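(* Let $N\ge1$, $0<s<1$, $p_1\le p<2$, and consider the Cauchy problem for $\partial_tu+\mathcal L_{s,p}u=0$ with initial data $u_0(x)=A|x|^\gamma$, $A>0$, with $-sp/(2-p)\le\gamma\le-N$. Then the construction of a minimal solution blows up everywhere for $t>0$: if $0\le u_{0,n}\in L^1(\mathbb R^N)\cap L^\infty(\mathbb R^N)$ is a nondecreasing sequence converging monotonically to $u_0$ and $u_n$ are the corresponding semigroup solutions, then $\lim_{n\to\infty}u_n(x,t)=\infty$ for every $x\in\mathbb R^N$ and $t>0$.
   Context: Here $p_1\in(1,2)$ is the root of $sp(p-1)=N(2-p)$ (it satisfies $p_c=2N/(N+s)<p_1<2$); $p<p_1$ is exactly the condition that $|x|^{-sp(p-1)/(2-p)}$ be locally integrable at the origin. Let $\Phi_p(z)=|z|^{p-2}z$ and $\mathcal L_{s,p}(u)(x)=P.V.\int_{\mathbb R^N}\frac{\Phi_p(u(x)-u(y))}{|x-y|^{N+sp}}\,dy$. In $L^2(\mathbb R^N)$ it is the subdifferential of the convex functional $J(u)=\frac1{2p}\iint\frac{|u(x)-u(y)|^p}{|x-y|^{N+sp}}\,dxdy$; it generates a contraction semigroup $S_t$ which extends to an order-preserving contraction semigroup on every $L^q(\mathbb R^N)$, $1\le q<\infty$; semigroup solutions are $S_tu_0$ with $u_0\in L^q(\mathbb R^N)$. *)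

(* Defs.v *)
From HB Require Import structures.
From mathcomp Require Import all_boot all_order all_algebra.
From mathcomp Require Import all_classical all_reals all_analysis.
Set Implicit Arguments.
Unset Strict Implicit.
Unset Printing Implicit Defensive.
Import Order.TTheory GRing.Theory Num.Theory.
Import numFieldNormedType.Exports.
Local Open Scope classical_set_scope.
Local Open Scope ring_scope.

(* R^n as n-tuples, with the product sigma-algebra of the Borel sets of R. *)
Notation Rn R n := (n.-tuple (measurableTypeR R)).

Section lebesgue_Rn.
Variable R : realType.

Definition consRn n (z : measurableTypeR R * Rn R n) : Rn R n.+1 :=
  [the n.+1.-tuple _ of z.1 :: z.2].

Lemma measurable_consRn n : measurable_fun setT (@consRn n).
Proof. exact: measurable_cons. Qed.

Definition unconsRn n (x : Rn R n.+1) : measurableTypeR R * Rn R n :=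
  (tnth x ord0, [tuple of behead x]).

Lemma measurable_unconsRn n : measurable_fun setT (@unconsRn n).
Proof.
apply/measurable_fun_pairP; split; first exact: measurable_tnth.
exact: measurable_behead.
Qed.

Lemma consRnK n : cancel (@consRn n) (@unconsRn n).
Proof. by case=> a x; congr pair; apply/val_inj. Qed.

Section step.
Variables (n : nat) (m : {sigma_finite_measure set (Rn R n) -> \bar R}).

Definition lebesgueS : set (Rn R n.+1) -> \bar R :=
  pushforward (lebesgue_measure \x m)%E (@consRn n).

Let lebesgueS0 : lebesgueS set0 = 0%E.
Proof. by rewrite /lebesgueS /pushforward preimage_set0 measure0. Qed.

Let lebesgueS_ge0 A : (0 <= lebesgueS A)%E.
Proof. by rewrite /lebesgueS /pushforward; exact: measure_ge0. Qed.

Let lebesgueS_sigma_additive : semi_sigma_additive lebesgueS.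
Proof.
move=> F mF tF mUF; rewrite /lebesgueS /pushforward preimage_bigcup.
apply: measure_semi_sigma_additive.
- by move=> k; rewrite -[X in measurable X]setTI; exact: measurable_consRn.
- apply/trivIsetP => /= i j _ _ ij; rewrite -preimage_setI.
  by move/trivIsetP : tF => /(_ _ _ _ _ ij) ->//; rewrite preimage_set0.
- by rewrite -preimage_bigcup -[X in measurable X]setTI; exact: measurable_consRn.
Qed.

HB.instance Definition _ := isMeasure.Build _ _ _ lebesgueS
  lebesgueS0 lebesgueS_ge0 lebesgueS_sigma_additive.

Let lebesgueS_sigma_finite : sigma_finite setT lebesgueS.
Proof.
have /sigma_finiteP[F [TF ndF Foo]] := sigma_finiteT (@lebesgue_measure R).
have /sigma_finiteP[G [TG ndG Goo]] := sigma_finiteT m.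
exists (fun i => @unconsRn n @^-1` (F i `*` G i)).
  rewrite -preimage_bigcup; apply/esym/seteqP; split=> // x _ /=.
  have [i _ Fi] : (\bigcup_i F i) (unconsRn x).1 by rewrite -TF.
  have [j _ Gj] : (\bigcup_i G i) (unconsRn x).2 by rewrite -TG.
  exists (maxn i j) => //; split.
  - by apply: (subsetPset _ _ (ndF _ _ (leq_maxl i j))).
  - by apply: (subsetPset _ _ (ndG _ _ (leq_maxr i j))).
move=> i; have [mF Fi] := Foo i; have [mG Gi] := Goo i; split.
  rewrite -[X in measurable X]setTI; apply: measurable_unconsRn => //.
  exact: measurableX.
rewrite /lebesgueS /pushforward -comp_preimage.
rewrite (_ : _ \o _ = id) ?preimage_id; last first.
  by apply/funext => z; exact: consRnK.
by rewrite product_measure1E// lte_mul_pinfty// ge0_fin_numE.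
Qed.

HB.instance Definition _ := Measure_isSigmaFinite.Build _ _ _ lebesgueS
  lebesgueS_sigma_finite.

End step.

Fixpoint lebesgueRn n : {sigma_finite_measure set (Rn R n) -> \bar R} :=
  match n with
  | 0 => \d_ ([tuple] : Rn R 0)
  | k.+1 => lebesgueS (lebesgueRn k)
  end.

Lemma lebesgueRn_box n (A : 'I_n -> set (measurableTypeR R)) :
  (forall i, measurable (A i)) ->
  lebesgueRn n [set x | forall i, A i (tnth x i)] =
  (\prod_(i < n) lebesgue_measure (A i))%E.
Proof.
elim: n A => [|n IH] A mA /=.
  rewrite big_ord0 diracE mem_set//.
  by case.
rewrite /lebesgueS /pushforward.
rewrite (_ : _ @^-1` _ = A ord0 `*`
   [set x | forall i, A (lift ord0 i) (tnth x i)]); last first.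
  apply/seteqP; split => -[a x] /=.
    move=> H; split; first by have := H ord0.
    by move=> i; have := H (lift ord0 i); rewrite tnthS.
  move=> [H0 H] i; case: (unliftP ord0 i) => [j ->|->//].
  by rewrite tnthS.
have mB : measurable
    [set x : Rn R n | forall i, A (lift ord0 i) (tnth x i)].
  rewrite (_ : [set x | _] = \bigcap_(i in [set: 'I_n])
    ((@tnth n (measurableTypeR R))^~ i @^-1` A (lift ord0 i))); last first.
    by apply/seteqP; split => x /= H i; [move=> _; exact: H|exact: (H i I)].
  apply: fin_bigcap_measurable; first exact: finite_finset.
  move=> i _; rewrite -[X in measurable X]setTI.
  exact: measurable_tnth.
rewrite big_ord_recl product_measure1E//.
by congr (_ * _)%E; exact: (IH (fun i => A (lift ord0 i))).
Qed.

End lebesgue_Rn.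

Section fractional_p_Laplacian.
Context {R : realType} {N : nat}.
Local Notation mu := (@lebesgueRn R N).
Implicit Types (x y : Rn R N) (u v xi : Rn R N -> R).

Definition edist x y : R :=
  Num.sqrt (\sum_(i < N) (tnth x i - tnth y i) ^+ 2).

Definition enorm x : R := Num.sqrt (\sum_(i < N) tnth x i ^+ 2).

Definition eball x (r : R) : set (Rn R N) := [set y | edist x y < r].

(* On the diagonal, a null set, the integrand is 0 / 0 = 0. *)
Definition energy (s p : R) u : \bar R :=
  ((2 * p)^-1%:E * \int[mu \x mu]_z
     (`|u z.1 - u z.2| `^ p / (edist z.1 z.2) `^ (N%:R + s * p))%:E)%E.

(* xi belongs to the subdifferential at u of the functional J on L^2. *)
Definition subdifferential (J : (Rn R N -> R) -> \bar R) u xi : Prop :=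
  [/\ u \in Lfun mu 2%:E, xi \in Lfun mu 2%:E, (J u < +oo)%E &
    forall v, v \in Lfun mu 2%:E ->
      (J u + (\int[mu]_x (xi x * (v x - u x)))%R%:E <= J v)%E].

(* u t = S_t u0 for the contraction semigroup generated in L^2 by minus the
   subdifferential of J, described by the theorem of Komura and Brezis: the
   orbit is the continuous curve on [0, +oo[ starting at u0 which, at every
   t > 0, has in L^2 a right derivative whose opposite belongs to the
   subdifferential at u t. *)
Definition gradient_flow (J : (Rn R N -> R) -> \bar R) u0
    (u : R -> Rn R N -> R) : Prop :=
  [/\ forall t, 0 <= t -> u t \in Lfun mu 2%:E,
      {ae mu, forall x, u 0 x = u0 x},
      forall t, 0 <= t ->
        'N[mu]_2%:E [EFin \o (fun x => u r x - u t x)%R]%E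
          @[r --> within [set r | 0 <= r] (nbhs t)] --> 0%E &
      forall t, 0 < t -> exists2 xi, subdifferential J (u t) xi &
        'N[mu]_2%:E [EFin \o (fun x => (u (t + h) x - u t x) / h + xi x)%R]%E
          @[h --> 0^'+] --> 0%E].

(* The semigroup solution of d_t u + L_{s,p} u = 0 for data in L^2; on data in
   the intersection of L^q and L^2 the extension of the semigroup to L^q is the
   L^2 one. *)
Definition semigroup_solution (s p : R) := gradient_flow (energy s p).

(* The value at x of an element of L^q: it does not depend on the
   representative, and it is v x whenever v is continuous at x. *)
Definition precise_value v x : \bar R :=
  limf_einf (fun r : R =>
    ((mu (eball x r))^-1 * \int[mu]_(y in eball x r) (v y)%:E)%E) 0^'+.

End fractional_p_Laplacian.

(* Main.v *)
Require Import Defs.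
From HB Require Import structures.
From mathcomp Require Import all_boot all_order all_algebra.
From mathcomp Require Import all_classical all_reals all_analysis measurable_realfun.
From mathcomp Require Import ring lra.
Require Import Defs.
Import Order.TTheory GRing.Theory Num.Theory.
Import numFieldNormedType.Exports.
Set Implicit Arguments.
Unset Strict Implicit.
Unset Printing Implicit Defensive.
Local Open Scope classical_set_scope.
Local Open Scope ring_scope.

(** Write [L] for the operator, [K x y] for its kernel [|x - y|^(-N - sp)], fix
    [t > 0] and let [f n] be the value at time [t] of the [n]-th solution.

    Weak formulation. All that is used of the evolution is that minus the right
    derivative is a subgradient of the energy. Differentiating the energy turns
    this into inequalities between integrands at pairs of points
    ([pairing_gain]), and the arguments below only produce such pointwise
    inequalities: a term at a pair which is gained, and an error. Comparison
    ([flow_comparison]) makes [f n] nondecreasing in [n]. Since [L] is homogeneous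
    of degree [p - 1], comparison with rescaled solutions bounds the time
    derivative of a nonnegative solution by [C u / t], so that all the [f n] satisfy
    [L f + c f >= 0] with the same [c] ([flow_supersolution]): from there on time
    is frozen.

    The mass at the origin becomes infinite. As [gamma <= -N] the initial masses
    near the origin tend to infinity ([initial_mass_unbounded]). They cannot leave
    instantaneously: when the equation is tested with [k(u) chi], where [chi] is a
    high power of a cutoff and [k] the derivative of a concave function, the
    dissipation absorbs the flux through the cutoff up to a power of [u] less than
    one. Gronwall's lemma then bounds the mass at time [t] from below by a fixed
    fraction of the initial one ([mass_lower_bound]); so [\int (f n) chi] tends to
    infinity.

    The long range interaction sees [\int_B f^(p-1)], a weaker quantity, and this
    is where [p1 <= p] enters. Assume that these integrals stay bounded. By
    Chebyshev's inequality the set where [f > a / 2] fills at most half of a ball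
    of radius [rho(a) = rho0 a^(-(p-1)/N)]. A point where [f = a] therefore
    dissipates an amount [a^(p-2+q) rho(a)^(-sp)] of the entropy [(1+f)^q]
    ([static_entropy]). This power of [a], [p - 2 + q + (p-1) s p / N], is at least [q]
    exactly when [N (2 - p) <= s p (p - 1)], that is when [p1 <= p]; monotonicity
    makes [(f n)^(p-1)] equi-integrable, so [rho0] can be taken small and
    [\int (1 + f)^q] is absorbed ([bounded_power]). With this bound in place of the
    one on [f^(p-1)] and [q] close to one, the same argument bounds [\int (f n) chi]
    ([bounded_mass]), a contradiction. Hence [\int_B (f n)^(p-1)] tends to infinity
    ([local_mass_unbounded]).

    Spreading. Let [x] be any point and [k] any level. When [\int_B f^(p-1)] is
    large, the points with [f + k |. - x| < 3k/4] are pulled up by [B] and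
    they fill a small set; De Giorgi's iteration on the levels between [3k/4] and
    [k/2] ([level_iteration]) shows that [f >= k/4] almost everywhere near [x]
    ([local_positivity]). So the averages of [f n] near [x], and with them its
    value at [x], exceed [k/4] for large [n]. *)

(** * Inequalities for real powers *)

Section real_inequalities.
Context {R : realType}.
Implicit Types (a b x y r p : R).

Lemma gt0_powRD x r p : 0 < x -> x `^ (r + p) = x `^ r * x `^ p.
Proof. by move=> x0; rewrite powRD// (gt_eqF x0) /= implybT. Qed.

Lemma powR_subadd x y r : 0 <= x -> 0 <= y -> 0 < r <= 1 ->
  (x + y) `^ r <= x `^ r + y `^ r.
Proof.
move=> x0 y0 /andP[r0 r1].
have [->|xy] := eqVneq (x + y) 0.
  by rewrite powR0 ?gt_eqF// addr_ge0// powR_ge0.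
have xyp : 0 < x + y by rewrite lt0r xy addr_ge0.
have H z : 0 <= z -> z <= x + y -> z / (x + y) * (x + y) `^ r <= z `^ r.
  move=> z0 zxy; have [->|zn0] := eqVneq z 0; first by rewrite !mul0r powR_ge0.
  have zp : 0 < z by rewrite lt0r zn0.
  have -> : z `^ r = (z / (x + y)) `^ r * (x + y) `^ r.
    by rewrite -powRM ?divr_ge0 1?ltW// divfK.
  rewrite ler_wpM2r ?powR_ge0// ger1_powR// divr_gt0//=.
  by rewrite ler_pdivrMr// mul1r.
have := lerD (H x x0 _) (H y y0 _).
by rewrite -mulrDl -mulrDl divff// mul1r; apply; rewrite ?lerDl ?lerDr.
Qed.

Lemma powR_subl x y r : 0 <= y <= x -> 0 < r <= 1 ->
  x `^ r - y `^ r <= (x - y) `^ r.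
Proof.
move=> /andP[y0 yx] r01; rewrite lerBlDr.
by rewrite -{1}(subrK y x) powR_subadd// subr_ge0.
Qed.

(** The duality map [a |-> |a|^(p-2) a] of the p-energy. *)
Definition Phi p a : R := Num.sg a * `|a| `^ (p - 1).

Lemma PhiN p a : Phi p (- a) = - Phi p a.
Proof. by rewrite /Phi sgrN normrN mulNr. Qed.

Lemma Phi_ge0 p a : 0 <= a -> Phi p a = a `^ (p - 1) * (0 < a)%R%:R.
Proof.
move=> a0; rewrite /Phi ger0_norm//.
have [->|an0] := eqVneq a 0; first by rewrite sgr0 mul0r ltxx mulr0.
have ap : 0 < a by rewrite lt0r an0.
by rewrite gtr0_sg// ap mul1r mulr1.
Qed.

Lemma Phi_pos p a : 1 < p -> 0 <= a -> Phi p a = a `^ (p - 1).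
Proof.
move=> p1 a0; rewrite Phi_ge0//; have [->|an0] := eqVneq a 0.
  by rewrite powR0 ?mul0r// subr_eq0 gt_eqF.
by rewrite lt0r an0 a0 mulr1.
Qed.

Lemma norm_Phi p a : 1 < p -> `|Phi p a| = `|a| `^ (p - 1).
Proof.
move=> p1; rewrite /Phi normrM normr_sg [X in _ * X]ger0_norm ?powR_ge0//.
have [->|an0] := eqVneq a 0; last by rewrite mul1r.
by rewrite normr0 powR0 ?mulr0// subr_eq0 gt_eqF.
Qed.

Lemma Phi_mul p a : 1 < p -> Phi p a * a = `|a| `^ p.
Proof.
move=> p1; have p0 : 0 < p by lra.
have [a0|a0] := leP 0 a.
  by rewrite Phi_pos// ger0_norm// mulrC mulr_powRB1.
have Na0 : 0 <= - a by lra.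
rewrite -[a]opprK PhiN mulrNN normrN (ger0_norm Na0).
by rewrite Phi_pos// mulrC mulr_powRB1.
Qed.

(** The duality map is only Hoelder continuous for [p < 2]; this replaces a
    second derivative of [|a|^p]. *)
Lemma Phi_holder p a b : 1 < p < 2 ->
  `|Phi p a - Phi p b| <= 2 * `|a - b| `^ (p - 1).
Proof.
move=> /andP[p1 p2]; have r01 : 0 < p - 1 <= 1 by lra.
have key x y : 0 <= y <= x -> `|Phi p x - Phi p y| <= 2 * `|x - y| `^ (p - 1).
  move=> /andP[y0 yx]; have x0 : 0 <= x by lra.
  rewrite !Phi_pos// ger0_norm ?subr_ge0; last first.
    by rewrite ge0_ler_powR// ?nnegrE; lra.
  apply: (@le_trans _ _ ((x - y) `^ (p - 1))); first by rewrite powR_subl ?y0.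
  rewrite [X in _ <= _ * X `^ _]ger0_norm ?subr_ge0//.
  have := powR_ge0 (x - y) (p - 1); lra.
have key2 x y : 0 <= x -> 0 <= y ->
    `|Phi p x - Phi p (- y)| <= 2 * `|x - - y| `^ (p - 1).
  move=> x0 y0; rewrite PhiN !opprK !Phi_pos// !ger0_norm ?addr_ge0 ?powR_ge0//.
  have : x `^ (p - 1) <= (x + y) `^ (p - 1).
    by rewrite ge0_ler_powR// ?nnegrE; lra.
  have : y `^ (p - 1) <= (x + y) `^ (p - 1).
    by rewrite ge0_ler_powR// ?nnegrE; lra.
  lra.
have key3 x y : 0 <= x -> 0 <= y -> `|Phi p x - Phi p y| <= 2 * `|x - y| `^ (p - 1).
  move=> x0 y0; have [xy|/ltW xy] := leP y x; first by apply: key; rewrite y0.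
  by rewrite distrC [X in _ <= _ * X `^ _]distrC; apply: key; rewrite x0.
have [a0|/ltW a0] := leP 0 a; have [b0|/ltW b0] := leP 0 b.
- exact: key3.
- by rewrite -[b]opprK; apply: key2; rewrite // oppr_ge0.
- rewrite distrC [X in _ <= _ * X `^ _]distrC -[a]opprK.
  by apply: key2; rewrite // oppr_ge0.
- have -> : Phi p a - Phi p b = - (Phi p (- a) - Phi p (- b)).
    by rewrite !PhiN; ring.
  have -> : a - b = - (- a - - b) by ring.
  by rewrite !normrN; apply: key3; rewrite oppr_ge0.
Qed.

(** Convexity of [|x|^p], with its tangent given by the duality map. *)
Lemma powR_tangent p x y : 1 < p ->
  `|x| `^ p + p * (Phi p x * (y - x)) <= `|y| `^ p.
Proof.
move=> p1; have p0 : 0 < p by lra.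
have pn0 : p != 0 by rewrite gt_eqF.
have q0 : 0 < p / (p - 1) by rewrite divr_gt0//; lra.
have Y : Phi p x * y <= `|y| `^ p / p + `|x| `^ p * ((p - 1) / p).
  apply: (@le_trans _ _ (`|y| * `|x| `^ (p - 1))).
    by rewrite (le_trans (ler_norm _))// normrM norm_Phi// mulrC.
  have := @conjugate_powR R `|y| (`|x| `^ (p - 1)) p (p / (p - 1)).
  rewrite normr_ge0 powR_ge0 -powRrM => /(_ isT isT p0 q0).
  have -> : (p - 1) * (p / (p - 1)) = p by field; rewrite subr_eq0 gt_eqF.
  rewrite invf_div; apply.
  by field.
rewrite mulrBr Phi_mul// mulrBr.
have := ler_pM2l p0 _ _; move=> H; rewrite -H in Y.
have e : p * (`|y| `^ p / p + `|x| `^ p * ((p - 1) / p)) = `|y| `^ p + `|x| `^ p * (p - 1).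
  by field.
rewrite e in Y; move: Y; set A := p * (Phi p x * y); lra.
Qed.

(** First order expansion of [|a|^p] with a remainder that is independent of
    [a]: the power [|b|^p] is still superlinear in [b]. *)
Lemma powR_add_le p a b : 1 < p < 2 ->
  `|a + b| `^ p <= `|a| `^ p + p * (Phi p a * b) + 2 * p * `|b| `^ p.
Proof.
move=> /andP[p1 p2]; have p0 : 0 < p by lra.
have := powR_tangent (a + b) a p1.
rewrite (_ : a - (a + b) = - b); last by ring.
have : Phi p (a + b) * b <= Phi p a * b + 2 * `|b| `^ p.
  rewrite -lerBlDl -mulrBl (le_trans (ler_norm _))// normrM.
  have := @Phi_holder p (a + b) a; rewrite p1 p2 => /(_ isT).
  rewrite (_ : a + b - a = b); last by ring.
  move=> H; rewrite (le_trans (ler_wpM2r (normr_ge0 b) H))//.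
  by rewrite -mulrA [_ * `|b|]mulrC mulr_powRB1.
set X := Phi p (a + b) * b; set Y := Phi p a * b; move=> H1.
rewrite mulrN -/X => H2.
have : p * X <= p * (Y + 2 * `|b| `^ p) by rewrite ler_pM2l.
lra.
Qed.

Lemma powR_norm_add p a b : 1 < p < 2 ->
  `|a + b| `^ p <= 4 * (`|a| `^ p + `|b| `^ p).
Proof.
move=> /andP[p1 p2]; have p0 : 0 <= p by lra.
have H x y : `|x| <= `|y| -> `|x + y| `^ p <= 4 * `|y| `^ p.
  move=> xy; apply: (@le_trans _ _ ((2 * `|y|) `^ p)).
    rewrite ge0_ler_powR ?nnegrE ?mulr_ge0//.
    by rewrite (le_trans (ler_normD _ _))// mulr_natl mulr2n lerD2r.
  rewrite powRM// ler_wpM2r ?powR_ge0//.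
  apply: (@le_trans _ _ (2 `^ 2%:R)); first by apply: ler_powR; [rewrite ler1n|lra].
  by rewrite powR_mulrn// -natrX.
have [ab|/ltW ab] := leP `|a| `|b|.
  rewrite (le_trans (H _ _ ab))// ler_pM2l// lerDr powR_ge0//.
by rewrite addrC (le_trans (H _ _ ab))// ler_pM2l// lerDl powR_ge0.
Qed.

Lemma norm_Phi_mul_le p a b : 1 < p ->
  `|Phi p a * b| <= `|a| `^ p + `|b| `^ p.
Proof.
move=> p1; have p0 : 0 < p by lra.
rewrite normrM norm_Phi//.
have [ab|/ltW ab] := leP `|a| `|b|.
  apply: (@le_trans _ _ (`|b| `^ (p - 1) * `|b|)).
    by rewrite ler_wpM2r// ge0_ler_powR ?nnegrE//; lra.
  by rewrite mulrC mulr_powRB1// lerDr powR_ge0.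
apply: (@le_trans _ _ (`|a| `^ (p - 1) * `|a|)).
  by rewrite ler_wpM2l// powR_ge0.
by rewrite mulrC mulr_powRB1// lerDl powR_ge0.
Qed.

(** Convexity: points symmetric about the middle of an interval carry less than
    its ends. *)
Lemma powR_between p x A B : 1 < p -> A <= x <= B ->
  `|x| `^ p + `|A + B - x| `^ p <= `|A| `^ p + `|B| `^ p.
Proof.
move=> p1 /andP[Ax xB].
have [AB|AB] := eqVneq A B.
  have -> : x = A by lra.
  have -> : A + B - A = B by ring.
  by [].
have BA : 0 < B - A by lra.
pose t := (B - x) / (B - A).
have t0 : 0 <= t by rewrite divr_ge0//; lra.
have t1 : 0 <= 1 - t.
  rewrite subr_ge0 ler_pdivrMr//; lra.
have xE : t * A + (1 - t) * B = x by rewrite /t; field; lra.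
have conv (c d : R) : 0 <= c -> 0 <= d -> c + d = 1 ->
    `|c * A + d * B| `^ p <= c * `|A| `^ p + d * `|B| `^ p.
  move=> c0 d0 cd.
  have := powR_tangent (c * A + d * B) A p1.
  have := powR_tangent (c * A + d * B) B p1.
  set z := c * A + d * B; set P := Phi p z.
  move=> /(ler_wpM2l d0) H1 /(ler_wpM2l c0) H2.
  have := lerD H2 H1.
  have -> : c * (`|z| `^ p + p * (P * (A - z))) + d * (`|z| `^ p + p * (P * (B - z)))
     = (c + d) * `|z| `^ p + p * P * (c * A + d * B - (c + d) * z) by ring.
  by rewrite cd !mul1r -/z subrr mulr0 addr0.
have := conv _ _ t0 t1 (subrKC _ _); rewrite xE.
have := conv _ _ t1 t0 (subrK _ _).
have -> : (1 - t) * A + t * B = A + B - x by rewrite -xE; ring.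
set a := `|A| `^ p; set b := `|B| `^ p; set c := `|x| `^ p; lra.
Qed.

(** The p-energy is submodular because this holds at each pair of points. *)
Lemma powR_minmax p a b c d : 1 < p ->
  `|Num.min a b - Num.min c d| `^ p + `|Num.max a b - Num.max c d| `^ p
  <= `|a - c| `^ p + `|b - d| `^ p.
Proof.
move=> p1.
have [ab|ba] := leP a b; have [cd|dc] := leP c d => //.
- have := @powR_between p (a - d) (a - c) (b - d) p1.
  have -> : a - c + (b - d) - (a - d) = b - c by ring.
  by apply; lra.
- have := @powR_between p (b - c) (b - d) (a - c) p1.
  have -> : b - d + (a - c) - (b - c) = a - d by ring.
  by rewrite [`|a - c| `^ p + _]addrC; apply; lra.
- by rewrite addrC.
Qed.

End real_inequalities.

(** * Euclidean balls and kernels *)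

Section euclidean_distance.
Context {R : realType} {N : nat}.
Implicit Types (x y : Rn R N) (r : R).

Lemma sqrt_sum_sqr_triangle (a b : 'I_N -> R) :
  Num.sqrt (\sum_i (a i + b i) ^+ 2) <=
  Num.sqrt (\sum_i a i ^+ 2) + Num.sqrt (\sum_i b i ^+ 2).
Proof.
set A := \sum_i a i ^+ 2; set B := \sum_i b i ^+ 2.
have A0 : 0 <= A by apply: sumr_ge0 => i _; exact: sqr_ge0.
have B0 : 0 <= B by apply: sumr_ge0 => i _; exact: sqr_ge0.
set X := Num.sqrt A; set Y := Num.sqrt B.
have X0 : 0 <= X by exact: sqrtr_ge0.
have Y0 : 0 <= Y by exact: sqrtr_ge0.
have XA : X ^+ 2 = A by rewrite sqr_sqrtr.
have YB : Y ^+ 2 = B by rewrite sqr_sqrtr.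
have CS : \sum_i a i * b i <= X * Y.
  have [XY0|XY0] := eqVneq (X * Y) 0.
    have zero (c : 'I_N -> R) : \sum_i c i ^+ 2 = 0 -> forall i, c i = 0.
      move=> /eqP; rewrite psumr_eq0; last by move=> i _; exact: sqr_ge0.
      by move=> /allP H i; apply/eqP; rewrite -sqrf_eq0; apply: H; rewrite mem_index_enum.
    rewrite XY0 big1// => i _; move/eqP: XY0; rewrite mulf_eq0 => /orP[]/eqP E.
      by rewrite (zero a) ?mul0r//; rewrite -/A -XA E expr0n.
    by rewrite (zero b) ?mulr0//; rewrite -/B -YB E expr0n.
  have XYp : 0 < X * Y by rewrite lt0r XY0 mulr_ge0.
  rewrite -(ler_pM2l XYp) -subr_ge0.
  have : 0 <= \sum_i (Y * a i - X * b i) ^+ 2.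
    by apply: sumr_ge0 => i _; exact: sqr_ge0.
  have -> : \sum_i (Y * a i - X * b i) ^+ 2 =
      Y ^+ 2 * A + X ^+ 2 * B - 2 * (X * Y * \sum_i a i * b i).
    rewrite /A /B !mulr_sumr -big_split/= -sumrB; apply: eq_bigr => i _; ring.
  rewrite -XA -YB; lra.
rewrite -(@ler_pXn2r _ 2) ?nnegrE ?addr_ge0 ?sqrtr_ge0//.
rewrite sqr_sqrtr; last by apply: sumr_ge0 => i _; exact: sqr_ge0.
have -> : \sum_i (a i + b i) ^+ 2 = A + B + 2 * \sum_i a i * b i.
  rewrite /A /B mulr_sumr -!big_split/=; apply: eq_bigr => i _; ring.
rewrite -XA -YB; nra.
Qed.

Lemma edist_ge0 x y : 0 <= edist x y.
Proof. exact: sqrtr_ge0. Qed.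

Lemma edistC x y : edist x y = edist y x.
Proof. by congr Num.sqrt; apply: eq_bigr => i _; rewrite -sqrrN opprB. Qed.

Lemma edist_triangle y x z : edist x z <= edist x y + edist y z.
Proof.
rewrite /edist; apply: le_trans (sqrt_sum_sqr_triangle _ _).
by rewrite le_eqVlt; apply/orP; left; apply/eqP; congr Num.sqrt;
  apply: eq_bigr => i _; congr (_ ^+ 2); ring.
Qed.

Lemma edist_coord x y i : `|tnth x i - tnth y i| <= edist x y.
Proof.
rewrite -sqrtr_sqr ler_wsqrtr// (bigD1 i)//= lerDl.
by apply: sumr_ge0 => j _; exact: sqr_ge0.
Qed.

(** The cube of half side [r / (2N)] lies in the ball of radius [r]. *)
Lemma edist_lt_coord x y r : 0 < r ->
  (forall i, `|tnth x i - tnth y i| < r / (2 * N%:R)) -> edist x y < r.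
Proof.
move=> r0 H; apply: (@le_lt_trans _ _ (r / 2)); last by lra.
have r20 : 0 <= r / 2 by lra.
rewrite -(@ler_pXn2r _ 2) ?nnegrE ?edist_ge0// sqr_sqrtr; last first.
  by apply: sumr_ge0 => i _; exact: sqr_ge0.
have [N0|N0] := posnP N.
  rewrite big1 ?sqr_ge0// => i; by have := ltn_ord i; rewrite [in X in (_ < X)%N]N0.
have N1 : 1 <= N%:R :> R by rewrite ler1n.
have -> : (r / 2) ^+ 2 = \sum_(i < N) (r / 2) ^+ 2 / N%:R.
  rewrite sumr_const card_ord -[RHS]mulr_natr divfK// gt_eqF//; lra.
apply: ler_sum => i _; rewrite -[leLHS]ger0_norm ?sqr_ge0// normrX.
have := ltW (H i) => h.
apply: (@le_trans _ _ ((r / (2 * N%:R)) ^+ 2)).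
  by rewrite ler_pXn2r ?nnegrE// divr_ge0//; lra.
rewrite invfM mulrA exprMn ler_wpM2l ?sqr_ge0// expr2.
by rewrite -[leRHS]mulr1 ler_wpM2l ?invf_le1 ?invr_ge0//; lra.
Qed.

Definition zeroRn : Rn R N := [tuple of nseq N 0].

Lemma enormE x : enorm x = edist zeroRn x.
Proof.
rewrite edistC /enorm /edist; congr Num.sqrt; apply: eq_bigr => i _.
by rewrite tnth_nseq subr0.
Qed.

Lemma measurable_edist :
  measurable_fun setT (fun z : Rn R N * Rn R N => edist z.1 z.2).
Proof.
have -> : (fun z : Rn R N * Rn R N => edist z.1 z.2) = fun z =>
    (\sum_(i < N) (tnth z.1 i - tnth z.2 i) ^+ 2) `^ 2^-1.
  by apply/funext => z; rewrite powR12_sqrt// sumr_ge0// => i _; exact: sqr_ge0.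
apply: (@measurableT_comp _ _ _ _ _ _ (@powR R ^~ 2^-1)) => //.
apply: measurable_sum => i; apply: measurable_funX; apply: measurable_funB.
  by apply: (measurableT_comp (measurable_tnth _)).
by apply: (measurableT_comp (measurable_tnth _)).
Qed.

Lemma measurable_edistl x : measurable_fun setT (edist x).
Proof.
apply: (measurableT_comp measurable_edist (g := fun y => (x, y))).
exact: pair1_measurable.
Qed.

Lemma measurable_eball x r : measurable (eball x r).
Proof.
rewrite (_ : eball x r = edist x @^-1` `]-oo, r[); last first.
  by apply/seteqP; split => y /=; rewrite in_itv.
rewrite -[X in measurable X]setTI; exact: measurable_edistl.
Qed.

Local Notation mu := (@lebesgueRn R N).

Lemma measurable_box (A : 'I_N -> set (measurableTypeR R)) :
  (forall i, measurable (A i)) ->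
  measurable [set x : Rn R N | forall i, A i (tnth x i)].
Proof.
move=> mA; rewrite (_ : [set x | _] = \bigcap_(i in [set: 'I_N])
  ((@tnth N (measurableTypeR R))^~ i @^-1` A i)); last first.
  by apply/seteqP; split => x /= H i; [move=> _; exact: H|exact: (H i I)].
apply: fin_bigcap_measurable; first exact: finite_finset.
by move=> i _; rewrite -[X in measurable X]setTI; exact: measurable_tnth.
Qed.

Lemma lebesgueRn_cube x (l : R) : 0 < l ->
  mu [set y | forall i, `]tnth x i - l, tnth x i + l[%classic (tnth y i)] =
  ((2 * l) ^+ N)%:E.
Proof.
move=> r0; pose A i : set (measurableTypeR R) := `]tnth x i - l, tnth x i + l[%classic.
have mA i : measurable (A i) by exact: measurable_itv.
rewrite (@lebesgueRn_box R N A mA) (eq_bigr (fun=> (2 * l)%:E)).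
  by rewrite prodEFin prodr_const card_ord.
move=> i _; rewrite lebesgue_measure_itv/= lte_fin ifT; last lra.
by rewrite -EFinD; congr EFin; lra.
Qed.

Lemma measurable_cube x (l : R) : measurable
  [set y : Rn R N | forall i, `]tnth x i - l, tnth x i + l[%classic (tnth y i)].
Proof.
apply: (@measurable_box (fun i => `]tnth x i - l, tnth x i + l[%classic)) => i.
exact: measurable_itv.
Qed.

(** Volume of the cube of side [1 / N], which lies in the unit ball. *)
Definition ballc : R := N%:R ^- N.

Lemma ballc_gt0 : (0 < N)%N -> 0 < ballc.
Proof. by move=> N0; rewrite invr_gt0 exprn_gt0 ?ltr0n. Qed.

Lemma eball_le x r : 0 < r -> (mu (eball x r) <= ((2 * r) ^+ N)%:E)%E.
Proof.
move=> r0; rewrite -(lebesgueRn_cube x r0); apply: le_measure; rewrite ?inE.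
- exact: measurable_eball.
- exact: measurable_cube.
- move=> y /= xy i; rewrite in_itv/= -ltr_distl distrC.
  exact: le_lt_trans (edist_coord _ _ _) xy.
Qed.

Lemma eball_ge x r : (0 < N)%N -> 0 < r -> ((ballc * r ^+ N)%:E <= mu (eball x r))%E.
Proof.
move=> N0 r0; have N0' : 0 < N%:R :> R by rewrite ltr0n.
have l0 : 0 < r / (2 * N%:R) by rewrite divr_gt0//; lra.
rewrite (_ : ballc * _ = (2 * (r / (2 * N%:R))) ^+ N); last first.
  rewrite /ballc -exprVn -exprMn; congr (_ ^+ _); field; lra.
rewrite -(lebesgueRn_cube x l0); apply: le_measure; rewrite ?inE.
- exact: measurable_cube.
- exact: measurable_eball.
- move=> y /= H; apply: edist_lt_coord => // i.
  by rewrite distrC ltr_distl; have := H i; rewrite in_itv.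
Qed.

Lemma eball_fin x r : (mu (eball x r) < +oo)%E.
Proof.
apply: (@le_lt_trans _ _ (mu (eball x (`|r| + 1)))).
  apply: le_measure; rewrite ?inE; [exact: measurable_eball..|].
  by move=> y; rewrite /eball/= => /lt_le_trans; apply; have := ler_norm r; lra.
by rewrite (le_lt_trans (eball_le _ _)) ?ltry// ltr_wpDl.
Qed.

(** Integration over dyadic annuli, in the form used for kernels: the [k]-th
    annulus, of radius [r k], contributes at most [B q^k]. *)
Lemma integral_le_series (g : Rn R N -> R) (q B : R) (a r : nat -> R) x :
  measurable_fun setT g -> (forall y, 0 <= g y) -> 0 <= q < 1 ->
  (forall k, 0 <= a k) -> (forall k, 0 < r k) ->
  (forall y, g y != 0 -> exists k, edist x y < r k /\ g y <= a k) ->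
  (forall k, a k * (2 * r k) ^+ N <= B * q ^+ k) ->
  (\int[mu]_y (g y)%:E <= (B / (1 - q))%:E)%E.
Proof.
move=> mg g0 /andP[q0 q1] a0 r0 H ar.
pose h k y := (a k * \1_(eball x (r k)) y)%:E.
have mh k : measurable_fun setT (h k).
  apply/measurable_EFinP; apply: measurable_funM => //.
  by apply: measurable_indic; exact: measurable_eball.
have h0 k y : (0 <= h k y)%E by rewrite lee_fin mulr_ge0.
apply: (@le_trans _ _ (\int[mu]_y (\sum_(0 <= k <oo) h k y))%E).
  apply: ge0_le_integral => //.
  - by move=> y _; rewrite lee_fin.
  - exact/measurable_EFinP.
  - by apply: ge0_emeasurable_sum => //.
  move=> y _; have [->|/H[k [xy gk]]] := eqVneq (g y) 0; first exact: nneseries_ge0.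
  rewrite (@nneseriesD1 _ _ k)//.
  apply: (@le_trans _ _ (h k y)); last by rewrite leeDl// nneseries_ge0.
  by rewrite /h indicE mem_set// mulr1 lee_fin.
rewrite integral_nneseries//.
apply: (@le_trans _ _ (\sum_(0 <= k <oo) (B * q ^+ k)%:E)%E).
  apply: lee_nneseries => [k _ _|k _]; first by apply: integral_ge0 => y _.
  rewrite (_ : (\int[mu]_y h k y)%E = ((a k)%:E * mu (eball x (r k)))%E); last first.
    rewrite (eq_integral (fun y => ((a k)%:E * (\1_(eball x (r k)) y)%:E)%E)); last first.
      by move=> y _; rewrite -EFinM.
    rewrite ge0_integralZl//; last 2 first.
      apply/measurable_EFinP; apply: measurable_indic; exact: measurable_eball.
      by rewrite lee_fin.
    by rewrite integral_indic ?setIT//; exact: measurable_eball.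
  apply: (@le_trans _ _ ((a k)%:E * ((2 * r k) ^+ N)%:E)%E).
    by rewrite lee_wpmul2l// ?lee_fin// eball_le.
  by rewrite -EFinM lee_fin.
have Bq k : 0 <= B * q ^+ k.
  by apply: le_trans (ar k); rewrite mulr_ge0// exprn_ge0// mulr_ge0// ltW.
have B0 : 0 <= B by have := Bq 0%N; rewrite expr0 mulr1.
apply: lime_le; first by apply: is_cvg_nneseries => k _ _; rewrite lee_fin.
apply: nearW => n; rewrite sumEFin lee_fin -mulr_sumr ler_wpM2l//.
rewrite -[leRHS]mul1r ler_pdivlMr ?subr_gt0// big_mkord mulrC.
have := subrX1 q n => E.
by have := exprn_ge0 n q0; lra.
Qed.

Lemma dyadic_below (d r : R) : 0 < d < r ->
  exists k, r / 2 ^+ k.+1 <= d < r / 2 ^+ k.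
Proof.
move=> /andP[d0 dr]; have r0 : 0 < r by lra.
have ex : exists k, r / 2 ^+ k.+1 <= d.
  have [n rn] : exists n : nat, r / d < n%:R.
    by exists (Num.truncn (r / d)).+1; exact: truncnS_gt.
  exists n; rewrite ler_pdivrMr ?exprn_gt0// mulrC -ler_pdivrMr//.
  rewrite (le_trans (ltW rn))// -natrX ler_nat.
  by rewrite ltnW// (ltn_trans (ltnSn n))// ltn_expl.
exists (ex_minn ex); case: ex_minnP => k -> kmin /=.
case: k kmin => [|k] kmin; first by rewrite expr0 divr1.
by rewrite ltNge; apply/negP => /kmin; rewrite ltnn.
Qed.

Lemma dyadic_above (d r : R) : 0 < r -> r <= d ->
  exists k, r * 2 ^+ k <= d < r * 2 ^+ k.+1.
Proof.
move=> r0 rd; have d0 : 0 < d by lra.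
have ex : exists k, d < r * 2 ^+ k.+1.
  have [n dn] : exists n : nat, d / r < n%:R.
    by exists (Num.truncn (d / r)).+1; exact: truncnS_gt.
  exists n; rewrite mulrC -ltr_pdivrMr//.
  rewrite (lt_le_trans dn)// -natrX ler_nat.
  by rewrite ltnW// (ltn_trans (ltnSn n))// ltn_expl.
exists (ex_minn ex); case: ex_minnP => k -> kmin /=; rewrite andbT.
case: k kmin => [|k] kmin; first by rewrite expr0 mulr1.
by rewrite leNgt; apply/negP => /kmin; rewrite ltnn.
Qed.

(** The kernel of an operator of differential order [a]. *)
Definition kernel (a : R) x y : R := (edist x y `^ (N%:R + a))^-1.

Lemma kernel_ge0 a x y : 0 <= kernel a x y.
Proof. by rewrite invr_ge0 powR_ge0. Qed.

Lemma kernelC a x y : kernel a x y = kernel a y x.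
Proof. by rewrite /kernel edistC. Qed.

Lemma measurable_kernel a :
  measurable_fun setT (fun z : Rn R N * Rn R N => kernel a z.1 z.2).
Proof.
have -> : (fun z : Rn R N * Rn R N => kernel a z.1 z.2) =
    (fun z => edist z.1 z.2 `^ (- (N%:R + a))).
  by apply/funext => z; rewrite powRN.
apply: (@measurableT_comp _ _ _ _ _ _ (@powR R ^~ (- (N%:R + a)))) => //.
exact: measurable_edist.
Qed.

Lemma measurable_kernell a x : measurable_fun setT (kernel a x).
Proof.
apply: (measurableT_comp (measurable_kernel a) (g := fun y => (x, y))).
exact: pair1_measurable.
Qed.

Lemma kernel_ge a x y (r : R) : 0 < a -> 0 < edist x y <= r ->
  (r `^ (N%:R + a))^-1 <= kernel a x y.
Proof.
move=> a0 /andP[d0 dr]; have Na : 0 <= N%:R + a by rewrite addr_ge0// ltW.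
rewrite lef_pV2 ?posrE ?powR_gt0//; last lra.
by rewrite ge0_ler_powR ?nnegrE//; lra.
Qed.

Lemma kernel_le a x y (r : R) : 0 < a -> 0 < r <= edist x y ->
  kernel a x y <= (r `^ (N%:R + a))^-1.
Proof.
move=> a0 /andP[d0 dr]; have Na : 0 <= N%:R + a by rewrite addr_ge0// ltW.
rewrite lef_pV2 ?posrE ?powR_gt0//; last lra.
by rewrite ge0_ler_powR ?nnegrE//; lra.
Qed.

Let powR2X (b : R) k : (2 ^+ k) `^ b = (2 `^ b) ^+ k :> R.
Proof. by rewrite -powR_mulrn// powRAC powR_mulrn// powR_ge0. Qed.

Let powR2_gt1 (b : R) : 0 < b -> 1 < 2 `^ b.
Proof.
move=> b0; have := @gt0_ltr_powR R b b0 1 2.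
by rewrite powR1; apply; rewrite ?nnegrE// ltr1n.
Qed.

(** The singularity of the kernel is integrable against [|x - y|^p], the size of
    the increments of Lipschitz functions. *)
Lemma kernel_near (a p : R) : 0 < a < p -> exists2 C, 0 < C &
  forall x r, 0 < r -> (\int[mu]_y
    (edist x y `^ p * kernel a x y * \1_(eball x r) y)%:E <= (C * r `^ (p - a))%:E)%E.
Proof.
move=> /andP[a0 ap]; pose q := (2 `^ (p - a))^-1 : R.
have q0 : 0 < q by rewrite invr_gt0 powR_gt0.
have q1 : q < 1.
  rewrite invf_lt1 ?powR_gt0//.
  by apply: powR2_gt1; lra.
exists (4 ^+ N * 2 `^ a / (1 - q)).
  by rewrite divr_gt0 ?mulr_gt0 ?exprn_gt0 ?powR_gt0//; lra.
move=> x r r0.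
rewrite mulrAC.
apply: (@integral_le_series _ q _
  (fun k => (r / 2 ^+ k) `^ p * ((r / 2 ^+ k.+1) `^ (N%:R + a))^-1)
  (fun k => r / 2 ^+ k) x).
- apply: measurable_funM; last by apply: measurable_indic; exact: measurable_eball.
  apply: measurable_funM; last exact: measurable_kernell.
  apply: (@measurableT_comp _ _ _ _ _ _ (@powR R ^~ p)) => //.
  exact: measurable_edistl.
- by move=> y; rewrite !mulr_ge0 ?powR_ge0 ?kernel_ge0.
- by rewrite ltW.
- by move=> k; rewrite mulr_ge0 ?invr_ge0 ?powR_ge0.
- by move=> k; rewrite divr_gt0 ?exprn_gt0.
- move=> y; have [yr|yr] := pselect (eball x r y); last first.
    by rewrite indicE memNset// mulr0 eqxx.
  rewrite indicE mem_set// mulr1 => d0.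
  have d0' : 0 < edist x y.
    rewrite lt0r edist_ge0 andbT; apply: contraNneq d0 => ->.
    by rewrite powR0 ?mul0r// gt_eqF//; lra.
  have [k /andP[k1 k2]] : exists k, r / 2 ^+ k.+1 <= edist x y < r / 2 ^+ k.
    by apply: dyadic_below; rewrite d0'.
  exists k; split => //; rewrite ler_pM ?powR_ge0 ?kernel_ge0//.
    by rewrite ge0_ler_powR ?nnegrE ?edist_ge0//; lra.
  by apply: kernel_le => //; rewrite k1 divr_gt0 ?exprn_gt0.
- move=> k; set t := r / 2 ^+ k.
  have t0 : 0 < t by rewrite divr_gt0 ?exprn_gt0.
  have -> : r / 2 ^+ k.+1 = t / 2 by rewrite /t exprSr invfM mulrA.
  set u := t / 2; have u0 : 0 < u by rewrite divr_gt0.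
  have tu : t = 2 * u by rewrite mulrC divfK.
  have -> : r `^ (p - a) = t `^ (p - a) * (2 `^ (p - a)) ^+ k.
    by rewrite -powR2X -powRM ?exprn_ge0// 1?ltW//; rewrite /t divfK// gt_eqF ?exprn_gt0.
  have -> : t `^ p = t `^ (p - a) * (2 `^ a * u `^ a).
    by rewrite -powRM ?(ltW u0)// -tu -gt0_powRD// subrK.
  have -> : u `^ (N%:R + a) = u ^+ N * u `^ a.
    by rewrite gt0_powRD// powR_mulrn// ltW.
  have -> : (2 * t) ^+ N = 4 ^+ N * u ^+ N.
    by rewrite tu -exprMn; congr (_ ^+ _); ring.
  have ua : u `^ a != 0 by rewrite gt_eqF// powR_gt0.
  have uN : u ^+ N != 0 by rewrite gt_eqF// exprn_gt0.
  have ek : (2 `^ (p - a)) ^+ k * q ^+ k = 1.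
    by rewrite -exprMn /q divff ?expr1n// gt_eqF ?powR_gt0.
  rewrite le_eqVlt; apply/orP; left; apply/eqP.
  rewrite -(mulrA _ _ (q ^+ k)) -(mulrA _ _ (q ^+ k)) ek mulr1.
  by field; rewrite ua uN.
Qed.

Lemma kernel_far (a : R) : 0 < a -> exists2 C, 0 < C &
  forall x r, 0 < r -> (\int[mu]_y
    (kernel a x y * \1_(~` eball x r) y)%:E <= (C * r `^ (- a))%:E)%E.
Proof.
move=> a0; pose q := (2 `^ a)^-1 : R.
have q0 : 0 < q by rewrite invr_gt0 powR_gt0.
have q1 : q < 1.
  rewrite invf_lt1 ?powR_gt0//.
  exact: powR2_gt1.
exists (4 ^+ N / (1 - q)).
  by rewrite divr_gt0 ?exprn_gt0//; lra.
move=> x r r0.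
rewrite mulrAC.
apply: (@integral_le_series _ q _
  (fun k => ((r * 2 ^+ k) `^ (N%:R + a))^-1)
  (fun k => r * 2 ^+ k.+1) x).
- apply: measurable_funM; first exact: measurable_kernell.
  by apply: measurable_indic; apply: measurableC; exact: measurable_eball.
- by move=> y; rewrite mulr_ge0 ?kernel_ge0.
- by rewrite ltW.
- by move=> k; rewrite invr_ge0 ?powR_ge0.
- by move=> k; rewrite mulr_gt0 ?exprn_gt0.
- move=> y; have [yr|yr] := pselect ((~` eball x r) y); last first.
    by rewrite indicE memNset// mulr0 eqxx.
  rewrite indicE mem_set// mulr1 => _.
  have ry : r <= edist x y by rewrite leNgt; apply/negP.
  have [k /andP[k1 k2]] := dyadic_above r0 ry.
  exists k; split => //.
  by apply: kernel_le => //; rewrite k1 mulr_gt0 ?exprn_gt0.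
- move=> k; set t := r * 2 ^+ k.
  have t0 : 0 < t by rewrite mulr_gt0 ?exprn_gt0.
  have -> : r * 2 ^+ k.+1 = 2 * t by rewrite /t exprS mulrCA.
  rewrite le_eqVlt; apply/orP; left; apply/eqP.
  have -> : r `^ (- a) = t `^ (- a) * (2 `^ a) ^+ k.
    rewrite -powR2X /t powRM ?exprn_ge0// 1?ltW// -mulrA -gt0_powRD ?exprn_gt0//.
    by rewrite addNr powRr0 mulr1.
  rewrite powRN.
  have -> : t `^ (N%:R + a) = t ^+ N * t `^ a.
    by rewrite gt0_powRD// powR_mulrn// ltW.
  have -> : (2 * (2 * t)) ^+ N = 4 ^+ N * t ^+ N.
    by rewrite -exprMn; congr (_ ^+ _); ring.
  have ta : t `^ a != 0 by rewrite gt_eqF// powR_gt0.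
  have tN : t ^+ N != 0 by rewrite gt_eqF// exprn_gt0.
  have ek : (2 `^ a) ^+ k * q ^+ k = 1.
    by rewrite -exprMn /q divff ?expr1n// gt_eqF ?powR_gt0.
  rewrite -(mulrA _ _ (q ^+ k)) -(mulrA _ _ (q ^+ k)) ek mulr1.
  by field; rewrite ta tN.
Qed.

End euclidean_distance.

(** * Integrals of nonnegative functions *)

Section integral_toolbox.
Context {d} {T : measurableType d} {R : realType}.
Variable mu : {measure set T -> \bar R}.
Implicit Types (f g h : T -> R).

Lemma int_le f g : measurable_fun setT f -> measurable_fun setT g ->
  (forall x, 0 <= f x) -> (forall x, f x <= g x) ->
  (\int[mu]_x (f x)%:E <= \int[mu]_x (g x)%:E)%E.
Proof.
move=> mf mg f0 fg; apply: ge0_le_integral => //.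
- by move=> x _; rewrite lee_fin.
- exact/measurable_EFinP.
- exact/measurable_EFinP.
- by move=> x _; rewrite lee_fin.
Qed.

Lemma int_ge0 f : (forall x, 0 <= f x) -> (0 <= \int[mu]_x (f x)%:E)%E.
Proof. by move=> f0; apply: integral_ge0 => x _; rewrite lee_fin. Qed.

Lemma intD f g : measurable_fun setT f -> measurable_fun setT g ->
  (forall x, 0 <= f x) -> (forall x, 0 <= g x) ->
  (\int[mu]_x (f x + g x)%:E = \int[mu]_x (f x)%:E + \int[mu]_x (g x)%:E)%E.
Proof.
move=> mf mg f0 g0; under eq_integral do rewrite EFinD.
by apply: ge0_integralD => //; try (exact/measurable_EFinP);
  move=> x _; rewrite lee_fin.
Qed.

Lemma intZ c f : measurable_fun setT f -> 0 <= c -> (forall x, 0 <= f x) ->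
  (\int[mu]_x (c * f x)%:E = c%:E * \int[mu]_x (f x)%:E)%E.
Proof.
move=> mf c0 f0; under eq_integral do rewrite EFinM.
by apply: ge0_integralZl => //; try (exact/measurable_EFinP);
  move=> *; rewrite lee_fin.
Qed.

Lemma int_integrable f g : measurable_fun setT f -> measurable_fun setT g ->
  (forall x, `|f x| <= g x) -> (\int[mu]_x (g x)%:E < +oo)%E ->
  mu.-integrable setT (EFin \o f).
Proof.
move=> mf mg fg gy; apply/integrableP; split; first exact/measurable_EFinP.
apply: le_lt_trans gy; apply: ge0_le_integral => //.
- by apply/measurable_EFinP; exact: measurableT_comp.
- exact/measurable_EFinP.
- by move=> x _; rewrite /= lee_fin.
Qed.

Lemma int_fine f : (forall x, 0 <= f x) -> (\int[mu]_x (f x)%:E < +oo)%E ->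
  (\int[mu]_x f x)%R%:E = (\int[mu]_x (f x)%:E)%E.
Proof. by move=> f0 fy; rewrite /Rintegral fineK// ge0_fin_numE// int_ge0. Qed.

Lemma int_Rfine f : mu.-integrable setT (EFin \o f) ->
  (\int[mu]_x f x)%R%:E = (\int[mu]_x (f x)%:E)%E.
Proof. by move=> fi; rewrite /Rintegral fineK// integrable_fin_num. Qed.

Lemma ge0_integrable f : measurable_fun setT f -> (forall x, 0 <= f x) ->
  (\int[mu]_x (f x)%:E < +oo)%E -> mu.-integrable setT (EFin \o f).
Proof. by move=> mf f0 fy; apply: (int_integrable mf mf) => // x; rewrite ger0_norm. Qed.

End integral_toolbox.

(** * The energy and its subdifferential *)

Section weak_formulation.
Context {R : realType} {N : nat} (s p : R).
Hypotheses (hs : 0 < s < 1) (hp : 1 < p < 2).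
Local Notation T := (Rn R N).
Local Notation mu := (@lebesgueRn R N).
Local Notation mu2 := (mu \x mu)%E.
Local Notation K := (@kernel R N (s * p)).
Implicit Types (f g u v xi eta : T -> R) (F G : T * T -> R).

Definition swap (z : T * T) : T * T := (z.2, z.1).

Lemma measurable_swap : measurable_fun setT swap.
Proof. by apply/measurable_fun_pairP; split; [exact: measurable_snd|exact: measurable_fst]. Qed.

Lemma measurable_fst_fun f : measurable_fun setT f ->
  measurable_fun setT (fun z : T * T => f z.1).
Proof. by move=> mf; apply: measurableT_comp. Qed.

Lemma measurable_snd_fun f : measurable_fun setT f ->
  measurable_fun setT (fun z : T * T => f z.2).
Proof. by move=> mf; apply: measurableT_comp. Qed.

Lemma int2E F : measurable_fun setT F -> (forall z, 0 <= F z) ->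
  (\int[mu2]_z (F z)%:E = \int[mu]_x \int[mu]_y (F (x, y))%:E)%E.
Proof.
move=> mF F0; rewrite (@fubini_tonelli1 _ _ _ _ _ mu mu (EFin \o F))//=.
exact/measurable_EFinP.
Qed.

Lemma int2_swap F : measurable_fun setT F -> (forall z, 0 <= F z) ->
  (\int[mu2]_z (F (swap z))%:E = \int[mu2]_z (F z)%:E)%E.
Proof.
move=> mF F0; have mFs := measurableT_comp mF measurable_swap.
rewrite (int2E mF F0) (int2E mFs (fun z => F0 (swap z))).
rewrite (@fubini_tonelli _ _ _ _ _ mu mu (EFin \o F))//=.
exact/measurable_EFinP.
Qed.

(** [\iint |u(x) - u(y)|^p K], that is [2 p J(u)]. *)
Definition penergy u : \bar R :=
  (\int[mu2]_z (`|u z.1 - u z.2| `^ p * K z.1 z.2)%:E)%E.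

Lemma energyE u : energy s p u = ((2 * p)^-1%:E * penergy u)%E.
Proof. by []. Qed.

Lemma measurable_powRn (r : R) d' (X : measurableType d') (h : X -> R) :
  measurable_fun setT h -> measurable_fun setT (fun x => h x `^ r).
Proof. by move=> mh; exact: (@measurableT_comp _ _ _ _ _ _ (@powR R ^~ r)). Qed.

Lemma measurable_diff u : measurable_fun setT u ->
  measurable_fun setT (fun z : T * T => u z.1 - u z.2).
Proof.
by move=> mu_; apply: measurable_funB; [exact: measurable_fst_fun|exact: measurable_snd_fun].
Qed.

Lemma measurable_K : measurable_fun setT (fun z : T * T => K z.1 z.2).
Proof. exact: measurable_kernel. Qed.

Lemma measurable_penergy u : measurable_fun setT u ->
  measurable_fun setT (fun z : T * T => `|u z.1 - u z.2| `^ p * K z.1 z.2).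
Proof.
move=> mu_; apply: measurable_funM; last exact: measurable_K.
by apply: measurable_powRn; apply: measurableT_comp => //; exact: measurable_diff.
Qed.

Lemma penergy_int_ge0 u (z : T * T) : 0 <= `|u z.1 - u z.2| `^ p * K z.1 z.2.
Proof. by rewrite mulr_ge0 ?powR_ge0 ?kernel_ge0. Qed.

Lemma penergy_ge0 u : (0 <= penergy u)%E.
Proof. by apply: int_ge0 => z; exact: penergy_int_ge0. Qed.

Lemma energy_lty u : (energy s p u < +oo)%E -> (penergy u < +oo)%E.
Proof.
have [p1 p2] := andP hp.
rewrite energyE; have := penergy_ge0 u.
case: (penergy u) => [r _ _|_|//]; first exact: ltry.
by rewrite mulry gtr0_sg ?mul1e// invr_gt0 mulr_gt0//; lra.
Qed.

Definition sqint u := measurable_fun setT u /\ (\int[mu]_x (u x ^+ 2)%:E < +oo)%E.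

Lemma Lfun2P u : u \in Lfun mu 2%:E <-> sqint u.
Proof.
split => [u2|[mu_ u2]].
  split; last by have /integrableP[_] := Lfun2_integrable_sqr u2;
    under eq_integral do rewrite /= ger0_norm ?sqr_ge0//.
  by move: u2; rewrite inE => /andP[]; rewrite inE.
rewrite inE; apply/andP; split; rewrite inE//= /finite_norm.
rewrite (@lty_poweRy _ _ 2)// -[X in (_ `^ X)%E]/(2%:R) powR_Lnorm//.
under eq_integral do rewrite /= powR_mulrn// -normrX ger0_norm ?sqr_ge0//.
by [].
Qed.

Lemma sqint_le u v : measurable_fun setT u -> sqint v ->
  (forall x, `|u x| <= `|v x|) -> sqint u.
Proof.
move=> mu_ [mv v2] uv; split => //; apply: le_lt_trans v2.
apply: int_le; [exact: measurable_funX..|by move=> x; exact: sqr_ge0|move=> x].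
by rewrite -[leLHS]ger0_norm ?sqr_ge0// -[leRHS]ger0_norm ?sqr_ge0// !normrX ler_pXn2r ?nnegrE.
Qed.

Lemma sqintZ c u : sqint u -> sqint (fun x => c * u x).
Proof.
move=> [mu_ u2]; split; first exact: measurable_funM.
under eq_integral do rewrite exprMn.
rewrite intZ ?sqr_ge0//; last 2 first.
- exact: measurable_funX.
- by move=> x; exact: sqr_ge0.
by rewrite lte_mul_pinfty// lee_fin sqr_ge0.
Qed.

Lemma sqintD u v : sqint u -> sqint v -> sqint (fun x => u x + v x).
Proof.
move=> [mu_ u2] [mv v2]; split; first exact: measurable_funD.
apply: (@le_lt_trans _ _ (\int[mu]_x (2 * u x ^+ 2 + 2 * v x ^+ 2)%:E)%E).
  apply: int_le => [| |x|x]; try (by exact: sqr_ge0).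
  - by apply: measurable_funX; exact: measurable_funD.
  - by apply: measurable_funD; apply: measurable_funM => //; exact: measurable_funX.
  - by have := sqr_ge0 (u x - v x); lra.
rewrite intD ?intZ//; try (by move=> x; exact: sqr_ge0);
  try (by move=> x; rewrite mulr_ge0 ?sqr_ge0);
  try (by apply: measurable_funX); try (by apply: measurable_funM => //; exact: measurable_funX).
by rewrite lte_add_pinfty// lte_mul_pinfty// lee_fin.
Qed.

Lemma sqintB u v : sqint u -> sqint v -> sqint (fun x => u x - v x).
Proof.
move=> u2 v2; have := sqintD u2 (sqintZ (-1) v2).
by congr sqint; apply/funext => x; rewrite mulN1r.
Qed.

Lemma sqint_mul u v : sqint u -> sqint v ->
  mu.-integrable setT (EFin \o (fun x => u x * v x)).
Proof. by move=> /Lfun2P u2 /Lfun2P v2; apply/Lfun1_integrable; exact: Lfun2_mul_Lfun1. Qed.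

Definition admissible eta := sqint eta /\ (penergy eta < +oo)%E.

(** The integrand of the first variation of [2 J] at [f] in the direction
    [eta]. *)
Definition pairing f eta (z : T * T) : R :=
  Phi p (f z.1 - f z.2) * (eta z.1 - eta z.2) * K z.1 z.2.

Lemma measurable_Phi d' (X : measurableType d') (h : X -> R) :
  measurable_fun setT h -> measurable_fun setT (fun x => Phi p (h x)).
Proof.
have [p1 p2] := andP hp.
move=> mh; have -> : (fun x => Phi p (h x)) =
    (fun x => if 0 <= h x then `|h x| `^ (p - 1) else - `|h x| `^ (p - 1)).
  apply/funext => x; case: ifPn => h0; first by rewrite Phi_pos ?ger0_norm.
  by rewrite /Phi ltr0_sg ?mulN1r// ltNge.
have mP : measurable_fun setT (fun x => `|h x| `^ (p - 1)).
  by apply: measurable_powRn; exact: measurableT_comp.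
apply: measurable_fun_ifT => //; first exact: measurable_fun_ler.
exact: measurableT_comp.
Qed.

Lemma measurable_pairing f eta : measurable_fun setT f -> measurable_fun setT eta ->
  measurable_fun setT (pairing f eta).
Proof.
move=> mf me; apply: measurable_funM; last exact: measurable_K.
apply: measurable_funM; last exact: measurable_diff.
by apply: measurable_Phi; exact: measurable_diff.
Qed.

Lemma pairing_le f eta z : `|pairing f eta z| <=
  `|f z.1 - f z.2| `^ p * K z.1 z.2 + `|eta z.1 - eta z.2| `^ p * K z.1 z.2.
Proof.
rewrite /pairing normrM [`|K _ _|]ger0_norm ?kernel_ge0// -mulrDl.
by rewrite ler_wpM2r ?kernel_ge0// norm_Phi_mul_le//; case/andP: hp.
Qed.

Lemma pairing_integrable f eta : measurable_fun setT f -> measurable_fun setT eta ->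
  (penergy f < +oo)%E -> (penergy eta < +oo)%E ->
  mu2.-integrable setT (EFin \o pairing f eta).
Proof.
move=> mf me fy ey.
apply: (int_integrable (measurable_pairing mf me)
  (g := fun z => `|f z.1 - f z.2| `^ p * K z.1 z.2 + `|eta z.1 - eta z.2| `^ p * K z.1 z.2)).
- by apply: measurable_funD; exact: measurable_penergy.
- exact: pairing_le.
rewrite (intD _ (measurable_penergy mf) (measurable_penergy me)
  (penergy_int_ge0 f) (penergy_int_ge0 eta)).
exact: (lte_add_pinfty fy ey).
Qed.

(** Integrated form of [powR_add_le]: a first order upper expansion of the
    energy, whose remainder is of order [e^p] with [p > 1]. *)
Lemma penergy_variation f eta e : 0 < e ->
  measurable_fun setT f -> measurable_fun setT eta ->
  (penergy f < +oo)%E -> (penergy eta < +oo)%E ->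
  (penergy (fun x => f x + e * eta x)%R <= penergy f +
     ((p * e) * \int[mu2]_z pairing f eta z)%R%:E +
     (2 * p * e `^ p)%:E * penergy eta)%E.
Proof.
move=> e0 mf me fy ey; have [p1 p2] := andP hp.
have mfe : measurable_fun setT (fun x => f x + e * eta x).
  by apply: measurable_funD => //; exact: measurable_funM.
have iS := pairing_integrable mf me fy ey.
pose A z := `|f z.1 - f z.2| `^ p * K z.1 z.2 : R.
pose B z := `|eta z.1 - eta z.2| `^ p * K z.1 z.2 : R.
have mA : measurable_fun setT A by exact: measurable_penergy.
have mB : measurable_fun setT B by exact: measurable_penergy.
have iA : mu2.-integrable setT (EFin \o A).
  exact: (ge0_integrable mA (penergy_int_ge0 f) fy).
have iB : mu2.-integrable setT (EFin \o B).
  exact: (ge0_integrable mB (penergy_int_ge0 eta) ey).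
have key z : `|(f z.1 + e * eta z.1) - (f z.2 + e * eta z.2)| `^ p * K z.1 z.2 <=
    A z + (p * e) * pairing f eta z + (2 * p * e `^ p) * B z.
  have -> : (f z.1 + e * eta z.1) - (f z.2 + e * eta z.2) =
    (f z.1 - f z.2) + e * (eta z.1 - eta z.2) by ring.
  have := powR_add_le (f z.1 - f z.2) (e * (eta z.1 - eta z.2)) hp.
  rewrite normrM (gtr0_norm e0) powRM ?(ltW e0)//.
  move=> /(ler_wpM2r (kernel_ge0 (s * p) z.1 z.2)) /le_trans; apply.
  rewrite le_eqVlt; apply/orP; left; apply/eqP; rewrite /A /B /pairing; ring.
have iS' : mu2.-integrable setT (EFin \o (fun z => (p * e) * pairing f eta z)).
  have := integrableZl measurableT (p * e) iS.
  by apply: eq_integrable => // z _; rewrite /= EFinM.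
have iB' : mu2.-integrable setT (EFin \o (fun z => (2 * p * e `^ p) * B z)).
  have := integrableZl measurableT (2 * p * e `^ p) iB.
  by apply: eq_integrable => // z _; rewrite /= EFinM.
have iAS : mu2.-integrable setT (EFin \o (fun z => A z + (p * e) * pairing f eta z)).
  have := integrableD measurableT iA iS'.
  by apply: eq_integrable => // z _; rewrite /= EFinD.
have iASB : mu2.-integrable setT
    (EFin \o (fun z => A z + (p * e) * pairing f eta z + (2 * p * e `^ p) * B z)).
  have := integrableD measurableT iAS iB'.
  by apply: eq_integrable => // z _; rewrite /= EFinD.
apply: (@le_trans _ _ (\int[mu2]_z
    (A z + (p * e) * pairing f eta z + (2 * p * e `^ p) * B z)%:E)%E).
  apply: int_le => //.
  - exact: (measurable_penergy mfe).
  - by apply/measurable_EFinP; have /integrableP[] := iASB.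
  - exact: (penergy_int_ge0 (fun x => f x + e * eta x)).
rewrite -int_Rfine// RintegralD// RintegralD//.
rewrite (RintegralZl _ _ iS)// (RintegralZl _ _ iB)//.
have EA : (\int[mu2]_z A z)%R%:E = penergy f by exact: (int_fine (penergy_int_ge0 f) fy).
have EB : (\int[mu2]_z B z)%R%:E = penergy eta by exact: (int_fine (penergy_int_ge0 eta) ey).
by rewrite -EA -EB -EFinM -!EFinD lexx.
Qed.

(** The derivative of the energy dominates every element of the subdifferential.
    The Hoelder bound on the duality map makes the second order term explicit,
    so that letting [e] tend to zero is elementary. *)
Lemma subdifferential_pairing f xi eta : subdifferential (energy s p) f xi ->
  admissible eta ->
  \int[mu]_x (xi x * eta x) <= 2^-1 * \int[mu2]_z pairing f eta z.
Proof.
move=> [/Lfun2P f2 /Lfun2P xi2 Jf sub] [e2 ey]; have [p1 p2] := andP hp.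
have p0 : 0 < p by lra.
have mf := f2.1; have me := e2.1.
have fy := energy_lty Jf.
set I := \int[mu]_x _; set S := \int[mu2]_z _.
rewrite -subr_le0.
have key (e : R) : 0 < e -> I - 2^-1 * S <= e `^ (p - 1) * fine (penergy eta).
  move=> e0.
  have v2 : sqint (fun x => f x + e * eta x) by apply: sqintD => //; exact: sqintZ.
  have := sub (fun x => f x + e * eta x) ((Lfun2P _ ).2 v2).
  have -> : (\int[mu]_x (xi x * (f x + e * eta x - f x)))%R = e * I.
    rewrite /I -(RintegralZl _ _ (sqint_mul xi2 e2))//.
    by apply: eq_Rintegral => x _; ring.
  have := penergy_variation e0 mf me fy ey.
  rewrite !energyE -/S.
  have := penergy_ge0 (fun x => f x + e * eta x).
  move: (penergy (fun x => f x + e * eta x)%R).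
  move: (penergy_ge0 f) (penergy_ge0 eta) fy ey.
  case: (penergy f) => // a _; case: (penergy eta) => // b _ _ _.
  case=> // c _; rewrite -!EFinM -!EFinD !lee_fin /= => c_le.
  have pV : 0 < (2 * p)^-1 by rewrite invr_gt0 mulr_gt0.
  move: c_le => /(ler_wpM2l (ltW pV)) c_le /le_trans /(_ c_le).
  have -> : (2 * p)^-1 * (a + p * e * S + 2 * p * e `^ p * b) =
    (2 * p)^-1 * a + e * (2^-1 * S) + e `^ p * b.
    by field; rewrite gt_eqF.
  have -> : e `^ p = e * e `^ (p - 1) by rewrite mulr_powRB1// ltW.
  rewrite -addrA lerD2l -mulrA -mulrDr ler_pM2l//.
  by rewrite -lerBlDl.
rewrite leNgt; apply/negP => ISp.
set b := fine (penergy eta) in key.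
have b0 : 0 <= b by apply: fine_ge0; exact: penergy_ge0.
(* [e] is such that [e^(p-1) b] is less than half of the excess *)
pose e := ((I - 2^-1 * S) / (2 * (b + 1))) `^ (p - 1)^-1.
have e0 : 0 < e by rewrite powR_gt0// divr_gt0//; lra.
have := key e e0; rewrite /e -powRrM mulVf ?gt_eqF ?subr_gt0// powRr1; last first.
  by rewrite divr_ge0//; lra.
rewrite leNgt => /negP; apply.
rewrite mulrAC ltr_pdivrMr; last lra.
rewrite ltr_pM2l//; clear -b0; lra.
Qed.

(** Pairwise form of the previous inequality: in the applications [E] collects
    the error made at a pair of points and [G] what is gained there. Both are
    taken with their transpose since an inequality between integrands is usually
    oriented by the order of the values of [f]. *)
Lemma pairing_gain f xi eta G (E : T * T -> R) : subdifferential (energy s p) f xi ->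
  admissible eta -> measurable_fun setT G -> measurable_fun setT E ->
  (forall z, 0 <= G z) -> (forall z, 0 <= E z) ->
  (forall z, pairing f eta z + G z + G (swap z) <= E z + E (swap z)) ->
  ((\int[mu]_x (xi x * eta x))%R%:E + \int[mu2]_z (G z)%:E <= \int[mu2]_z (E z)%:E)%E.
Proof.
move=> sub adm mG mE G0 E0 key.
have [Ey|] := ltP (\int[mu2]_z (E z)%:E)%E +oo%E; last first.
  by rewrite leye_eq => /eqP ->; rewrite leey.
have H := subdifferential_pairing sub adm.
have [/Lfun2P [mf _] _ Jf _] := sub; have [[me _] ey] := adm.
have fy := energy_lty Jf.
have iS := pairing_integrable mf me fy ey.
have mGs : measurable_fun setT (G \o swap) by exact: measurableT_comp mG measurable_swap.
have mEs : measurable_fun setT (E \o swap) by exact: measurableT_comp mE measurable_swap.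
have iE := ge0_integrable mE E0 Ey.
have Esy : (\int[mu2]_z ((E \o swap) z)%:E < +oo)%E by rewrite (int2_swap mE E0).
have iEs := ge0_integrable mEs (fun z => E0 (swap z)) Esy.
have iEE : mu2.-integrable setT (EFin \o (fun z => E z + (E \o swap) z)).
  have := integrableD measurableT iE iEs.
  by apply: eq_integrable => // z _; rewrite /= EFinD.
have mS : measurable_fun setT (pairing f eta) by exact: measurable_pairing.
have iEES : mu2.-integrable setT (EFin \o (fun z => E z + (E \o swap) z - pairing f eta z)).
  have := integrableB measurableT iEE iS.
  by apply: eq_integrable => // z _; rewrite /= EFinB.
have GE : (\int[mu2]_z (G z + (G \o swap) z)%:E <=
    \int[mu2]_z (E z + (E \o swap) z - pairing f eta z)%:E)%E.
  apply: int_le => [| |z|z].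
  - exact: measurable_funD mG mGs.
  - by apply/measurable_EFinP; have /integrableP[] := iEES.
  - exact: addr_ge0 (G0 _) (G0 _).
  - by have := key z; rewrite /=; lra.
rewrite (intD _ mG mGs G0 (fun z => G0 (swap z))) (int2_swap mG G0) in GE.
rewrite -(int_Rfine iEES) (RintegralB _ iEE iS)// (RintegralD _ iE iEs)// in GE.
have EsE : \int[mu2]_z ((E \o swap) z) = \int[mu2]_z E z.
  by rewrite /Rintegral (int2_swap mE E0).
rewrite EsE in GE; rewrite -(int_fine E0 Ey).
move: GE H; set S := \int[mu2]_z pairing f eta z; set I := \int[mu]_x _.
set e := \int[mu2]_z E z; have := int_ge0 mu2 G0.
case: (\int[mu2]_z (G z)%:E)%E => // g g0.
rewrite -EFinD lee_fin => GE H; rewrite -EFinD lee_fin.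
move: GE H; clear; lra.
Qed.

End weak_formulation.

(** * Dini derivatives *)

Section dini.
Context {R : realType}.
Implicit Types (Y : R -> R) (t r h e d a b : R).

(** At the supremum of the times up to which the bound with slope [e] holds, the
    Dini condition lets it go on a little further. The derivative is not
    controlled at the initial time, where the flow need not be differentiable;
    continuity is enough there. *)
Lemma dini_nonincreasing Y :
  (forall t, 0 <= t -> forall e, 0 < e -> exists2 d : R, 0 < d &
    forall r, 0 <= r -> `|r - t| < d -> `|Y r - Y t| <= e) ->
  (forall t, 0 < t -> forall e, 0 < e -> exists2 d : R, 0 < d &
    forall h, 0 < h < d -> Y (t + h) <= Y t + h * e) ->
  forall b, 0 <= b -> Y b <= Y 0.
Proof.
move=> cY dY b b0.
have step a e : 0 < a <= b -> 0 < e -> Y b <= Y a + e * (b - a).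
  move=> /andP[a0 ab] e0; rewrite leNgt; apply/negP => Yb.
  pose S := [set t | a <= t <= b /\ Y t <= Y a + e * (t - a)].
  have Sa : S a by rewrite /S/= lexx ab subrr mulr0 addr0.
  have Sb : has_sup S by split; [exists a|exists b => t [/andP[]]].
  pose c := sup S.
  have ac : a <= c by apply: ub_le_sup => //; case: Sb.
  have cb : c <= b by apply: ge_sup; [exists a|move=> t [/andP[]]].
  have c0 : 0 < c by lra.
  have Sc : Y c <= Y a + e * (c - a).
    rewrite -lerBlDr; apply/ler_addgt0Pr => eta eta0.
    have [d d0 Hd] := cY c (ltW c0) eta eta0.
    have [t [/andP[at_ tb] Yt] ct] := sup_adherent d0 Sb.
    have tc : t <= c by apply: ub_le_sup; [case: Sb|split; rewrite ?at_].
    have := Hd t (le_trans (ltW a0) at_); rewrite ltr_distl.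
    rewrite -/c in ct; move=> /(_ _); rewrite ler_distl => H.
    have /andP[H1 H2] : Y c - eta <= Y t <= Y c + eta by apply: H; apply/andP; split; lra.
    have : e * (t - a) <= e * (c - a) by rewrite ler_wpM2l; lra.
    lra.
  have cb' : c < b.
    by rewrite lt_neqAle cb andbT; apply/eqP => cE; rewrite cE in Sc; lra.
  have [d d0 Hd] := dY c c0 e e0.
  pose h := Num.min (d / 2) (b - c).
  have h0 : 0 < h by rewrite lt_min; lra.
  have hd : h < d by rewrite (@le_lt_trans _ _ (d / 2))// ?ge_min ?lexx//; lra.
  have hb : h <= b - c by rewrite ge_min lexx orbT.
  have := Hd h; rewrite h0 hd => /(_ isT) Yh.
  have : S (c + h) by split; [apply/andP; split; lra|lra].
  move=> Sch; have : c + h <= c by apply: ub_le_sup => //; case: Sb.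
  lra.
have step2 a : 0 < a <= b -> Y b <= Y a.
  move=> ab; apply/ler_addgt0Pr => eta eta0.
  have ba : 0 < b - a + 1 by lra.
  have := step a (eta / (b - a + 1)) ab (divr_gt0 eta0 ba).
  have : eta / (b - a + 1) * (b - a) <= eta.
    rewrite mulrAC ler_pdivrMr// ler_wpM2l//; lra.
  lra.
move: b0; rewrite le_eqVlt => /predU1P[<-//|b0].
apply/ler_addgt0Pr => eta eta0.
have [d d0 Hd] := cY 0 (lexx _) eta eta0.
pose a := Num.min (d / 2) b.
have a0 : 0 < a by rewrite lt_min; lra.
have ad : a < d by rewrite (@le_lt_trans _ _ (d / 2))// ?ge_min ?lexx//; lra.
have ab : a <= b by rewrite ge_min lexx orbT.
have := Hd a (ltW a0); rewrite subr0 gtr0_norm// => /(_ ad).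
rewrite ler_distl => /andP[_ H].
have := step2 a; rewrite a0 ab => /(_ isT); lra.
Qed.

End dini.

(** * Square integrable functions *)

Section square_integrable.
Context {R : realType} {N : nat}.
Local Notation T := (Rn R N).
Local Notation mu := (@lebesgueRn R N).
Implicit Types (f g u v w : T -> R).

Definition L1 f := mu.-integrable setT (EFin \o f).
(** Real-valued integrals: the functions of time below are built with them. *)
Definition Int f : R := \int[mu]_x f x.
Definition nsq u : R := Int (fun x => u x ^+ 2).

Lemma L1D f g : L1 f -> L1 g -> L1 (fun x => f x + g x).
Proof. by move=> fi gi; have := integrableD measurableT fi gi; exact: eq_integrable. Qed.

Lemma L1B f g : L1 f -> L1 g -> L1 (fun x => f x - g x).
Proof. by move=> fi gi; have := integrableB measurableT fi gi; exact: eq_integrable. Qed.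

Lemma L1Z c f : L1 f -> L1 (fun x => c * f x).
Proof. by move=> fi; have := integrableZl measurableT c fi; exact: eq_integrable. Qed.

Lemma IntD f g : L1 f -> L1 g -> Int (fun x => f x + g x) = Int f + Int g.
Proof. by move=> fi gi; exact: RintegralD. Qed.

Lemma IntB f g : L1 f -> L1 g -> Int (fun x => f x - g x) = Int f - Int g.
Proof. by move=> fi gi; exact: RintegralB. Qed.

Lemma IntZ c f : L1 f -> Int (fun x => c * f x) = c * Int f.
Proof. by move=> fi; exact: RintegralZl. Qed.

Lemma Int_le f g : L1 f -> L1 g -> (forall x, f x <= g x) -> Int f <= Int g.
Proof. by move=> fi gi fg; apply: le_Rintegral. Qed.

Lemma Int_dist f g h : L1 f -> L1 g -> L1 h ->
  (forall x, `|f x - g x| <= h x) -> `|Int f - Int g| <= Int h.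
Proof.
move=> fi gi hi fgh; rewrite ler_distl -!(IntB gi hi) -!(IntD gi hi).
apply/andP; split; apply: Int_le => //; try (by apply: L1B); try (by apply: L1D).
- by move=> x; have := fgh x; rewrite ler_distl => /andP[].
- by move=> x; have := fgh x; rewrite ler_distl => /andP[].
Qed.

Lemma Int_ge0 f : (forall x, 0 <= f x) -> 0 <= Int f.
Proof. by move=> f0; apply: Rintegral_ge0. Qed.

Lemma eq_Int f g : f =1 g -> Int f = Int g.
Proof. by move=> fg; apply: eq_Rintegral => x _; exact: fg. Qed.

Lemma sqint_sqr u : sqint u -> L1 (fun x => u x ^+ 2).
Proof. by move=> u2; have := sqint_mul u2 u2; exact: eq_integrable. Qed.

Lemma nsq_ge0 u : 0 <= nsq u.
Proof. by apply: Int_ge0 => x; exact: sqr_ge0. Qed.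

Lemma nsqE u : sqint u -> (nsq u)%:E = (\int[mu]_x (u x ^+ 2)%:E)%E.
Proof. by move=> [_ u2]; apply: int_fine => // x; exact: sqr_ge0. Qed.

Lemma nsqD u v : sqint u -> sqint v ->
  nsq (fun x => u x + v x) <= 2 * nsq u + 2 * nsq v.
Proof.
move=> u2 v2; rewrite /nsq -!IntZ ?(sqint_sqr u2) ?(sqint_sqr v2)//.
rewrite -IntD; [|exact: (L1Z 2 (sqint_sqr u2))|exact: (L1Z 2 (sqint_sqr v2))].
apply: Int_le.
- exact: (sqint_sqr (sqintD u2 v2)).
- apply: L1D; [exact: (L1Z 2 (sqint_sqr u2))|exact: (L1Z 2 (sqint_sqr v2))].
- by move=> x; have := sqr_ge0 (u x - v x); lra.
Qed.

Lemma nsqZ c u : sqint u -> nsq (fun x => c * u x) = c ^+ 2 * nsq u.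
Proof.
move=> u2; rewrite /nsq -IntZ; last exact: sqint_sqr.
by apply: eq_Int => x; rewrite exprMn.
Qed.

Lemma Int_young c u v : 0 < c -> sqint u -> sqint v ->
  2 * Int (fun x => u x * v x) <= c * nsq u + c^-1 * nsq v.
Proof.
move=> c0 u2 v2; rewrite /nsq -!IntZ; try (by exact: sqint_sqr); last exact: sqint_mul.
rewrite -IntD; [|exact: (L1Z c (sqint_sqr u2))|exact: (L1Z c^-1 (sqint_sqr v2))].
apply: Int_le.
- exact: (L1Z 2 (sqint_mul u2 v2)).
- apply: L1D; [exact: (L1Z c (sqint_sqr u2))|exact: (L1Z c^-1 (sqint_sqr v2))].
- move=> x; rewrite -subr_ge0.
  have -> : c * u x ^+ 2 + c^-1 * v x ^+ 2 - 2 * (u x * v x) =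
     c^-1 * (c * u x - v x) ^+ 2 by field; rewrite gt_eqF.
  by rewrite mulr_ge0 ?sqr_ge0// invr_ge0 ltW.
Qed.

(** Convergence in [L^2] read on the integral of the square, free of roots and
    extended reals. *)
Lemma Lnorm2_small (F : set_system R) (FF : Filter F) (f : R -> T -> R) :
  ('N[mu]_2%:E[EFin \o f h]%E @[h --> F] --> 0%E) ->
  forall e : R, 0 < e -> \forall h \near F,
    (\int[mu]_x (f h x ^+ 2)%:E <= e%:E)%E.
Proof.
move=> fF e e0.
have se0 : (0%E < (Num.sqrt e)%:E)%E by rewrite lte_fin sqrtr_gt0.
have := fF _ (open_ereal_lt' se0); rewrite /= => H.
near=> h.
have : ('N[mu]_2%:E[EFin \o f h] < (Num.sqrt e)%:E)%E by near: h; exact: H.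
move=> /ltW Nh.
have -> : (\int[mu]_x (f h x ^+ 2)%:E = 'N[mu]_2%:E[EFin \o f h] `^ 2)%E.
  rewrite -[X in (_ `^ X)%E]/(2%:R) powR_Lnorm//.
  by apply: eq_integral => x _; rewrite /= powR_mulrn// -normrX ger0_norm ?sqr_ge0.
have := @gt0_ler_poweR R 2 _ ('N[mu]_2%:E[EFin \o f h])%E (Num.sqrt e)%:E.
rewrite poweR_EFin powR_mulrn ?sqrtr_ge0// sqr_sqrtr ?(ltW e0)//; apply => //.
- by rewrite in_itv/= leey Lnorm_ge0.
- by rewrite in_itv/= leey lee_fin sqrtr_ge0.
Unshelve. all: by end_near. Qed.

End square_integrable.

(** * Gradient flows in L^2 *)

Section flow.
Context {R : realType} {N : nat} (s p : R).
Hypotheses (hs : 0 < s < 1) (hp : 1 < p < 2).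
Local Notation T := (Rn R N).
Local Notation mu := (@lebesgueRn R N).
Implicit Types (f g : T -> R) (u v w : R -> T -> R) (t r h e d a b c : R).

Definition L2_continuous w := forall t, 0 <= t -> forall e, 0 < e ->
  exists2 d : R, 0 < d & forall r, 0 <= r -> `|r - t| < d ->
    nsq (fun x => w r x - w t x) <= e.

Definition L2_right_derivative w t (z : T -> R) := forall e, 0 < e ->
  exists2 d : R, 0 < d & forall h, 0 < h < d ->
    nsq (fun x => (w (t + h) x - w t x) / h - z x) <= e.

(** Gradient flow of the energy with the convergences in [L^2] written out. The
    starting point is left out, so that the condition is inherited by rescaled
    curves. *)
Definition flow u := [/\ forall t, 0 <= t -> sqint (u t), L2_continuous u &
  forall t, 0 < t -> exists2 xi, subdifferential (energy s p) (u t) xi &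
    L2_right_derivative u t (fun x => - xi x)].

Lemma sqint_quot w t h z : sqint (w (t + h)) -> sqint (w t) -> sqint z ->
  sqint (fun x => (w (t + h) x - w t x) / h - z x).
Proof.
move=> w1 w2 z2; apply: sqintB => //.
have := sqintZ h^-1 (sqintB w1 w2).
by congr sqint; apply/funext => x; rewrite mulrC.
Qed.

Lemma gradient_flow_flow (u0 : T -> R) u : semigroup_solution s p u0 u -> flow u.
Proof.
move=> [u2 _ cu du]; have u2' t : 0 <= t -> sqint (u t) by move=> /u2/Lfun2P.
split => // [t t0 e e0|t t0].
  have := Lnorm2_small (within_filter _ (nbhs_filter t)) (cu t t0) e0.
  rewrite /within/= => /nbhs_ballP[d /= d0 Hd]; exists d => // r r0 rt.
  rewrite -lee_fin nsqE; last exact: sqintB (u2' _ r0) (u2' _ t0).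
  by apply: (Hd r _ r0); rewrite /ball/= distrC.
have [xi sub der] := du t t0; exists xi => // e e0.
have := Lnorm2_small (within_filter _ (nbhs_filter (0:R))) der e0.
rewrite /within/= => /nbhs_ballP[d /= d0 Hd]; exists d => // h /andP[h0 hd].
have [_ /Lfun2P xi2 _ _] := sub.
rewrite -lee_fin nsqE; last first.
  apply: sqint_quot; [apply: u2'; lra|apply: u2'; lra|].
  by have := sqintZ (-1) xi2; congr sqint; apply/funext => x; rewrite mulN1r.
have := Hd h; rewrite /ball/= sub0r normrN gtr0_norm// => /(_ hd h0).
by under eq_integral do rewrite -[xi _]opprK.
Qed.

(** A functional with a quadratic upper expansion along an [L^2] curve inherits
    an upper Dini derivative from the right derivative of the curve: the
    quadratic term is [O(h^2)]. *)
Lemma functional_dini w t (z phi : T -> R) (P : (T -> R) -> R) (C D : R) :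
  0 < t -> (forall r, 0 <= r -> sqint (w r)) -> sqint z ->
  L2_right_derivative w t z -> sqint phi -> 0 <= C ->
  (forall r, 0 <= r -> P (w r) <= P (w t) +
     Int (fun x => phi x * (w r x - w t x)) + C * nsq (fun x => w r x - w t x)) ->
  Int (fun x => phi x * z x) <= D ->
  forall e, 0 < e -> exists2 d : R, 0 < d & forall h, 0 < h < d ->
    P (w (t + h)) <= P (w t) + h * (D + e).
Proof.
move=> t0 w2 z2 dw phi2 C0 HP HD e e0.
(* the weight [l] in Young's inequality splits the product of the test
   function with the small remainder of the difference quotient *)
pose l := (e / 2) / (nsq phi + 1).
have n0 := nsq_ge0 phi.
have l0 : 0 < l by rewrite divr_gt0//; lra.
pose e1 := Num.min 1 (l * (e / 2)).
have e10 : 0 < e1 by rewrite lt_min ltr01 mulr_gt0//; lra.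
have [d d0 Hd] := dw e1 e10.
pose M := C * (2 * nsq z + 2) + 1.
have M0 : 0 < M by rewrite /M ltr_wpDl// mulr_ge0//; have := nsq_ge0 z; lra.
exists (Num.min d (e / 2 / M)); first by rewrite lt_min d0 divr_gt0//; lra.
move=> h /andP[h0]; rewrite lt_min => /andP[hd hM].
have th0 : 0 <= t + h by lra.
have := HP _ th0; set k := fun x => w (t + h) x - w t x.
have k2 : sqint k by apply: sqintB; apply: w2; lra.
pose q x := k x / h - z x.
have q2 : sqint q by apply: sqint_quot => //; apply: w2; lra.
have nq : nsq q <= e1 by apply: Hd; rewrite h0.
have kE x : k x = h * (z x + q x) by rewrite /q addrCA subrr addr0 mulrCA divff ?mulr1// gt_eqF.
have E1 : Int (fun x => phi x * k x) =
    h * (Int (fun x => phi x * z x) + Int (fun x => phi x * q x)).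
  rewrite -IntD; [|exact: (sqint_mul phi2 z2)|exact: (sqint_mul phi2 q2)].
  rewrite -IntZ; last by apply: L1D; [exact: (sqint_mul phi2 z2)|exact: (sqint_mul phi2 q2)].
  by apply: eq_Int => x; rewrite kE; ring.
have E2 : nsq k = h ^+ 2 * nsq (fun x => z x + q x).
  by rewrite -nsqZ; [apply: eq_Int => x; rewrite kE|exact: sqintD].
have := nsqD z2 q2; have := Int_young l0 phi2 q2.
rewrite E1 E2.
set I := Int (fun x => phi x * q x); set n2 := nsq (fun x => z x + q x) => HI Hn.
move=> Hmain; apply: (le_trans Hmain).
have nq1 : nsq q <= 1 by apply: le_trans nq _; rewrite ge_min lexx.
have nq2 : nsq q <= l * (e / 2) by apply: le_trans nq _; rewrite ge_min lexx orbT.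
have lphi : l * nsq phi <= e / 2.
  rewrite /l mulrAC ler_pdivrMr ?ltr_wpDl//; apply: ler_wpM2l; last by rewrite lerDl.
  by rewrite divr_ge0// ltW.
have I_le : I <= e / 2.
  have : l^-1 * nsq q <= e / 2 by rewrite mulrC ler_pdivrMr// mulrC.
  lra.
have : h * (C * n2) <= e / 2.
  have : C * n2 <= M by rewrite /M; have : C * n2 <= C * (2 * nsq z + 2);
    [rewrite ler_wpM2l//; lra|lra].
  move=> /(ler_wpM2l (ltW h0)) /le_trans; apply.
  by rewrite -ler_pdivlMr// ltW.
move=> Hq; rewrite -addrA lerD2l.
have -> : C * (h ^+ 2 * n2) = h * (h * (C * n2)) by ring.
rewrite -mulrDr ler_pM2l//; lra.
Qed.

End flow.

(** * Comparison *)

Section comparison.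
Context {R : realType} {N : nat} (s p : R).
Hypotheses (hs : 0 < s < 1) (hp : 1 < p < 2).
Local Notation T := (Rn R N).
Local Notation mu := (@lebesgueRn R N).
Local Notation flow := (@flow R N s p).
Implicit Types (f g : T -> R) (u v w : R -> T -> R) (t r h e d a b c : R).

(** The modulus of continuity is that of [l A + (C / l) |w r - w t|^2] minimized
    in [l]: it suits functionals whose increments are bounded by Young
    inequalities. *)
Lemma L2_continuous_functional w (P : (T -> R) -> R) (A : R -> R) (C : R) :
  (forall t, 0 <= t -> 0 <= A t) -> 0 <= C ->
  (forall t, 0 <= t -> sqint (w t)) -> L2_continuous w ->
  (forall t r l, 0 <= t -> 0 <= r -> 0 < l <= 1 ->
     `|P (w r) - P (w t)| <= l * A t + C / l * nsq (fun x => w r x - w t x)) ->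
  forall t, 0 <= t -> forall e, 0 < e -> exists2 d : R, 0 < d &
    forall r, 0 <= r -> `|r - t| < d -> `|P (w r) - P (w t)| <= e.
Proof.
move=> A0 C0 w2 cw HP t t0 e e0.
have At := A0 t t0.
pose l := Num.min 1 (e / 2 / (A t + 1)).
have l0 : 0 < l by rewrite lt_min ltr01 divr_gt0//; lra.
have l1 : l <= 1 by rewrite ge_min lexx.
have lA : l * A t <= e / 2.
  apply: (@le_trans _ _ (e / 2 / (A t + 1) * A t)).
    by rewrite ler_wpM2r// ge_min lexx orbT.
  by rewrite mulrAC ler_pdivrMr ?ler_wpM2l//; lra.
have C1 : 0 < C + 1 by lra.
have e20 : 0 < e / 2 by lra.
have ec0 : 0 < l * (e / 2) / (C + 1) by rewrite divr_gt0// mulr_gt0.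
have [d d0 Hd] := cw t t0 _ ec0.
exists d => // r r0 rt; apply: (le_trans (HP t r l t0 r0 _)); first by rewrite l0.
have := Hd r r0 rt; set n := nsq _ => nle.
have n0 : 0 <= n by exact: nsq_ge0.
have : C / l * n <= e / 2.
  rewrite mulrAC ler_pdivrMr//.
  apply: (@le_trans _ _ ((C + 1) * n)); first by rewrite ler_wpM2r//; lra.
  by rewrite mulrC -ler_pdivlMr// [e / 2 * l]mulrC.
lra.
Qed.

Lemma L2_continuousB u v : (forall t, 0 <= t -> sqint (u t)) ->
  (forall t, 0 <= t -> sqint (v t)) -> L2_continuous u -> L2_continuous v ->
  L2_continuous (fun t x => u t x - v t x).
Proof.
move=> u2 v2 cu cv t t0 e e0; have e4 : 0 < e / 4 by lra.
have [d d0 Hd] := cu t t0 _ e4; have [d' d'0 Hd'] := cv t t0 _ e4.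
exists (Num.min d d') => [|r r0]; first by rewrite lt_min d0.
rewrite lt_min => /andP[/(Hd r r0) H1 /(Hd' r r0) H2].
have k2 : sqint (fun x => u r x - u t x) by apply: sqintB; [exact: u2|exact: u2].
have k2' : sqint (fun x => -1 * (v r x - v t x)).
  by apply: sqintZ; apply: sqintB; [exact: v2|exact: v2].
have := nsqD k2 k2'; rewrite nsqZ ?sqrrN ?expr1n; last by apply: sqintB; apply: v2.
have -> : nsq (fun x => u r x - u t x + -1 * (v r x - v t x)) =
  nsq (fun x => u r x - v r x - (u t x - v t x)) by apply: eq_Int => x; congr (_ ^+ 2); ring.
lra.
Qed.

Lemma L2_right_derivativeB u v t (z z' : T -> R) :
  0 < t -> (forall t, 0 <= t -> sqint (u t)) ->
  (forall t, 0 <= t -> sqint (v t)) -> sqint z -> sqint z' ->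
  L2_right_derivative u t z -> L2_right_derivative v t z' ->
  L2_right_derivative (fun t x => u t x - v t x) t (fun x => z x - z' x).
Proof.
move=> t0 u2 v2 z2 z2' du dv e e0; have e4 : 0 < e / 4 by lra.
have [d d0 Hd] := du _ e4; have [d' d'0 Hd'] := dv _ e4.
exists (Num.min d d') => [|h]; first by rewrite lt_min d0.
rewrite lt_min => /andP[h0 /andP[hd hd']].
have th : 0 <= t + h by lra.
have t0' := ltW t0.
have := Hd h; rewrite h0 => /(_ hd) H1; have := Hd' h; rewrite h0 => /(_ hd') H2.
have k2 := sqint_quot (u2 _ th) (u2 _ t0') z2.
have k2' := sqint_quot (v2 _ th) (v2 _ t0') z2'.
have := nsqD k2 (sqintZ (-1) k2'); rewrite nsqZ// sqrrN expr1n.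
have -> : nsq (fun x => (u (t + h) x - u t x) / h - z x +
      -1 * ((v (t + h) x - v t x) / h - z' x)) =
  nsq (fun x => (u (t + h) x - v (t + h) x - (u t x - v t x)) / h - (z x - z' x)).
  by apply: eq_Int => x; congr (_ ^+ 2); ring.
lra.
Qed.

Lemma measurable_min f g : measurable_fun setT f -> measurable_fun setT g ->
  measurable_fun setT (fun x => Num.min (f x) (g x)).
Proof. by move=> mf mg; exact: measurable_minr. Qed.

Lemma measurable_max f g : measurable_fun setT f -> measurable_fun setT g ->
  measurable_fun setT (fun x => Num.max (f x) (g x)).
Proof. by move=> mf mg; exact: measurable_maxr. Qed.

Lemma penergyE f : penergy s p f =
  (\int[mu \x mu]_z (`|f z.1 - f z.2| `^ p * kernel (s * p) z.1 z.2)%R%:E)%E.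
Proof. by []. Qed.

Opaque penergy.

Lemma penergyD f g : measurable_fun setT f -> measurable_fun setT g ->
  (penergy s p f + penergy s p g = \int[mu \x mu]_z
    (`|f z.1 - f z.2| `^ p * kernel (s * p) z.1 z.2 +
     `|g z.1 - g z.2| `^ p * kernel (s * p) z.1 z.2)%R%:E)%E.
Proof.
move=> mf mg; symmetry; rewrite !penergyE.
exact: (intD _ (measurable_penergy s p mf) (measurable_penergy s p mg)
  (penergy_int_ge0 s p f) (penergy_int_ge0 s p g)).
Qed.

Lemma penergy_minmax f g : measurable_fun setT f -> measurable_fun setT g ->
  (penergy s p (fun x => Num.min (f x) (g x))%R +
   penergy s p (fun x => Num.max (f x) (g x))%R <= penergy s p f + penergy s p g)%E.
Proof.
move=> mf mg; have [p1 p2] := andP hp.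
have mm := measurable_min mf mg; have mM := measurable_max mf mg.
rewrite [X in (X <= _)%E](penergyD mm mM) [X in (_ <= X)%E](penergyD mf mg).
apply: int_le.
- exact: measurable_funD (measurable_penergy s p mm) (measurable_penergy s p mM).
- exact: measurable_funD (measurable_penergy s p mf) (measurable_penergy s p mg).
- by move=> z; rewrite addr_ge0// mulr_ge0 ?powR_ge0 ?kernel_ge0.
- by move=> z; rewrite -!mulrDl ler_wpM2r ?kernel_ge0//; exact: powR_minmax.
Qed.

Definition pos f x : R := Num.max (f x) 0.

Lemma pos_ge0 f x : 0 <= pos f x.
Proof. by rewrite /pos le_max lexx orbT. Qed.

Lemma sqint_pos f : sqint f -> sqint (pos f).
Proof.
move=> f2; apply: (sqint_le _ f2); first by apply: measurable_maxr => //; case: f2.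
move=> x; rewrite ger0_norm ?pos_ge0// /pos ge_max ler_norm normr_ge0//.
Qed.

(** T-monotonicity of the subdifferential: by submodularity of the energy, [f]
    and [g] may be compared with their minimum and maximum, which differ from
    them by the positive part of [f - g]. *)
Lemma subdifferential_Tmonotone f g xi zeta :
  subdifferential (energy s p) f xi -> subdifferential (energy s p) g zeta ->
  0 <= Int (fun x => pos (fun y => f y - g y) x * (xi x - zeta x)).
Proof.
move=> [/Lfun2P f2 /Lfun2P xi2 Jf subf] [/Lfun2P g2 /Lfun2P ze2 Jg subg].
have [p1 p2] := andP hp.
have w2 : sqint (pos (fun y => f y - g y)) by apply: sqint_pos; exact: sqintB.
set W := pos _ in w2 *.
have mE x : Num.min (f x) (g x) = f x - W x.
  rewrite /W /pos; have [fg|fg] := leP (f x) (g x).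
    by rewrite max_r ?subr0// subr_le0.
  by rewrite max_l ?subKr// subr_ge0 ltW.
have ME x : Num.max (f x) (g x) = g x + W x.
  rewrite /W /pos; have [fg|fg] := leP (f x) (g x).
    by rewrite [X in _ + X]max_r ?addr0// subr_le0.
  by rewrite [X in _ + X]max_l ?subr_ge0 ?ltW// addrCA subrr addr0.
have m2 : sqint (fun x => Num.min (f x) (g x)).
  by rewrite (funext mE); exact: sqintB.
have M2 : sqint (fun x => Num.max (f x) (g x)).
  by rewrite (funext ME); exact: sqintD.
have := subf _ ((Lfun2P _).2 m2); have := subg _ ((Lfun2P _).2 M2).
have -> : \int[mu]_x (zeta x * (Num.max (f x) (g x) - g x)) = Int (fun x => W x * zeta x).
  by apply: eq_Int => x; rewrite ME; ring.
have -> : \int[mu]_x (xi x * (Num.min (f x) (g x) - f x)) = - Int (fun x => W x * xi x).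
  rewrite -[RHS]mulN1r -IntZ; last exact: sqint_mul.
  by apply: eq_Int => x; rewrite mE; ring.
have -> : Int (fun x => W x * (xi x - zeta x)) =
    Int (fun x => W x * xi x) - Int (fun x => W x * zeta x).
  rewrite -IntB; [|exact: sqint_mul..].
  by apply: eq_Int => x; ring.
have := penergy_minmax f2.1 g2.1.
have [fy gy] := (energy_lty hp Jf, energy_lty hp Jg).
rewrite !energyE.
move: (penergy_ge0 s p f) (penergy_ge0 s p g) fy gy.
move: (penergy_ge0 s p (fun x => Num.min (f x) (g x))%R)
  (penergy_ge0 s p (fun x => Num.max (f x) (g x))%R).
case: (penergy _ _ f) => // a; case: (penergy _ _ g) => // b.
case: (penergy _ _ _) => // [m|]; last by case: (penergy _ _ _).
case: (penergy _ _ _) => // M _ _ _ _ _ _.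
rewrite -!EFinM -!EFinD !lee_fin => abmM.
have pV : 0 < (2 * p)^-1 by rewrite invr_gt0 mulr_gt0// (lt_trans ltr01).
have := ler_wpM2l (ltW pV) abmM; rewrite !mulrDr.
clear; lra.
Qed.

Lemma pos_sqr_dist (a b l : R) : 0 < l -> l <= 1 ->
  `|Num.max a 0 ^+ 2 - Num.max b 0 ^+ 2| <= l * b ^+ 2 + 2 / l * (a - b) ^+ 2.
Proof.
move=> l0 l1.
have H : `|Num.max a 0 ^+ 2 - Num.max b 0 ^+ 2| <= 2 * `|b| * `|a - b| + (a - b) ^+ 2.
  rewrite subr_sqr normrM -(@real_normK _ (a - b)) ?num_real//.
  have := ler_norm (a - b); have := ler_norm (- (a - b)); have := ler_norm b.
  rewrite normrN; have := normr_ge0 b; move: (`|a - b|) (`|b|) => k c c0 bc k1 k2.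
  have -> : 2 * c * k + k ^+ 2 = k * (2 * c + k) by ring.
  apply: ler_pM => //; rewrite ler_norml.
    by case: (leP a 0) => a0; case: (leP b 0) => b0; apply/andP; split; lra.
  by case: (leP a 0) => a0; case: (leP b 0) => b0; apply/andP; split; lra.
apply: (le_trans H).
have lV : 1 <= l^-1 by rewrite invf_ge1.
have : 2 * `|b| * `|a - b| <= l * b ^+ 2 + l^-1 * (a - b) ^+ 2.
  rewrite -subr_ge0 -(@real_normK _ b) ?num_real// -(@real_normK _ (a - b)) ?num_real//.
  have -> : l * `|b| ^+ 2 + l^-1 * `|a - b| ^+ 2 - 2 * `|b| * `|a - b| =
     l^-1 * (l * `|b| - `|a - b|) ^+ 2 by field; rewrite gt_eqF.
  by rewrite mulr_ge0 ?sqr_ge0// invr_ge0 ltW.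
have : (a - b) ^+ 2 <= l^-1 * (a - b) ^+ 2 by rewrite ler_peMl ?sqr_ge0.
lra.
Qed.

Lemma pos_sqr_expand (a b : R) : Num.max a 0 ^+ 2 <=
  Num.max b 0 ^+ 2 + 2 * Num.max b 0 * (a - b) + (a - b) ^+ 2.
Proof.
have := sqr_ge0 a; have := sqr_ge0 (a - b).
case: (leP a 0) => a0; case: (leP b 0) => b0; [lra|lra| |lra].
have : 0 <= a * - b by rewrite mulr_ge0//; lra.
have := sqr_ge0 b; lra.
Qed.

Lemma nsq0_ae f : sqint f -> nsq f = 0 -> {ae mu, forall x, f x = 0}.
Proof.
move=> f2 f0; have := nsqE f2; rewrite f0 => E.
have mf : measurable_fun setT (fun x => (f x ^+ 2)%:E).
  by apply/measurable_EFinP; apply: measurable_funX; case: f2.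
have := (ae_eq_integral_abs mu measurableT mf).1.
have -> : (\int[mu]_x `|(f x ^+ 2)%:E| = \int[mu]_x (f x ^+ 2)%:E)%E.
  by apply: eq_integral => x _; rewrite gee0_abs// lee_fin sqr_ge0.
rewrite -E => /(_ erefl); apply: filterS => x /(_ I) /= [/eqP].
by rewrite sqrf_eq0 => /eqP.
Qed.

Lemma ae_nsq0 f : sqint f -> {ae mu, forall x, f x = 0} -> nsq f = 0.
Proof.
move=> f2 f0; apply: EFin_inj; rewrite nsqE//.
have mf : measurable_fun setT (fun x => (f x ^+ 2)%:E).
  by apply/measurable_EFinP; apply: measurable_funX; case: f2.
have <- : (\int[mu]_x `|(f x ^+ 2)%:E| = \int[mu]_x (f x ^+ 2)%:E)%E.
  by apply: eq_integral => x _; rewrite gee0_abs// lee_fin sqr_ge0.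
apply/(ae_eq_integral_abs mu measurableT mf).
by apply: filterS f0 => x fx _; rewrite /= fx expr0n.
Qed.

(** Order preservation: by T-monotonicity the integral of the squared positive
    part of the difference does not increase. *)
Lemma flow_comparison u v : flow u -> flow v ->
  {ae mu, forall x, u 0 x <= v 0 x} ->
  forall t, 0 <= t -> {ae mu, forall x, u t x <= v t x}.
Proof.
move=> [u2 cu du] [v2 cv dv] uv0.
pose w t x := u t x - v t x.
have w2 t : 0 <= t -> sqint (w t) by move=> t0; apply: sqintB; [exact: u2|exact: v2].
have cw : L2_continuous w by exact: L2_continuousB.
pose P f := nsq (pos f).
have pw2 t : 0 <= t -> sqint (pos (w t)) by move=> t0; apply: sqint_pos; exact: w2.
have L1p t : 0 <= t -> L1 (fun x => pos (w t) x ^+ 2) by move=> t0; exact: sqint_sqr (pw2 _ t0).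
have key t r : 0 <= t -> 0 <= r -> P (w r) <= P (w t) +
     Int (fun x => (2 * pos (w t) x) * (w r x - w t x)) + 1 * nsq (fun x => w r x - w t x).
  move=> t0 r0; have k2 := sqintB (w2 _ r0) (w2 _ t0).
  have i1 := sqint_mul (sqintZ 2 (pw2 _ t0)) k2.
  rewrite mul1r /P /nsq -IntD; [|exact: L1p|exact: i1].
  rewrite -IntD; [|by apply: L1D; [exact: L1p|exact: i1]|exact: (sqint_sqr k2)].
  apply: Int_le; first exact: L1p.
    by apply: L1D; [apply: L1D; [exact: L1p|exact: i1]|exact: (sqint_sqr k2)].
  by move=> x; exact: pos_sqr_expand.
have cP t : 0 <= t -> forall e, 0 < e -> exists2 d : R, 0 < d &
    forall r, 0 <= r -> `|r - t| < d -> `|P (w r) - P (w t)| <= e.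
  apply: (@L2_continuous_functional w P (fun t => nsq (w t)) 2) => //.
    by move=> r _; exact: nsq_ge0.
  move=> r r' l r0 r'0 /andP[l0 l1].
  have k2 := sqintB (w2 _ r'0) (w2 _ r0).
  have i1 := L1Z l (sqint_sqr (w2 _ r0)); have i2 := L1Z (2 / l) (sqint_sqr k2).
  rewrite /P /nsq -(IntZ l (sqint_sqr (w2 _ r0))) -(IntZ (2 / l) (sqint_sqr k2)) -(IntD i1 i2).
  apply: (Int_dist (L1p _ r'0) (L1p _ r0) (L1D i1 i2)) => x.
  exact: (pos_sqr_dist (w r' x) (w r x) l0 l1).
have dP t : 0 < t -> forall e, 0 < e -> exists2 d : R, 0 < d &
    forall h, 0 < h < d -> P (w (t + h)) <= P (w t) + h * e.
  move=> t0 e e0.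
  have [xi sub dxi] := du t t0; have [zeta sub' dze] := dv t t0.
  have [_ /Lfun2P xi2 _ _] := sub; have [_ /Lfun2P ze2 _ _] := sub'.
  have xi2' : sqint (fun x => - xi x).
    by have := sqintZ (-1) xi2; congr sqint; apply/funext => x; rewrite mulN1r.
  have ze2' : sqint (fun x => - zeta x).
    by have := sqintZ (-1) ze2; congr sqint; apply/funext => x; rewrite mulN1r.
  have dw := L2_right_derivativeB t0 u2 v2 xi2' ze2' dxi dze.
  have := @functional_dini R N w t _ (fun x => 2 * pos (w t) x) P 1 0 t0 w2
    (sqintB xi2' ze2') dw (sqintZ 2 (pw2 _ (ltW t0))) ler01
    (fun r Hr => key t r (ltW t0) Hr) _ e e0.
  rewrite add0r; apply.
  have := subdifferential_Tmonotone sub sub'; rewrite -/(w t) => H.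
  have -> : Int (fun x => 2 * pos (w t) x * (- xi x - - zeta x)) =
      (-2) * Int (fun x => pos (w t) x * (xi x - zeta x)).
    rewrite -IntZ; last exact: (sqint_mul (pw2 _ (ltW t0)) (sqintB xi2 ze2)).
    by apply: eq_Int => x; ring.
  by rewrite mulNr oppr_le0 mulr_ge0.
move=> t t0.
have Pt : P (w t) <= P (w 0) by exact: (dini_nonincreasing cP dP t0).
have P0 : P (w 0) = 0.
  apply: ae_nsq0; [exact: pw2|]; apply: filterS uv0 => x uvx.
  by rewrite /pos /w max_r// subr_le0.
have : P (w t) = 0 by apply/eqP; rewrite eq_le nsq_ge0 -P0 Pt.
move=> /(nsq0_ae (pw2 _ t0)); apply: filterS => x.
by rewrite /pos /w => /eqP; rewrite eq_le ge_max subr_le0 => /andP[/andP[]].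
Qed.

End comparison.

(** * Modification on null sets *)

Section almost_everywhere.
Context {R : realType} {N : nat} (s p : R).
Hypotheses (hs : 0 < s < 1) (hp : 1 < p < 2).
Local Notation T := (Rn R N).
Local Notation mu := (@lebesgueRn R N).
Local Notation mu2 := (mu \x mu)%E.
Local Notation flow := (@flow R N s p).
Implicit Types (f g : T -> R) (u v w : R -> T -> R) (t r h e d a b c : R).

Lemma ae_fst (P : T -> Prop) : {ae mu, forall x, P x} -> {ae mu2, forall z, P z.1}.
Proof.
move=> [A [mA A0 PA]]; exists (A `*` setT); split.
- exact: measurableX.
- transitivity (mu A * mu setT)%E; first exact: product_measure1E.
  by rewrite (_ : mu A = 0)%E ?mul0e.
- by move=> [x y] /= Pxy; split => //; exact: PA.
Qed.

Lemma ae_snd (P : T -> Prop) : {ae mu, forall x, P x} -> {ae mu2, forall z, P z.2}.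
Proof.
move=> [A [mA A0 PA]]; exists (setT `*` A); split.
- exact: measurableX.
- transitivity (mu setT * mu A)%E; first exact: product_measure1E.
  by rewrite (_ : mu A = 0)%E ?mule0.
- by move=> [x y] /= Pxy; split => //; exact: PA.
Qed.

Lemma int_ae_eq (k : measure_display) (X : measurableType k) (m : {measure set X -> \bar R}) (F G : X -> R) :
  measurable_fun setT F -> measurable_fun setT G -> {ae m, forall x, F x = G x} ->
  (\int[m]_x (F x)%:E = \int[m]_x (G x)%:E)%E.
Proof.
move=> mF mG FG; apply: ae_eq_integral => //; try exact/measurable_EFinP.
by apply: filterS FG => x -> _.
Qed.

Lemma penergy_ae f g : measurable_fun setT f -> measurable_fun setT g ->
  {ae mu, forall x, f x = g x} -> penergy s p f = penergy s p g.
Proof.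
move=> mf mg fg; rewrite !penergyE; apply: int_ae_eq.
- exact: (measurable_penergy s p mf).
- exact: (measurable_penergy s p mg).
- by apply: filterS2 (ae_fst fg) (ae_snd fg) => z -> ->.
Qed.

Lemma nsq_ae f g : measurable_fun setT f -> measurable_fun setT g ->
  {ae mu, forall x, f x = g x} -> nsq f = nsq g.
Proof.
move=> mf mg fg; rewrite /nsq /Int /Rintegral; congr fine; apply: int_ae_eq.
- exact: measurable_funX.
- exact: measurable_funX.
- by apply: filterS fg => x ->.
Qed.

Lemma Int_ae f g : measurable_fun setT f -> measurable_fun setT g ->
  {ae mu, forall x, f x = g x} -> Int f = Int g.
Proof. by move=> mf mg fg; rewrite /Int /Rintegral; congr fine; apply: int_ae_eq. Qed.

Lemma Int_ae_le f g : L1 f -> L1 g ->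
  {ae mu, forall x, f x <= g x} -> Int f <= Int g.
Proof.
move=> fi gi fg; rewrite -subr_ge0 -IntB//.
have mf : measurable_fun setT f by apply/measurable_EFinP; case/integrableP: fi.
have mg : measurable_fun setT g by apply/measurable_EFinP; case/integrableP: gi.
rewrite (@Int_ae _ (pos (fun x => g x - f x))).
- by apply: Int_ge0 => x; exact: pos_ge0.
- exact: measurable_funB.
- by apply: measurable_maxr => //; exact: measurable_funB.
- by apply: filterS fg => x fgx; rewrite /pos max_l// subr_ge0.
Qed.

Lemma sqint_ae f g : sqint f -> measurable_fun setT g ->
  {ae mu, forall x, f x = g x} -> sqint g.
Proof.
move=> [mf f2] mg fg; split => //; apply: le_lt_trans f2.
rewrite le_eqVlt; apply/orP; left; apply/eqP; apply: int_ae_eq.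
- exact: measurable_funX.
- exact: measurable_funX.
- by apply: filterS fg => x ->.
Qed.

Lemma subdifferential_ae f g xi : measurable_fun setT g ->
  {ae mu, forall x, f x = g x} ->
  subdifferential (energy s p) f xi -> subdifferential (energy s p) g xi.
Proof.
move=> mg fg [/Lfun2P f2 /Lfun2P xi2 Jf sub].
have g2 := sqint_ae f2 mg fg.
have E : energy s p g = energy s p f by rewrite !energyE (penergy_ae f2.1 mg fg).
split; [exact/Lfun2P|exact/Lfun2P|by rewrite E|].
move=> v /[dup] vL /Lfun2P v2; rewrite E.
have -> : \int[mu]_x (xi x * (v x - g x)) = \int[mu]_x (xi x * (v x - f x)).
  apply: Int_ae.
  - by apply: measurable_funM; [exact: xi2.1|exact: measurable_funB v2.1 mg].
  - by apply: measurable_funM; [exact: xi2.1|exact: measurable_funB v2.1 f2.1].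
  - by apply: filterS fg => x ->.
exact: sub.
Qed.

(** The inequalities at pairs of points need functions that are nonnegative
    everywhere, so representatives have to be changed. *)
Lemma flow_ae u v : flow u -> (forall t, 0 <= t -> measurable_fun setT (v t)) ->
  (forall t, 0 <= t -> {ae mu, forall x, u t x = v t x}) -> flow v.
Proof.
move=> [u2 cu du] mv uv.
have v2 t : 0 <= t -> sqint (v t) by move=> t0; exact: sqint_ae (u2 t t0) (mv t t0) (uv t t0).
split => // [t t0 e e0|t t0].
  have [d d0 Hd] := cu t t0 e e0; exists d => // r Hr /(Hd r Hr).
  rewrite (@nsq_ae _ (fun x => v r x - v t x))//.
  - exact: (sqintB (u2 _ Hr) (u2 _ t0)).1.
  - exact: (sqintB (v2 _ Hr) (v2 _ t0)).1.
  - by apply: filterS2 (uv _ Hr) (uv _ t0) => x -> ->.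
have t0' := ltW t0.
have [xi sub dxi] := du t t0; exists xi; first exact: subdifferential_ae (mv _ t0') (uv _ t0') sub.
move=> e e0; have [d d0 Hd] := dxi e e0; exists d => // h hd; have := Hd h hd.
have [_ /Lfun2P xi2 _ _] := sub.
have xi2' : sqint (fun x => - xi x).
  by have := sqintZ (-1) xi2; congr sqint; apply/funext => x; rewrite mulN1r.
have th : 0 <= t + h by move: hd => /andP[h0 _]; lra.
rewrite (@nsq_ae _ (fun x => (v (t + h) x - v t x) / h - - xi x))//.
- exact: (sqint_quot (u2 _ th) (u2 _ t0') xi2').1.
- exact: (sqint_quot (v2 _ th) (v2 _ t0') xi2').1.
- by apply: filterS2 (uv _ th) (uv _ t0') => x -> ->.
Qed.

End almost_everywhere.

(** * Homogeneity and the time derivative *)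

Section scaling.
Context {R : realType} {N : nat} (s p : R).
Hypotheses (hs : 0 < s < 1) (hp : 1 < p < 2).
Local Notation T := (Rn R N).
Local Notation mu := (@lebesgueRn R N).
Local Notation mu2 := (mu \x mu)%E.
Local Notation flow := (@flow R N s p).
Implicit Types (f g : T -> R) (u v w : R -> T -> R) (t r h e d a b c : R).

Lemma penergyZ c f : 0 < c -> measurable_fun setT f ->
  penergy s p (fun x => c * f x)%R = ((c `^ p)%:E * penergy s p f)%E.
Proof.
move=> c0 mf; rewrite !penergyE -intZ; last 3 first.
- exact: (measurable_penergy s p mf).
- exact: powR_ge0.
- exact: penergy_int_ge0.
apply: eq_integral => z _; congr EFin.
by rewrite -mulrBr normrM (gtr0_norm c0) powRM ?(ltW c0)// mulrA.
Qed.

Lemma energyZ c f : 0 < c -> measurable_fun setT f ->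
  energy s p (fun x => c * f x)%R = ((c `^ p)%:E * energy s p f)%E.
Proof. by move=> c0 mf; rewrite !energyE penergyZ// muleCA. Qed.

Lemma subdifferentialZ c f xi : 0 < c -> subdifferential (energy s p) f xi ->
  subdifferential (energy s p) (fun x => c * f x) (fun x => c `^ (p - 1) * xi x).
Proof.
move=> c0 [/Lfun2P f2 /Lfun2P xi2 Jf sub].
have cp : 0 < c `^ p by exact: powR_gt0.
have p0 : 0 < p by case/andP: hp => p1 _; exact: lt_trans ltr01 p1.
split.
- by apply/Lfun2P; exact: sqintZ.
- by apply/Lfun2P; exact: sqintZ.
- rewrite energyZ//; last exact: f2.1.
  by apply: lte_mul_pinfty => //; rewrite lee_fin ltW.
move=> v /Lfun2P v2.
have vc2 := sqintZ c^-1 v2.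
have := sub _ ((Lfun2P _).2 vc2).
have vE : v = (fun x => c * (c^-1 * v x)).
  by apply/funext => x; rewrite mulrA divff ?mul1r// gt_eqF.
rewrite [in X in _ -> X]vE (energyZ c0 vc2.1) (energyZ c0 f2.1).
have -> : \int[mu]_x (c `^ (p - 1) * xi x * (c * (c^-1 * v x) - c * f x)) =
    c `^ p * \int[mu]_x (xi x * (c^-1 * v x - f x)).
  rewrite -[RHS](IntZ _ (sqint_mul xi2 (sqintB vc2 f2))).
  by apply: eq_Int => x; rewrite -mulrBr -(mulr_powRB1 (ltW c0) p0); ring.
rewrite EFinM -muleDr//; last by rewrite fin_num_adde_defl.
by move=> H; rewrite lee_pmul2l.
Qed.

(** The exponent comes from the balance between the time derivative, homogeneous
    of degree [1], and the operator, homogeneous of degree [p - 1]. *)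
Lemma flow_scale u l : 0 < l -> flow u ->
  flow (fun t x => l `^ (- (2 - p)^-1) * u (l * t) x).
Proof.
move=> l0 [u2 cu du]; have [p1 p2] := andP hp.
set c := l `^ _; have c0 : 0 < c by exact: powR_gt0.
have lt t : 0 <= t -> 0 <= l * t by move=> t0; rewrite mulr_ge0// ltW.
have v2 t : 0 <= t -> sqint (fun x => c * u (l * t) x).
  by move=> t0; apply: sqintZ; apply: u2; exact: lt.
split => // [t t0 e e0|t t0].
  have e'0 : 0 < e / c ^+ 2 by rewrite divr_gt0 ?exprn_gt0.
  have [d d0 Hd] := cu _ (lt t t0) _ e'0.
  exists (d / l); first by rewrite divr_gt0.
  move=> r Hr rt.
  have := Hd _ (lt r Hr); rewrite -mulrBr normrM (gtr0_norm l0) mulrC -ltr_pdivlMr// => /(_ rt).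
  rewrite ler_pdivlMr ?exprn_gt0// mulrC -nsqZ; last exact: sqintB (u2 _ (lt r Hr)) (u2 _ (lt t t0)).
  by congr (_ <= _); apply: eq_Int => x; rewrite mulrBr.
have [xi sub dxi] := du _ (mulr_gt0 l0 t0).
have cl : c `^ (p - 1) = c * l.
  rewrite /c -{3}(powRr1 (ltW l0)) -gt0_powRD// -powRrM; congr powR; field.
  by rewrite subr_eq0 gt_eqF.
exists (fun x => c `^ (p - 1) * xi x); first exact: subdifferentialZ.
move=> e e0.
have e'0 : 0 < e / (c * l) ^+ 2 by rewrite divr_gt0 ?exprn_gt0 ?mulr_gt0.
have [d d0 Hd] := dxi _ e'0.
exists (d / l); first by rewrite divr_gt0.
move=> h /andP[h0]; rewrite ltr_pdivlMr// mulrC => hd.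
have := Hd (l * h); rewrite hd mulr_gt0// => /(_ isT).
rewrite ler_pdivlMr ?exprn_gt0 ?mulr_gt0// mulrC.
have [_ /Lfun2P xi2 _ _] := sub.
have xi2' : sqint (fun x => - xi x).
  by have := sqintZ (-1) xi2; congr sqint; apply/funext => x; rewrite mulN1r.
rewrite -nsqZ; last first.
  by apply: sqint_quot => //; apply: u2; rewrite ?addr_ge0 ?mulr_ge0// ltW.
congr (_ <= _); apply: eq_Int => x; congr (_ ^+ 2).
by rewrite cl (mulrDr l t h); field; rewrite !gt_eqF.
Qed.

(** The Benilan-Crandall estimate: for [l >= 1] the rescaled flow of
    [flow_scale] starts below the flow itself and stays there. Equivalently
    [t^(-1/(2-p)) u(t)] does not increase. *)
Lemma flow_homogeneity u l : flow u -> {ae mu, forall x, 0 <= u 0 x} -> 1 <= l ->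
  forall t, 0 <= t -> {ae mu, forall x, u (l * t) x <= l `^ (2 - p)^-1 * u t x}.
Proof.
move=> fu u0 l1 t t0; have [p1 p2] := andP hp.
have l0 : 0 < l by lra.
have := flow_comparison hp (flow_scale l0 fu) fu; rewrite /= mulr0 => cmp.
have : {ae mu, forall x, l `^ (- (2 - p)^-1) * u 0 x <= u 0 x}.
  apply: filterS u0 => x ux; rewrite ler_piMl//.
  rewrite powRN invf_le1 ?powR_gt0// -[leLHS](powRr0 l) ler_powR// invr_ge0; lra.
move=> /cmp /(_ t t0); apply: filterS => x.
by rewrite powRN ler_pdivrMl// powR_gt0.
Qed.

Lemma flow0 : flow (fun _ _ => 0).
Proof.
have [p1 p2] := andP hp.
have s0 : sqint (fun _ : T => 0).
  split; first exact: measurable_cst.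
  by rewrite expr0n/= integral0.
have n0 : nsq (fun _ : T => 0) = 0 by rewrite /nsq /Int /Rintegral expr0n/= integral0.
split => // [t t0 e e0|t t0]; first by exists 1 => // r _ _; rewrite subrr n0 ltW.
exists (fun=> 0); last first.
  by move=> e e0; exists 1 => // h _; rewrite !(subrr, mul0r, oppr0, subr0) n0 ltW.
have J0 : energy s p (fun _ : T => 0) = 0%E.
  rewrite energyE penergyE (eq_integral (cst 0%E)) ?integral0 ?mule0// => z _.
  by rewrite subrr normr0 powR0 ?mul0r// gt_eqF//; lra.
split; [exact/Lfun2P|exact/Lfun2P|by rewrite J0|].
move=> v _; rewrite J0 add0e.
have -> : \int[mu]_x (0 * (v x - 0)) = 0.
  by rewrite /Rintegral (eq_integral (cst 0%E)) ?integral0// => x _; rewrite mul0r.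
by rewrite energyE mule_ge0 ?penergy_ge0// lee_fin invr_ge0; lra.
Qed.

Lemma flow_ge0 u : flow u -> {ae mu, forall x, 0 <= u 0 x} ->
  forall t, 0 <= t -> {ae mu, forall x, 0 <= u t x}.
Proof. by move=> fu u0 t t0; exact: (flow_comparison hp flow0 fu u0). Qed.


(** A nonnegative function with [L f + c f >= 0], in the pairwise form of
    [pairing_gain] which is the only way in which this is used. *)
Definition supersolution c f := [/\ forall x, 0 <= f x, sqint f, (penergy s p f < +oo)%E &
  forall eta (G E : T * T -> R), admissible s p eta -> (forall x, 0 <= eta x) ->
    measurable_fun setT G -> measurable_fun setT E ->
    (forall z, 0 <= G z) -> (forall z, 0 <= E z) ->
    (forall z, pairing s p f eta z + G z + G (swap z) <= E z + E (swap z)) ->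
    (\int[mu2]_z (G z)%:E <=
       \int[mu2]_z (E z)%:E + (c * Int (fun x => (f x * eta x)%R))%R%:E)%E].

Lemma powR_1D_le a x : 1 < a -> 0 <= x <= 1 ->
  (1 + x) `^ a <= 1 + a * 2 `^ (a - 1) * x.
Proof.
move=> a1 /andP[x0 x1]; have := powR_tangent (1 + x) 1 a1.
rewrite normr1 powR1 ger0_norm ?addr_ge0// Phi_pos ?addr_ge0//.
have -> : 1 - (1 + x) = - x by ring.
have : (1 + x) `^ (a - 1) * x <= 2 `^ (a - 1) * x.
  by rewrite ler_wpM2r// ge0_ler_powR ?nnegrE//; lra.
move=> /(ler_wpM2l (ltW (lt_trans ltr01 a1))); lra.
Qed.

(** The Benilan-Crandall estimate at [(1 + h / t) t] bounds the right derivative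
    from above by a multiple of [u t / t], with a constant that depends on [p]
    only. *)
Lemma flow_supersolution t : 0 < t -> exists2 c : R, 0 <= c & forall u, flow u ->
  (forall r x, 0 <= r -> 0 <= u r x) -> supersolution c (u t).
Proof.
move=> t0; have [p1 p2] := andP hp.
set a := (2 - p)^-1; have a1 : 1 < a by rewrite invf_gt1; lra.
pose M := a * 2 `^ (a - 1); have M0 : 0 <= M by rewrite mulr_ge0 ?powR_ge0//; lra.
exists (M / t); first by rewrite divr_ge0// ltW.
move=> u fu u0; have t0' := ltW t0.
have [u2 _ du] := fu; have [xi sub dxi] := du t t0.
have [_ /Lfun2P xi2 Jt _] := sub.
split; [by move=> x; exact: u0|exact: u2|exact: energy_lty|].
move=> eta G E adm eta0 mG mE G0 E0 key.
have gain := pairing_gain hp sub adm mG mE G0 E0 key.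
have eta2 := adm.1.
have xi2' : sqint (fun x => - xi x).
  by have := sqintZ (-1) xi2; congr sqint; apply/funext => x; rewrite mulN1r.
have lower : - Int (fun x => xi x * eta x) <= M / t * Int (fun x => u t x * eta x).
  apply/ler_addgt0Pr => e e0.
  have n0 := nsq_ge0 eta.
  pose l := e / (nsq eta + 1); have l0 : 0 < l by rewrite divr_gt0//; lra.
  have le0 : 0 < l * e by rewrite mulr_gt0.
  have [d d0 Hd] := dxi _ le0.
  pose h := Num.min (d / 2) t.
  have h0 : 0 < h by rewrite lt_min t0 andbT; lra.
  have hd : h < d by rewrite (@le_lt_trans _ _ (d / 2))// ?ge_min ?lexx//; lra.
  have ht : h <= t by rewrite ge_min lexx orbT.
  have := Hd h; rewrite h0 => /(_ hd).
  have th : 0 <= t + h by lra.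
  pose q x := (u (t + h) x - u t x) / h - - xi x.
  have q2 : sqint q by exact: (sqint_quot (u2 _ th) (u2 _ t0') xi2').
  rewrite -/(nsq q) => nq.
  have := Int_young l0 (sqintZ (-1) eta2) q2.
  rewrite nsqZ// sqrrN expr1n mul1r.
  have : l^-1 * nsq q <= e by rewrite mulrC ler_pdivrMr// mulrC.
  have : l * nsq eta <= e.
    rewrite /l mulrAC ler_pdivrMr ?ltr_wpDl ?nsq_ge0//.
    by apply: ler_wpM2l; [exact: ltW|rewrite lerDl].
  have quot2 : sqint (fun x => (u (t + h) x - u t x) / h).
    have := sqintZ h^-1 (sqintB (u2 _ th) (u2 _ t0')).
    by congr sqint; apply/funext => x; rewrite mulrC.
  have -> : Int (fun x => -1 * eta x * q x) =
    - (Int (fun x => (u (t + h) x - u t x) / h * eta x) + Int (fun x => xi x * eta x)).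
    rewrite -IntD; [|exact: (sqint_mul quot2 eta2)|exact: (sqint_mul xi2 eta2)].
    rewrite -[RHS]mulN1r -IntZ; last first.
      by apply: L1D; [exact: (sqint_mul quot2 eta2)|exact: (sqint_mul xi2 eta2)].
    by apply: eq_Int => x; rewrite /q; ring.
  have qle : Int (fun x => (u (t + h) x - u t x) / h * eta x) <=
      M / t * Int (fun x => u t x * eta x).
    have ue := sqint_mul (u2 _ t0') eta2.
    rewrite -(IntZ _ ue); apply: Int_ae_le.
    - exact: (sqint_mul quot2 eta2).
    - exact: (L1Z _ ue).
    (* the time [t + h] is reached from [t] by the dilation of ratio [1 +
       h/t] *)
    have l1 : 1 <= 1 + h / t by rewrite lerDl divr_ge0// ltW.
    have u00 : {ae mu, forall x, 0 <= u 0 x} by apply: aeW => x; exact: u0.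
    have := flow_homogeneity fu u00 l1 t0'.
    have -> : (1 + h / t) * t = t + h by field; rewrite gt_eqF.
    apply: filterS => x ux; rewrite mulrA ler_wpM2r// ler_pdivrMr// lerBlDl.
    apply: (le_trans ux); have ht1 : h / t <= 1 by rewrite ler_pdivrMr// mul1r.
    have ht0 : 0 <= h / t by rewrite divr_ge0// ltW.
    have := @powR_1D_le a (h / t) a1; rewrite ht0 ht1 => /(_ isT).
    rewrite -/M => /(ler_wpM2r (u0 t x t0')) /le_trans; apply.
    by rewrite mulrDl mul1r lerD2l le_eqVlt; apply/orP; left; apply/eqP; ring.
  move: qle; clear; lra.
move: gain; have -> : \int[mu]_x (xi x * eta x) = Int (fun x => xi x * eta x) by [].
move: lower; set I := Int _; set I' := Int _ => lower.
have := int_ge0 mu2 G0; have := int_ge0 mu2 E0.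
case: (\int[mu2]_z (G z)%:E)%E => //; case: (\int[mu2]_z (E z)%:E)%E => //.
- move=> e g _ _; rewrite -!EFinD !lee_fin; move: lower; clear; lra.
- by move=> *; rewrite addye// leey.
Qed.

End scaling.

(** * Cutoff functions *)

Section cutoff.
Context {R : realType} {N : nat} (s p : R).
Hypotheses (hs : 0 < s < 1) (hp : 1 < p < 2).
Local Notation T := (Rn R N).
Local Notation mu := (@lebesgueRn R N).
Local Notation mu2 := (mu \x mu)%E.
Local Notation K := (@kernel R N (s * p)).
Implicit Types (f g : T -> R) (t h e d a b c : R).

Let sp0 : 0 < s * p.
Proof. by have [s0 s1] := andP hs; have [p1 p2] := andP hp; rewrite mulr_gt0//; lra. Qed.

Let spp : s * p < p.
Proof. by have [s0 s1] := andP hs; have [p1 p2] := andP hp; rewrite gtr_pMl//; lra. Qed.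

(** The kernel times [min(1, |x - y|)^p]: what is left of the kernel against
    bounded Lipschitz functions. Its integral in [y] is bounded. *)
Definition tamed (z : T * T) : R :=
  edist z.1 z.2 `^ p * K z.1 z.2 * (edist z.1 z.2 < 1)%R%:R +
  K z.1 z.2 * (1 <= edist z.1 z.2)%R%:R.

Lemma measurable_boolR k (X : measurableType k) (P : X -> bool) :
  measurable_fun setT P -> measurable_fun setT (fun x => (P x)%:R : R).
Proof.
move=> mP; have -> : (fun x => (P x)%:R : R) = (fun x => if P x then 1 else 0).
  by apply/funext => x; case: (P x).
by apply: measurable_fun_ifT.
Qed.

Lemma measurable_tamed : measurable_fun setT tamed.
Proof.
have md := @measurable_edist R N; have mK := @measurable_kernel R N (s * p).
apply: measurable_funD; apply: measurable_funM => //.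
- by apply: measurable_funM => //; exact: measurable_powRn.
- by apply: measurable_boolR; exact: measurable_fun_ltr.
- by apply: measurable_boolR; exact: measurable_fun_ler.
Qed.

Lemma tamed_ge0 z : 0 <= tamed z.
Proof. by rewrite addr_ge0// ?mulr_ge0 ?powR_ge0 ?kernel_ge0. Qed.

Lemma measurable_section (F : T * T -> R) x : measurable_fun setT F ->
  measurable_fun setT (fun y => F (x, y)).
Proof. by move=> mF; apply: measurableT_comp mF _; exact: pair1_measurable. Qed.

Lemma measurable_int_section (F : T * T -> R) : measurable_fun setT F ->
  (forall z, 0 <= F z) -> measurable_fun setT (fun x => \int[mu]_y (F (x, y))%:E)%E.
Proof.
move=> mF F0; apply: (@measurable_fun_fubini_tonelli_F _ _ _ _ _ mu (EFin \o F)).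
  exact/measurable_EFinP.
by move=> z; rewrite /= lee_fin.
Qed.

Lemma indicE_bool (A : set T) (P : T -> bool) y : (A y <-> P y) ->
  \1_A y = (P y)%:R :> R.
Proof.
move=> AP; rewrite indicE; congr ((_ : bool)%:R).
by apply/idP/idP => [/set_mem/AP|/AP/mem_set].
Qed.

Lemma kernel_near_bool : exists2 C : R, 0 < C & forall x r, 0 < r ->
  (\int[mu]_y (edist x y `^ p * K x y * (edist x y < r)%R%:R)%:E <=
     (C * r `^ (p - s * p))%:E)%E.
Proof.
have [|C C0 H] := @kernel_near R N (s * p) p; first by rewrite sp0 spp.
exists C => // x r r0; apply: le_trans (H x r r0).
rewrite le_eqVlt; apply/orP; left; apply/eqP; apply: eq_integral => y _.
by rewrite (@indicE_bool _ (fun y => edist x y < r)).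
Qed.

Lemma kernel_far_bool : exists2 C : R, 0 < C & forall x r, 0 < r ->
  (\int[mu]_y (K x y * (r <= edist x y)%R%:R)%:E <= (C * r `^ (- (s * p)))%:E)%E.
Proof.
have [C C0 H] := @kernel_far R N (s * p) sp0.
exists C => // x r r0; apply: le_trans (H x r r0).
rewrite le_eqVlt; apply/orP; left; apply/eqP; apply: eq_integral => y _.
rewrite (@indicE_bool _ (fun y => r <= edist x y))// /eball/=.
by rewrite leNgt; split => [/negP|/negP].
Qed.

Lemma tamed_bound : exists2 C : R, 0 < C & forall x,
  (\int[mu]_y (tamed (x, y))%:E <= C%:E)%E.
Proof.
have [C C0 HC] := kernel_near_bool; have [D D0 HD] := kernel_far_bool.
exists (C + D); first exact: addr_gt0.
move=> x; have md := @measurable_edistl R N x.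
have mK := @measurable_kernell R N (s * p) x.
rewrite /tamed/= intD.
- rewrite EFinD; apply: leeD.
    by have := HC x 1 ltr01; rewrite powR1 mulr1.
  by have := HD x 1 ltr01; rewrite powR1 mulr1.
- apply: measurable_funM; last by apply: measurable_boolR; exact: measurable_fun_ltr.
  by apply: measurable_funM => //; exact: measurable_powRn.
- by apply: measurable_funM => //; apply: measurable_boolR; exact: measurable_fun_ler.
- by move=> y; rewrite !mulr_ge0 ?powR_ge0 ?kernel_ge0.
- by move=> y; rewrite mulr_ge0 ?kernel_ge0.
Qed.

(** Errors of this form are controlled by the measure of the set from which they
    originate. *)
Lemma int2_tamed (C c : R) (S : T -> bool) (F : T * T -> R) :
  (forall x, (\int[mu]_y (tamed (x, y))%:E <= C%:E)%E) -> 0 <= c ->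
  measurable_fun setT S -> measurable_fun setT F -> (forall z, 0 <= F z) ->
  (forall z, F z <= c * (S z.1)%:R * tamed z) ->
  (\int[mu2]_z (F z)%:E <= (c * C)%:E * mu [set x | S x])%E.
Proof.
move=> HC c0 mS mF F0 FS.
have mT := measurable_tamed.
have mB : measurable_fun setT (fun z : T * T => c * (S z.1)%:R * tamed z).
  apply: measurable_funM => //; apply: measurable_funM => //.
  exact: (measurable_fst_fun (measurable_boolR mS)).
have C0 : 0 <= C.
  have := HC (@zeroRn R N); apply: contraTT; rewrite -ltNge => C0.
  rewrite -ltNge (lt_le_trans _ (int_ge0 _ _)) ?lte_fin//.
  by move=> y; exact: tamed_ge0.
apply: (@le_trans _ _ (\int[mu2]_z (c * (S z.1)%:R * tamed z)%:E)%E).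
  exact: int_le.
rewrite int2E//; last by move=> z; rewrite !mulr_ge0 ?tamed_ge0.
have mSet : measurable [set x | S x].
  by rewrite -[X in measurable X]setTI; apply: (mS measurableT [set true]).
have -> : ((c * C)%:E * mu [set x | S x] = \int[mu]_x (c * C * \1_[set x | S x] x)%:E)%E.
  rewrite intZ ?mulr_ge0//.
  by rewrite integral_indic// setIT.
apply: ge0_le_integral => //.
- by move=> x _; apply: int_ge0 => y; rewrite !mulr_ge0 ?tamed_ge0.
- apply: (measurable_int_section mB) => z; by rewrite !mulr_ge0 ?tamed_ge0.
- by apply/measurable_EFinP; apply: measurable_funM => //; exact: measurable_indic.
- move=> x _ /=; rewrite intZ//; last 3 first.
  + exact: (measurable_section x mT).
  + by rewrite mulr_ge0.
  + by move=> y; exact: tamed_ge0.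
  rewrite (@indicE_bool _ S)//.
  have -> : ((c * C * (S x)%:R)%:E = (c * (S x)%:R)%:E * C%:E)%E by rewrite -EFinM mulrAC.
  by rewrite lee_wpmul2l// lee_fin mulr_ge0.
Qed.


(** A pair contributes only if one of its points is in the support, and then at
    most a multiple of [tamed]. *)
Lemma penergy_lipschitz (g : T -> R) x0 r A : 0 < r -> 0 <= A -> measurable_fun setT g ->
  (forall x y, `|g x - g y| <= A * edist x y) -> (forall x, 0 <= g x <= A) ->
  (forall x, r <= edist x0 x -> g x = 0) -> (penergy s p g < +oo)%E.
Proof.
move=> r0 A0 mg lip gA supp; have [p1 p2] := andP hp; have p0 : 0 < p by lra.
have [C C0 HC] := tamed_bound.
pose S x := edist x0 x < r.
have mS : measurable_fun setT S.
  by apply: measurable_fun_ltr => //; exact: measurable_edistl.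
have mT := measurable_tamed.
have [mB B0] : measurable_fun setT (fun z : T * T => A `^ p * (S z.1)%:R * tamed z) /\
    (forall z : T * T, 0 <= A `^ p * (S z.1)%:R * tamed z).
  split; last by move=> z; rewrite !mulr_ge0 ?powR_ge0 ?tamed_ge0.
  apply: measurable_funM => //; apply: measurable_funM => //.
  exact: (measurable_fst_fun (measurable_boolR mS)).
set B := fun z : T * T => _ in mB B0.
have mBs : measurable_fun setT (B \o swap) by exact: measurableT_comp mB measurable_swap.
have bound z : `|g z.1 - g z.2| `^ p * K z.1 z.2 <= A `^ p * tamed z.
  rewrite /tamed; case: ltP => d1 /=; rewrite ?mulr1 ?mulr0 ?addr0 ?add0r.
    rewrite mulrA ler_wpM2r ?kernel_ge0// -powRM ?edist_ge0//.
    by rewrite ge0_ler_powR ?nnegrE ?mulr_ge0 ?edist_ge0// ltW.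
  rewrite ler_wpM2r ?kernel_ge0// ge0_ler_powR ?nnegrE ?(ltW p0)//.
  have := gA z.1; have := gA z.2; rewrite ler_norml; lra.
apply: (@le_lt_trans _ _ (\int[mu2]_z (B z + (B \o swap) z)%:E)%E).
  rewrite penergyE; apply: int_le.
  - exact: (measurable_penergy s p mg).
  - exact: measurable_funD mB mBs.
  - exact: penergy_int_ge0.
  - move=> z; rewrite /B /=.
    have ts : tamed (swap z) = tamed z by rewrite /tamed /swap/= edistC kernelC.
    rewrite ts -mulrDl -mulrDr.
    have [S1|S1] := boolP (S z.1).
      apply: (le_trans (bound z)); rewrite ler_wpM2r ?tamed_ge0// ler_peMr ?powR_ge0//.
      by rewrite lerDl.
    have [S2|S2] := boolP (S z.2).
      by apply: (le_trans (bound z)); rewrite ler_wpM2r ?tamed_ge0// add0r mulr1.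
    rewrite !supp ?subrr ?normr0 ?powR0 ?mul0r ?gt_eqF//; last 2 first.
    - by rewrite leNgt.
    - by rewrite leNgt.
    by rewrite !mulr_ge0 ?powR_ge0 ?tamed_ge0.
rewrite (intD _ mB mBs B0 (fun z => B0 (swap z))) (int2_swap mB B0).
have H : (\int[mu2]_z (B z)%:E < +oo)%E.
  apply: (le_lt_trans (int2_tamed HC (powR_ge0 A p) mS mB B0 (fun z => lexx _))).
  apply: lte_mul_pinfty => //; first by rewrite lee_fin mulr_ge0 ?powR_ge0// ltW.
  exact: eball_fin.
exact: lte_add_pinfty.
Qed.

Lemma subXX_le (a b : R) m : 0 <= b <= a -> a ^+ m - b ^+ m <= m%:R * a ^+ m.-1 * (a - b).
Proof.
move=> /andP[b0 ba]; have a0 : 0 <= a by lra.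
rewrite subrXX mulrC ler_wpM2r ?subr_ge0//.
apply: (@le_trans _ _ (\sum_(i < m) a ^+ m.-1)); last first.
  by rewrite sumr_const card_ord mulr_natl.
apply: ler_sum => i _.
have -> : a ^+ m.-1 = a ^+ (m.-1 - i) * a ^+ i.
  by rewrite -exprD subnK// -ltnS prednK// (leq_ltn_trans _ (ltn_ord i)).
by rewrite ler_wpM2l ?exprn_ge0// lerXn2r ?nnegrE.
Qed.

Variables (x0 : T) (r : R) (m : nat).
Hypotheses (hr : 0 < r <= 1) (hm : (2 <= m)%N).

(** The distance to the complement of a ball. Its powers [chi] are the cutoff
    functions: in a neighbourhood of [x] of size comparable to [theta x] the
    function [chi] is comparable to [chi x], and outside of it the kernel is
    integrable. *)
Definition theta x : R := Num.max (r - edist x0 x) 0.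
Definition chi x : R := theta x ^+ m.

Lemma theta_ge0 x : 0 <= theta x.
Proof. by rewrite le_max lexx orbT. Qed.

Lemma theta_le1 x : theta x <= 1.
Proof. by rewrite ge_max ler01 andbT; have := edist_ge0 x0 x; have [_ r1] := andP hr; lra. Qed.

Lemma theta_lip x y : theta x - theta y <= edist x y.
Proof.
rewrite /theta lerBlDr ge_max; apply/andP; split; last first.
  by rewrite addr_ge0 ?edist_ge0// le_max lexx orbT.
rewrite -lerBlDl le_max; apply/orP; left.
have := edist_triangle x x0 y; lra.
Qed.

Lemma chi_ge0 x : 0 <= chi x.
Proof. by rewrite exprn_ge0// theta_ge0. Qed.

Lemma chi_le1 x : chi x <= 1.
Proof. by rewrite exprn_ile1 ?theta_ge0 ?theta_le1. Qed.

Lemma measurable_theta : measurable_fun setT theta.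
Proof.
apply: measurable_maxr => //; apply: measurable_funB => //; exact: measurable_edistl.
Qed.

Lemma measurable_chi : measurable_fun setT chi.
Proof. by apply: measurable_funX; exact: measurable_theta. Qed.

Lemma theta_supp x : r <= edist x0 x -> theta x = 0.
Proof. by move=> rx; rewrite /theta max_r// subr_le0. Qed.

Lemma chi_supp x : r <= edist x0 x -> chi x = 0.
Proof. by move=> rx; rewrite /chi theta_supp// expr0n; case: m hm. Qed.

Lemma chi_diff x y : chi x - chi y <= m%:R * theta x ^+ m.-1 * edist x y.
Proof.
have H : 0 <= m%:R * theta x ^+ m.-1 :> R by rewrite mulr_ge0// exprn_ge0 ?theta_ge0.
have [xy|/ltW xy] := leP (theta x) (theta y).
  apply: (@le_trans _ _ 0); last by rewrite mulr_ge0// edist_ge0.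
  by rewrite subr_le0 lerXn2r ?nnegrE ?theta_ge0.
have := @subXX_le (theta x) (theta y) m; rewrite theta_ge0 xy => /(_ isT) /le_trans; apply.
by rewrite ler_wpM2l// theta_lip.
Qed.

Lemma chi_lip x y : `|chi x - chi y| <= m%:R * edist x y.
Proof.
have H (x' y' : T) : chi x' - chi y' <= m%:R * edist x' y'.
  apply: (le_trans (chi_diff x' y')); rewrite ler_wpM2r ?edist_ge0//.
  by rewrite ler_piMr// exprn_ile1 ?theta_ge0 ?theta_le1.
by rewrite ler_norml H andbT lerNl opprB edistC H.
Qed.

Lemma penergy_chi : (penergy s p chi < +oo)%E.
Proof.
have [r0 _] := andP hr.
apply: (@penergy_lipschitz _ x0 r m%:R) => //.
- exact: measurable_chi.
- exact: chi_lip.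
- move=> x; rewrite chi_ge0 (le_trans (chi_le1 x))// ler1n.
  exact: leq_trans hm.
- exact: chi_supp.
Qed.

Lemma sqint_chi : sqint chi.
Proof.
split; first exact: measurable_chi.
apply: (@le_lt_trans _ _ (\int[mu]_x (\1_(eball x0 r) x)%:E)%E).
  apply: int_le => [| |x|x].
  - by apply: measurable_funX; exact: measurable_chi.
  - by apply: measurable_indic; exact: measurable_eball.
  - exact: sqr_ge0.
  - rewrite (@indicE_bool _ (fun x => edist x0 x < r))//; case: ltP => xr.
      by rewrite exprn_ile1 ?chi_ge0 ?chi_le1.
    by rewrite chi_supp// expr0n.
rewrite integral_indic ?setIT//; [exact: eball_fin|exact: measurable_eball].
Qed.

(** Test functions [k(f) chi] for a bounded Lipschitz profile [k]: their
    increments are bounded by those of [f] and [chi]. *)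
Lemma admissible_profile f (k : R -> R) (L : R) :
  (forall x, 0 <= f x) -> sqint f -> (penergy s p f < +oo)%E ->
  measurable_fun setT (fun x => k (f x)) -> 0 <= L ->
  (forall a b, 0 <= a -> 0 <= b -> `|k a - k b| <= L * `|a - b|) ->
  (forall a, 0 <= a -> 0 <= k a <= L) ->
  admissible s p (fun x => k (f x) * chi x).
Proof.
move=> f0 f2 fy mk L0 lip kL; have [p1 p2] := andP hp; have p0 : 0 < p by lra.
have mkc : measurable_fun setT (fun x => k (f x) * chi x).
  by apply: measurable_funM => //; exact: measurable_chi.
split.
  apply: (sqint_le mkc (sqintZ L sqint_chi)) => x.
  have [k0 kL'] := andP (kL _ (f0 x)).
  by rewrite !normrM ler_wpM2r// !ger0_norm.
have mf := f2.1.
pose A z := `|f z.1 - f z.2| `^ p * K z.1 z.2 : R.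
pose B z := `|chi z.1 - chi z.2| `^ p * K z.1 z.2 : R.
have mA : measurable_fun setT A by exact: (measurable_penergy s p mf).
have mB : measurable_fun setT B by exact: (measurable_penergy s p measurable_chi).
have c0 : 0 <= 4 * L `^ p by rewrite mulr_ge0 ?powR_ge0.
apply: (@le_lt_trans _ _ (\int[mu2]_z (4 * L `^ p * (A z + B z))%:E)%E).
  rewrite penergyE; apply: int_le.
  - exact: (measurable_penergy s p mkc).
  - by apply: measurable_funM => //; exact: measurable_funD.
  - by move=> z; rewrite mulr_ge0 ?powR_ge0 ?kernel_ge0.
  - move=> z; rewrite /A /B -mulrDl mulrA ler_wpM2r ?kernel_ge0//.
    have -> : k (f z.1) * chi z.1 - k (f z.2) * chi z.2 =
      (k (f z.1) - k (f z.2)) * chi z.1 + k (f z.2) * (chi z.1 - chi z.2) by ring.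
    apply: (le_trans (powR_norm_add _ _ hp)).
    rewrite -mulrA ler_pM2l// mulrDr -!powRM//.
    apply: lerD; rewrite ge0_ler_powR ?nnegrE ?mulr_ge0 ?(ltW p0)// normrM.
      apply: (@le_trans _ _ (`|k (f z.1) - k (f z.2)| * 1)); last by rewrite mulr1 lip.
      by rewrite ler_wpM2l// ger0_norm ?chi_ge0 ?chi_le1.
    have [k0 kL'] := andP (kL _ (f0 z.2)).
    by rewrite ler_wpM2r// ger0_norm.
rewrite (@intZ _ _ _ mu2 _ (fun z => A z + B z))//; last 2 first.
- exact: measurable_funD.
- by move=> z; rewrite addr_ge0 ?penergy_int_ge0.
rewrite (intD _ mA mB (penergy_int_ge0 s p f) (penergy_int_ge0 s p chi)).
rewrite -/(penergy s p f) -/(penergy s p chi).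
apply: lte_mul_pinfty => //; exact: lte_add_pinfty fy penergy_chi.
Qed.

End cutoff.

(** * Dissipation of concave entropies *)

Section concave_entropy.

Context {R : realType} {N : nat} (s p : R).
Hypotheses (hs : 0 < s < 1) (hp : 1 < p < 2).
Local Notation T := (Rn R N).
Local Notation mu := (@lebesgueRn R N).
Local Notation mu2 := (mu \x mu)%E.
Local Notation K := (@kernel R N (s * p)).
Variables (x0 : T) (r : R) (m : nat).
Hypotheses (hr : 0 < r <= 1) (hm : (2 <= m)%N).
Local Notation theta := (theta x0 r).
Local Notation chi := (chi x0 r m).
Implicit Types (f g : T -> R) (t h e d a b c : R).

(** Young inequality in the form that absorbs the error made by the cutoff: if
    the left-hand side is positive then [D < P / Q]. *)
Lemma absorb D P Q : 0 <= D -> 0 <= P -> 0 < Q ->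
  D `^ (p - 1) * (P - Q * D) <= P `^ p * Q `^ (1 - p).
Proof.
move=> D0 P0 Q0; have [p1 p2] := andP hp; have p0 : 0 < p by lra.
have [PQ|PQ] := leP (P - Q * D) 0.
  apply: (@le_trans _ _ 0); last by rewrite mulr_ge0 ?powR_ge0.
  by rewrite mulr_ge0_le0 ?powR_ge0.
have DPQ : D <= P / Q by rewrite ler_pdivlMr// mulrC; lra.
apply: (@le_trans _ _ ((P / Q) `^ (p - 1) * P)).
  apply: ler_pM; rewrite ?powR_ge0//; first exact: ltW.
    by rewrite ge0_ler_powR ?nnegrE ?divr_ge0 ?(ltW Q0)//; lra.
  by rewrite lerBlDr lerDl mulr_ge0// ltW.
rewrite powRM ?invr_ge0 ?(ltW Q0)// mulrAC [_ * P]mulrC mulr_powRB1//.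
rewrite ler_wpM2l ?powR_ge0// -powR_inv1 ?(ltW Q0)// -powRrM.
by rewrite (_ : -1 * (p - 1) = 1 - p) ?lexx//; ring.
Qed.

Variables (k y er : R -> R) (Ce : R).
(* [k] is the derivative of a concave entropy, [y] a lower bound of its slope. *)
Hypotheses (k0 : forall a, 0 <= a -> 0 < k a)
  (y0 : forall a, 0 <= a -> 0 < y a)
  (er0 : forall a, 0 <= a -> 0 <= er a) (Ce0 : 0 < Ce)
  (ky : forall a b, 0 <= b <= a -> (a - b) * y a <= k b - k a)
  (near_er : forall a, 0 <= a -> k a `^ p * y a `^ (1 - p) <= Ce * er a)
  (far_er : forall a, 0 <= a -> a `^ (p - 1) * k a <= Ce * er a).

Lemma k_decr a b : 0 <= b <= a -> k a <= k b.
Proof.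
move=> ba; have [b0 ba'] := andP ba; have := ky ba.
have a0 : 0 <= a := le_trans b0 ba'.
have : 0 <= (a - b) * y a by rewrite mulr_ge0 ?subr_ge0// (ltW (y0 a0)).
move=> H /(le_trans H); lra.
Qed.

Definition nearC : R := m%:R `^ p * (2 ^+ m.+1) `^ (p - 1) * Ce.

(** Pairs closer than half the distance to the complement of the ball. With [a >
    b] the test function [k(f) chi] splits into [(k a - k b) chi z], which is
    dissipated, and [k a (chi x - chi z)], an error of first order in [|x - z|].
    Half of the dissipation is kept; the other half, at least [(a - b) (y a) chi
    z / 2], absorbs the error by [absorb]. *)
Lemma near_pair a b x z : 0 <= b < a -> edist x z < theta x / 2 ->
  (a - b) `^ (p - 1) * (k a * chi x - k b * chi z) +
  2^-1 * ((a - b) `^ (p - 1) * (k b - k a) * chi z) <=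
  nearC * er a * (theta x ^+ m * theta x `^ (- p) * edist x z `^ p).
Proof.
move=> /andP[b0 ba] xz; have [p1 p2] := andP hp; have p0 : 0 < p by lra.
have a0 : 0 <= a by lra.
have th0 : 0 < theta x.
  by have := le_lt_trans (edist_ge0 x z) xz; rewrite pmulr_lgt0.
have thm : 0 < theta x ^+ m by rewrite exprn_gt0.
have th2 : theta x / 2 <= theta z by have := theta_lip x0 r x z; lra.
have chiz : (2 ^+ m)^-1 * theta x ^+ m <= chi z.
  rewrite -exprVn -exprMn mulrC /chi lerXn2r ?nnegrE ?theta_ge0//.
  by rewrite mulr_ge0// ltW.
have kba : k a <= k b by apply: k_decr; rewrite b0 ltW.
have ka := k0 a0; have ya := y0 a0.
pose X := m%:R * theta x ^+ m.-1 * edist x z.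
have XE : X = m%:R * (edist x z / theta x) * theta x ^+ m.
  have -> : theta x ^+ m = theta x * theta x ^+ m.-1.
    by rewrite -exprS prednK//; case: m hm.
  by rewrite /X; field; rewrite gt_eqF.
have XX : chi x - chi z <= X by exact: chi_diff.
pose P := k a * X; pose Q := 2^-1 * y a * ((2 ^+ m)^-1 * theta x ^+ m).
have X0 : 0 <= X by rewrite /X !mulr_ge0 ?exprn_ge0 ?edist_ge0// ltW.
have P0 : 0 <= P by rewrite mulr_ge0// ltW.
have t2 : 0 < (2 ^+ m)^-1 :> R by rewrite invr_gt0 exprn_gt0.
have Q0 : 0 < Q by rewrite !mulr_gt0.
have D0 : 0 <= a - b by lra.
apply: (@le_trans _ _ ((a - b) `^ (p - 1) * (P - Q * (a - b)))).
  rewrite [X in _ + X](_ : _ = (a - b) `^ (p - 1) * (2^-1 * ((k b - k a) * chi z))); last by ring.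
  rewrite -mulrDr ler_wpM2l ?powR_ge0//.
  have H1 : k a * (chi x - chi z) <= P by rewrite ler_wpM2l// ltW.
  have H2 : Q * (a - b) <= 2^-1 * ((k b - k a) * chi z).
    have := ky (a := a) (b := b); rewrite b0 (ltW ba) => /(_ isT) H.
    rewrite /Q -!mulrA ler_pM2l//.
    have -> : y a * ((2 ^+ m)^-1 * (theta x ^+ m * (a - b))) =
      ((a - b) * y a) * ((2 ^+ m)^-1 * theta x ^+ m) by ring.
    apply: ler_pM => //; first by rewrite mulr_ge0// ltW.
    by rewrite mulr_ge0// ltW.
  have : k a * chi x - k b * chi z = k a * (chi x - chi z) - (k b - k a) * chi z by ring.
  move=> ->; move: H1 H2; set A := (k b - k a) * chi z; lra.
apply: (le_trans (absorb D0 P0 Q0)).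
have dth : 0 <= edist x z / theta x by rewrite divr_ge0 ?edist_ge0// ltW.
have -> : P = m%:R * (k a) * (edist x z / theta x) * theta x ^+ m by rewrite /P XE; ring.
have -> : Q = (2 ^+ m.+1)^-1 * y a * theta x ^+ m by rewrite /Q exprS invfM; ring.
rewrite !powRM ?mulr_ge0 ?invr_ge0 ?exprn_ge0 ?(ltW ka) ?(ltW ya) ?(ltW th0) ?edist_ge0//.
have -> : (2 ^+ m.+1)^-1 `^ (1 - p) = (2 ^+ m.+1) `^ (p - 1) :> R.
  by rewrite -powR_inv1 ?exprn_ge0// -powRrM (_ : -1 * (1 - p) = p - 1)//; ring.
have -> : (theta x)^-1 `^ p = theta x `^ (- p).
  by rewrite -powR_inv1 ?(ltW th0)// -powRrM mulN1r.
have E : (theta x ^+ m) `^ p * (theta x ^+ m) `^ (1 - p) = theta x ^+ m.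
  by rewrite -gt0_powRD// addrC subrK powRr1// ltW.
rewrite /nearC.
have := near_er a0; move: E.
set A := (theta x ^+ m) `^ p; set B := (theta x ^+ m) `^ (1 - p).
set U := k a `^ p; set V := y a `^ (1 - p); set W := edist x z `^ p.
set Z := theta x `^ (- p); set M := m%:R `^ p; set M2 := (2 ^+ m.+1) `^ (p - 1).
move=> AB UV.
have -> : M * U * (W * Z) * A * (M2 * V * B) = (U * V) * (M * M2 * (A * B) * Z * W) by ring.
rewrite AB.
have -> : M * M2 * Ce * er a * (theta x ^+ m * Z * W) =
   (Ce * er a) * (M * M2 * theta x ^+ m * Z * W) by ring.
apply: ler_wpM2r UV; rewrite !mulr_ge0 ?powR_ge0 ?exprn_ge0//; exact: ltW.
Qed.

(** For distant pairs the kernel is integrable and the positive term is bounded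
    directly. *)
Lemma far_pair a b x z : 0 <= b < a ->
  (a - b) `^ (p - 1) * (k a * chi x - k b * chi z) <= Ce * er a * theta x ^+ m.
Proof.
move=> /andP[b0 ba]; have [p1 p2] := andP hp; have a0 : 0 <= a by lra.
apply: (@le_trans _ _ (a `^ (p - 1) * (k a * chi x))).
  apply: (@le_trans _ _ ((a - b) `^ (p - 1) * (k a * chi x))).
    rewrite ler_wpM2l ?powR_ge0// lerBlDr lerDl mulr_ge0 ?chi_ge0//.
    by rewrite ltW// k0.
  rewrite ler_wpM2r ?mulr_ge0 ?chi_ge0 ?(ltW (k0 a0))//.
  by rewrite ge0_ler_powR ?nnegrE//; lra.
by rewrite mulrA ler_wpM2r ?far_er// exprn_ge0// theta_ge0.
Qed.


Hypotheses (mk : measurable_fun setT k) (mer : measurable_fun setT er).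

(** The half of the dissipation kept by [near_pair], at the pairs of nearby
    points at which the values of [f] differ at least by a factor two. *)
Definition dissipation f (z : T * T) : R :=
  if (f z.2 <= f z.1 / 2) && (edist z.1 z.2 < theta z.1 / 2) then
    2^-1 * ((f z.1 - f z.2) `^ (p - 1) * (k (f z.2) - k (f z.1)) * chi z.2) * K z.1 z.2
  else 0.

Definition entropy_error f (z : T * T) : R :=
  nearC * er (f z.1) * (theta z.1 ^+ m * theta z.1 `^ (- p)) *
    (edist z.1 z.2 `^ p * K z.1 z.2 * (edist z.1 z.2 < theta z.1 / 2)%R%:R) +
  Ce * er (f z.1) * theta z.1 ^+ m *
    (K z.1 z.2 * (theta z.1 / 2 <= edist z.1 z.2)%R%:R).

Lemma nearC_ge0 : 0 <= nearC.
Proof. by rewrite !mulr_ge0 ?powR_ge0// ltW. Qed.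

Lemma entropy_error_ge0 f z : (forall x, 0 <= f x) -> 0 <= entropy_error f z.
Proof.
move=> f0; rewrite addr_ge0// !mulr_ge0 ?nearC_ge0 ?er0 ?exprn_ge0 ?theta_ge0 ?powR_ge0
  ?kernel_ge0//; exact: ltW.
Qed.

Lemma dissipation_ge0 f z : (forall x, 0 <= f x) -> 0 <= dissipation f z.
Proof.
move=> f0; rewrite /dissipation; case: ifP => // /andP[fz _].
have kk : k (f z.1) <= k (f z.2).
  by apply: k_decr; rewrite f0/=; have := f0 z.1; lra.
by rewrite !mulr_ge0 ?subr_ge0 ?powR_ge0 ?chi_ge0 ?kernel_ge0.
Qed.

Lemma measurable_dissipation f : measurable_fun setT f ->
  measurable_fun setT (dissipation f).
Proof.
move=> mf; have mf1 := measurable_fst_fun mf; have mf2 := measurable_snd_fun mf.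
have mkf : measurable_fun setT (k \o f) by exact: measurableT_comp.
have mt := measurable_fst_fun (@measurable_theta R N x0 r).
apply: measurable_fun_ifT => //.
  apply: measurable_and.
    by apply: measurable_fun_ler => //; exact: measurable_funM.
  apply: measurable_fun_ltr; first exact: measurable_edist.
  exact: measurable_funM.
apply: measurable_funM; last exact: measurable_kernel.
apply: measurable_funM => //; apply: measurable_funM; last exact: (measurable_snd_fun (measurable_chi _ _ _)).
apply: measurable_funM; last first.
  by apply: measurable_funB; [exact: (measurable_snd_fun mkf)|exact: (measurable_fst_fun mkf)].
by apply: measurable_powRn; exact: measurable_funB.
Qed.

Lemma measurable_entropy_error f : measurable_fun setT f ->
  measurable_fun setT (entropy_error f).
Proof.
move=> mf; have mf1 := measurable_fst_fun mf.
have mef : measurable_fun setT (fun z : T * T => er (f z.1)).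
  exact: (measurable_fst_fun (measurableT_comp mer mf)).
have mt := measurable_fst_fun (@measurable_theta R N x0 r).
have md := @measurable_edist R N; have mK := @measurable_kernel R N (s * p).
have mtm : measurable_fun setT (fun z : T * T => theta z.1 ^+ m) by exact: measurable_funX.
apply: measurable_funD; apply: measurable_funM.
- apply: measurable_funM; first exact: measurable_funM.
  by apply: measurable_funM => //; exact: measurable_powRn.
- apply: measurable_funM.
    by apply: measurable_funM => //; exact: measurable_powRn.
  by apply: measurable_boolR; apply: measurable_fun_ltr => //; exact: measurable_funM.
- by apply: measurable_funM => //; exact: measurable_funM.
- apply: measurable_funM => //.
  by apply: measurable_boolR; apply: measurable_fun_ler => //; exact: measurable_funM.
Qed.

Lemma entropy_pairs f : (forall x, 0 <= f x) -> forall z,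
  pairing s p f (fun x => k (f x) * chi x) z + dissipation f z + dissipation f (swap z)
  <= entropy_error f z + entropy_error f (swap z).
Proof.
move=> f0; have [p1 p2] := andP hp.
have main z : f z.2 < f z.1 ->
    pairing s p f (fun x => k (f x) * chi x) z + dissipation f z + dissipation f (swap z)
    <= entropy_error f z + entropy_error f (swap z).
  move=> fz; have f02 := f0 z.2.
  have -> : dissipation f (swap z) = 0.
    rewrite /dissipation /swap/=; case: ifP => // /andP[H _]; exfalso.
    move: H fz f02; move: (f z.1) (f z.2) => a b; lra.
  rewrite addr0; apply: (@le_trans _ _ (entropy_error f z)); last first.
    by rewrite lerDl entropy_error_ge0.
  have ba : 0 <= f z.2 < f z.1 by rewrite f02.
  rewrite /pairing Phi_pos//; last by rewrite subr_ge0 ltW.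
  rewrite /dissipation /entropy_error.
  have K0 := kernel_ge0 (s * p) z.1 z.2.
  case: (ltP (edist z.1 z.2) (theta z.1 / 2)) => dz /=.
    rewrite andbT mulr0 mulr0 addr0 mulr1.
    have H := @near_pair (f z.1) (f z.2) z.1 z.2 ba dz.
    apply: (@le_trans _ _ (((f z.1 - f z.2) `^ (p - 1) * (k (f z.1) * chi z.1 - k (f z.2) * chi z.2) +
      2^-1 * ((f z.1 - f z.2) `^ (p - 1) * (k (f z.2) - k (f z.1)) * chi z.2)) * K z.1 z.2)).
      rewrite mulrDl lerD2l; case: ifP => // _.
      have kk : k (f z.1) <= k (f z.2) by apply: k_decr; rewrite f02 ltW.
      by rewrite !mulr_ge0 ?subr_ge0 ?powR_ge0 ?chi_ge0.
    apply: (le_trans (ler_wpM2r K0 H)).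
    by rewrite le_eqVlt; apply/orP; left; apply/eqP; ring.
  rewrite andbF addr0 !mulr0 add0r mulr1 ler_wpM2r//.
  exact: far_pair.
move=> z; have [fz|fz|fz] := ltgtP (f z.2) (f z.1).
- exact: main.
- have := main (swap z) fz.
  have -> : pairing s p f (fun x => k (f x) * chi x) (swap z) =
      pairing s p f (fun x => k (f x) * chi x) z.
    rewrite /pairing /swap/= (kernelC _ z.2 z.1).
    by rewrite -[f z.2 - f z.1]opprB PhiN; ring.
  have -> : swap (swap z) = z by case: z {fz}.
  move: (pairing _ _ _ _ _) (dissipation f z) (dissipation f (swap z)).
  move: (entropy_error f z) (entropy_error f (swap z)); clear; move=> A B C D E.
  by rewrite -!addrA [E + D]addrC [B + A]addrC.
- have d0 : dissipation f z = 0.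
    rewrite /dissipation fz subrr powR0 ?mul0r ?mulr0 ?mul0r; first by case: ifP.
    by rewrite gt_eqF//; lra.
  have d0' : dissipation f (swap z) = 0.
    rewrite /dissipation /swap/= fz subrr powR0 ?mul0r ?mulr0 ?mul0r; first by case: ifP.
    by rewrite gt_eqF//; lra.
  rewrite d0 d0' /pairing fz subrr /Phi sgr0 !mul0r !addr0.
  by rewrite addr_ge0// entropy_error_ge0.
Qed.

Lemma int_lin2 (A B u v : R) (F G : T -> R) : 0 <= A -> 0 <= B ->
  measurable_fun setT F -> measurable_fun setT G -> (forall x, 0 <= F x) ->
  (forall x, 0 <= G x) -> (\int[mu]_x (F x)%:E <= u%:E)%E ->
  (\int[mu]_x (G x)%:E <= v%:E)%E ->
  (\int[mu]_x (A * F x + B * G x)%R%:E <= (A * u + B * v)%R%:E)%E.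
Proof.
move=> A0 B0 mF mG F0 G0 Fu Gv.
have mAF : measurable_fun setT (fun x => A * F x) by exact: measurable_funM.
have mBG : measurable_fun setT (fun x => B * G x) by exact: measurable_funM.
rewrite (intD _ mAF mBG (fun x => mulr_ge0 A0 (F0 x)) (fun x => mulr_ge0 B0 (G0 x))).
rewrite (intZ _ mF A0 F0) (intZ _ mG B0 G0) EFinD !EFinM.
by apply: leeD; apply: lee_wpmul2l; rewrite ?lee_fin.
Qed.

(** The kernel at distances comparable to [theta x] integrates to [theta
    x^(-sp)], in the near part because of the factor [|x - y|^p]. *)
Lemma int_entropy_error : exists2 C : R, 0 < C & forall f, measurable_fun setT f ->
  (forall x, 0 <= f x) -> (\int[mu2]_z (entropy_error f z)%:E <=
    C%:E * \int[mu]_x (er (f x) * (theta x ^+ m * theta x `^ (- (s * p))))%:E)%E.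
Proof.
have [p1 p2] := andP hp; have [s0 s1] := andP hs.
have [C C0 HC] := @kernel_near_bool R N s p hs hp; have [D D0 HD] := @kernel_far_bool R N s p hs hp.
have sp0 : 0 < s * p by rewrite mulr_gt0//; lra.
have spp : s * p < p by rewrite gtr_pMl//; lra.
pose M := nearC * C + Ce * D * 2 `^ (s * p).
have M0 : 0 < M.
  apply: ltr_wpDl; first exact: mulr_ge0 nearC_ge0 (ltW C0).
  by rewrite !mulr_gt0 ?powR_gt0.
exists M => // f mf f0.
have mE := measurable_entropy_error mf.
rewrite (int2E mE (fun z => entropy_error_ge0 z f0)).
have mef : measurable_fun setT (fun x => er (f x) * (theta x ^+ m * theta x `^ (- (s * p)))).
  apply: measurable_funM; first exact: measurableT_comp.
  apply: measurable_funM; first by apply: measurable_funX; exact: measurable_theta.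
  by apply: measurable_powRn; exact: measurable_theta.
rewrite -intZ//; last 2 first.
- exact: ltW.
- by move=> x; rewrite !mulr_ge0 ?er0 ?exprn_ge0 ?powR_ge0 ?theta_ge0.
apply: ge0_le_integral => //.
- by move=> x _; apply: int_ge0 => y'; exact: entropy_error_ge0.
- by apply: (measurable_int_section mE) => z; exact: entropy_error_ge0.
- by apply/measurable_EFinP; apply: measurable_funM.
- move=> x _ /=.
  have md := @measurable_edistl R N x; have mKl := @measurable_kernell R N (s * p) x.
  have e0 := er0 (f0 x).
  have [th0|thn0] := eqVneq (theta x) 0.
    rewrite (_ : (\int[mu]_y (entropy_error f (x, y))%:E = 0)%E); last first.
      rewrite (eq_integral (cst 0%E)) ?integral0// => y' _.
      by rewrite /entropy_error/= th0 expr0n; case: m hm => // n _; rewrite !mul0r !mulr0 !mul0r addr0.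
    by rewrite lee_fin th0 expr0n; case: m hm => // n _; rewrite !mul0r !mulr0.
  have th : 0 < theta x by rewrite lt0r thn0 theta_ge0.
  have th2 : 0 < theta x / 2 by rewrite divr_gt0.
  pose F y' : R := edist x y' `^ p * K x y' * (edist x y' < theta x / 2)%R%:R.
  pose G y' : R := K x y' * (theta x / 2 <= edist x y')%R%:R.
  have mF : measurable_fun setT F.
    apply: measurable_funM; first by apply: measurable_funM mKl; exact: measurable_powRn.
    by apply: measurable_boolR; exact: measurable_fun_ltr.
  have mG : measurable_fun setT G.
    by apply: (measurable_funM mKl); apply: measurable_boolR; exact: measurable_fun_ler.
  have F0 y' : 0 <= F y' by rewrite !mulr_ge0 ?powR_ge0 ?kernel_ge0.
  have G0 y' : 0 <= G y' by rewrite mulr_ge0 ?kernel_ge0.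
  have A0 : 0 <= nearC * er (f x) * (theta x ^+ m * theta x `^ (- p)).
    exact: mulr_ge0 (mulr_ge0 nearC_ge0 e0) (mulr_ge0 (exprn_ge0 _ (ltW th)) (powR_ge0 _ _)).
  have B0 : 0 <= Ce * er (f x) * theta x ^+ m.
    exact: mulr_ge0 (mulr_ge0 (ltW Ce0) e0) (exprn_ge0 _ (ltW th)).
  apply: (le_trans (int_lin2 A0 B0 mF mG F0 G0 (HC x _ th2) (HD x _ th2))).
  rewrite lee_fin.
  have E1 : (theta x / 2) `^ (p - s * p) <= theta x `^ p * theta x `^ (- (s * p)).
    rewrite -gt0_powRD// ge0_ler_powR ?nnegrE ?(ltW th) ?(ltW th2)//; last by lra.
    by rewrite subr_ge0 ltW.
  have E2 : (theta x / 2) `^ (- (s * p)) = 2 `^ (s * p) * theta x `^ (- (s * p)).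
    rewrite powRM ?(ltW th) ?invr_ge0// mulrC; congr (_ * _).
    by rewrite -powR_inv1// -powRrM mulN1r opprK.
  have E3 : theta x `^ (- p) * theta x `^ p = 1 by rewrite -gt0_powRD// addNr powRr0.
  rewrite E2.
  set A := theta x `^ (- (s * p)) in E1 *.
  apply: (@le_trans _ _ (nearC * er (f x) * (theta x ^+ m * theta x `^ (- p)) *
      (C * (theta x `^ p * A)) + Ce * er (f x) * theta x ^+ m * (D * (2 `^ (s * p) * A)))).
    by rewrite lerD2r; apply: (ler_wpM2l A0); apply: (ler_wpM2l (ltW C0)).
  rewrite /M le_eqVlt; apply/orP; left; apply/eqP.
  move: E3; set U := theta x `^ (- p); set V := theta x `^ p => UV.
  have -> : nearC * er (f x) * (theta x ^+ m * U) * (C * (V * A)) =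
    nearC * er (f x) * theta x ^+ m * C * A * (U * V) by ring.
  by rewrite UV; ring.
Qed.

Variable L : R.
Hypotheses (L0 : 0 <= L)
  (klip : forall a b, 0 <= a -> 0 <= b -> `|k a - k b| <= L * `|a - b|)
  (kL : forall a, 0 <= a -> 0 <= k a <= L).

Lemma admissible_k f : (forall x, 0 <= f x) -> sqint f -> (penergy s p f < +oo)%E ->
  admissible s p (fun x => k (f x) * chi x).
Proof.
move=> f0 f2 fy.
have mkf : measurable_fun setT (fun x => k (f x)) by exact: measurableT_comp mk f2.1.
exact: (admissible_profile hs hp x0 hr hm f0 f2 fy mkf L0 klip kL).
Qed.

(** The entropy with derivative [k] decreases along the flow up to the error of
    the cutoff. *)
Lemma subdifferential_entropy : exists2 C : R, 0 < C & forall f xi,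
  (forall x, 0 <= f x) -> subdifferential (energy s p) f xi ->
  ((Int (fun x => xi x * (k (f x) * chi x))%R)%:E <=
    C%:E * \int[mu]_x (er (f x) * (theta x ^+ m * theta x `^ (- (s * p))))%:E)%E.
Proof.
have [C C0 HC] := int_entropy_error; exists C => // f xi f0 sub.
have [/Lfun2P f2 _ Jf _] := sub; have fy := energy_lty hp Jf.
have mf := f2.1.
apply: le_trans (HC f mf f0).
have := pairing_gain hp sub (admissible_k f0 f2 fy) (measurable_dissipation mf)
  (measurable_entropy_error mf) (fun z => dissipation_ge0 z f0)
  (fun z => entropy_error_ge0 z f0) (entropy_pairs f0).
apply: le_trans; rewrite leeDl// int_ge0// => z; exact: dissipation_ge0.
Qed.

(** The same at a frozen time, for supersolutions; here the dissipation is
    kept. *)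
Lemma supersolution_entropy : exists2 C : R, 0 < C & forall c f,
  supersolution s p c f ->
  (\int[mu2]_z (dissipation f z)%:E <=
    C%:E * \int[mu]_x (er (f x) * (theta x ^+ m * theta x `^ (- (s * p))))%:E +
    (c * Int (fun x => f x * (k (f x) * chi x)))%R%:E)%E.
Proof.
have [C C0 HC] := int_entropy_error; exists C => // c f [f0 f2 fy sup].
have mf := f2.1.
have kc0 x : 0 <= k (f x) * chi x by rewrite mulr_ge0 ?chi_ge0// ltW// k0.
have := sup _ _ _ (admissible_k f0 f2 fy) kc0 (measurable_dissipation mf)
  (measurable_entropy_error mf) (fun z => dissipation_ge0 z f0)
  (fun z => entropy_error_ge0 z f0) (entropy_pairs f0).
move=> /le_trans; apply; rewrite leeD2r//; exact: HC.
Qed.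

End concave_entropy.

(** * Entropies of power type *)

Section power_profiles.
Context {R : realType}.
Implicit Types (a b t q r p : R).

Lemma powR_bernoulli t q : 0 <= t -> 0 < q < 1 -> t `^ q <= 1 + q * (t - 1).
Proof.
move=> t0 /andP[q0 q1].
have := @conjugate_powR R (t `^ q) 1 q^-1 (1 - q)^-1.
rewrite powR_ge0 ler01 !invr_gt0 subr_gt0 !invrK -powRrM divff ?gt_eqF// powRr1// powR1 mul1r mulr1.
move=> /(_ isT isT q0 q1 (subrKC _ _)); lra.
Qed.

Lemma powR_concave q a b : 0 < a -> 0 <= b -> 0 < q < 1 ->
  b `^ q <= a `^ q + q * a `^ (q - 1) * (b - a).
Proof.
move=> a0 b0 q01; have ba : 0 <= b / a by rewrite divr_ge0// ltW.
have := powR_bernoulli ba q01; have aq : 0 < a `^ q by rewrite powR_gt0.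
move=> /(ler_wpM2r (ltW aq)); rewrite -powRM ?(ltW a0)// divfK ?gt_eqF//.
move=> /le_trans; apply; rewrite le_eqVlt; apply/orP; left; apply/eqP.
have -> : a `^ q = a `^ (q - 1) * a by rewrite -{3}(powRr1 (ltW a0)) -gt0_powRD// subrK.
by field; rewrite gt_eqF.
Qed.

Lemma powR_neg_convex r a b : 0 < a -> 0 < b -> 0 < r < 1 ->
  a `^ (- r) - r * a `^ (- r - 1) * (b - a) <= b `^ (- r).
Proof.
move=> a0 b0 r01; have [r0 r1] := andP r01.
have ba : 0 < b / a by rewrite divr_gt0.
have B := powR_bernoulli (ltW ba) r01.
have B0 : 0 < (b / a) `^ r by rewrite powR_gt0.
have H : 1 - r * (b / a - 1) <= (b / a) `^ (- r).
  rewrite powRN; have [H0|H0] := leP (1 - r * (b / a - 1)) 0.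
    by apply: (le_trans H0); rewrite invr_ge0 ltW.
  rewrite -[leRHS]mulr1 ler_pdivlMl//.
  apply: (@le_trans _ _ ((1 + r * (b / a - 1)) * (1 - r * (b / a - 1)))).
    by rewrite ler_wpM2r// ltW.
  by have := sqr_ge0 (r * (b / a - 1)); lra.
have ar : 0 < a `^ (- r) by rewrite powR_gt0.
move: H => /(ler_wpM2r (ltW ar)); rewrite -powRM ?(ltW a0) ?(ltW ba)// divfK ?gt_eqF//.
apply: le_trans; rewrite le_eqVlt; apply/orP; left; apply/eqP.
have -> : a `^ (- r) = a `^ (- r - 1) * a by rewrite -{3}(powRr1 (ltW a0)) -gt0_powRD// subrK.
by field; rewrite gt_eqF.
Qed.

(** Minus the derivative of [profile]: by convexity, a lower bound of the slope
    of the chords that end at [a]. *)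
Definition slope r a : R := r * (1 + a) `^ (- r - 1).
(** Derivatives of concave functions: of [u + (1+u)^(1-r) / (1-r)] if [beta =
    1], which is comparable to [u], and of [(1+u)^(1-r) / (1-r)] if [beta = 0],
    for which the errors have smaller powers. *)
Definition profile (beta r a : R) : R := beta + (1 + a) `^ (- r).
Definition power q a : R := (1 + a) `^ q.

Lemma slope_gt0 r a : 0 < r -> 0 <= a -> 0 < slope r a.
Proof. by move=> r0 a0; rewrite mulr_gt0// powR_gt0//; lra. Qed.

Lemma power_ge0 q a : 0 <= power q a.
Proof. exact: powR_ge0. Qed.

Lemma powR_le1 x r : 1 <= x -> 0 <= r -> x `^ (- r) <= 1.
Proof. by move=> x1 r0; rewrite -(powRr0 x) ler_powR// oppr_le0. Qed.

Lemma profile_bound beta r a : 0 <= beta <= 1 -> 0 < r -> 0 <= a ->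
  0 < profile beta r a <= 2.
Proof.
move=> /andP[b0 b1] r0 a0; have a1 : 0 < 1 + a by lra.
apply/andP; split; first by rewrite ltr_wpDl// powR_gt0.
have : (1 + a) `^ (- r) <= 1 by apply: powR_le1; lra.
rewrite /profile; lra.
Qed.

Lemma profile_slope beta r a b : 0 < r < 1 -> 0 <= b <= a ->
  (a - b) * slope r a <= profile beta r b - profile beta r a.
Proof.
move=> r01 /andP[b0 ba]; have a1 : 0 < 1 + a by lra. have b1 : 0 < 1 + b by lra.
have := powR_neg_convex a1 b1 r01.
have -> : 1 + b - (1 + a) = b - a by ring.
rewrite /profile /slope; set A := _ `^ (- r); set B := _ `^ (- r - 1).
set D := (1 + b) `^ (- r); lra.
Qed.

Lemma profile_lip beta r a b : 0 < r < 1 -> 0 <= a -> 0 <= b ->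
  `|profile beta r a - profile beta r b| <= 2 * `|a - b|.
Proof.
move=> r01; have [r0 r1] := andP r01.
have H a' b' : 0 <= b' <= a' -> `|profile beta r a' - profile beta r b'| <= 2 * `|a' - b'|.
  move=> /andP[b0 ba]; have a1 : 0 < 1 + a' by lra. have b1 : 0 < 1 + b' by lra.
  have := powR_neg_convex b1 a1 r01.
  have -> : 1 + a' - (1 + b') = a' - b' by ring.
  have := @profile_slope beta r a' b' r01; rewrite b0 ba => /(_ isT).
  have := slope_gt0 r0 (le_trans b0 ba) => sl.
  have ab0 : 0 <= a' - b' by lra.
  have := mulr_ge0 ab0 (ltW sl).
  rewrite /profile (ger0_norm ab0).
  have Bl1 : r * (1 + b') `^ (- r - 1) <= 2.
    have : (1 + b') `^ (- r - 1) <= 1 by rewrite -opprD; apply: powR_le1; lra.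
    have := powR_ge0 (1 + b') (- r - 1); nra.
  have := ler_wpM2r ab0 Bl1.
  set A := (1 + b') `^ (- r); set D := (1 + a') `^ (- r).
  move=> h1 h2 h3 h4.
  rewrite ler0_norm; lra.
move=> a0 b0; have [ab|/ltW ab] := leP b a; first by apply: H; rewrite b0.
by rewrite distrC [X in _ <= 2 * X]distrC; apply: H; rewrite a0.
Qed.

Lemma measurable_power q : measurable_fun setT (power q).
Proof. by apply: measurable_powRn; apply: measurable_funD. Qed.

Lemma measurable_profile beta r : measurable_fun setT (profile beta r).
Proof. by apply: measurable_funD => //; exact: measurable_power. Qed.

(** The errors grow like the power [(r + 1) (p - 1)], which is less than one for
    small [r] since [p < 2]. *)
Lemma profile1_near p r a : 1 < p < 2 -> 0 < r < 1 -> 0 <= a ->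
  profile 1 r a `^ p * slope r a `^ (1 - p) <=
  (2 `^ p * r `^ (1 - p)) * power ((r + 1) * (p - 1)) a.
Proof.
move=> /andP[p1 p2] /andP[r0 r1] a0; have a1 : 0 < 1 + a by lra.
have /andP[k0 k2] : 0 < profile 1 r a <= 2 by apply: profile_bound => //; rewrite ler01 lexx.
rewrite /slope powRM ?(ltW r0) ?powR_ge0// -powRrM -mulrA /power.
have -> : (- r - 1) * (1 - p) = (r + 1) * (p - 1) by ring.
rewrite ler_wpM2r ?mulr_ge0 ?powR_ge0// ge0_ler_powR ?nnegrE ?(ltW k0)//; lra.
Qed.

Lemma profile1_far p r a : 1 < p < 2 -> 0 < r < 1 -> 0 <= a ->
  a `^ (p - 1) * profile 1 r a <= 2 * power ((r + 1) * (p - 1)) a.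
Proof.
move=> /andP[p1 p2] /andP[r0 r1] a0; have a1 : 0 < 1 + a by lra.
have /andP[k0 k2] : 0 < profile 1 r a <= 2 by apply: profile_bound => //; rewrite ler01 lexx.
rewrite mulrC ler_pM ?powR_ge0 ?(ltW k0)// /power.
apply: (@le_trans _ _ ((1 + a) `^ (p - 1))).
  by rewrite ge0_ler_powR ?nnegrE//; lra.
by apply: ler_powR; [lra|nra].
Qed.

(** The errors grow like the power [p - 1 - r], less than the power [1 - r] of
    the entropy itself since [p < 2]. *)
Lemma profile0_near p r a : 1 < p < 2 -> 0 < r < 1 -> 0 <= a ->
  profile 0 r a `^ p * slope r a `^ (1 - p) = r `^ (1 - p) * power (p - 1 - r) a.
Proof.
move=> /andP[p1 p2] /andP[r0 r1] a0; have a1 : 0 < 1 + a by lra.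
rewrite /slope powRM ?(ltW r0) ?powR_ge0// /profile add0r -!powRrM mulrCA -gt0_powRD//.
by rewrite /power; congr (_ * _ `^ _); ring.
Qed.

Lemma profile0_far p r a : 1 < p < 2 -> 0 < r < 1 -> 0 <= a ->
  a `^ (p - 1) * profile 0 r a <= power (p - 1 - r) a.
Proof.
move=> /andP[p1 p2] /andP[r0 r1] a0; have a1 : 0 < 1 + a by lra.
rewrite /profile add0r /power (gt0_powRD (p - 1) (- r) a1) ler_wpM2r ?powR_ge0//.
by rewrite ge0_ler_powR ?nnegrE//; lra.
Qed.

(** Either [th^(-a)] is less than [X^(q-e)], and the left-hand side is below
    [X^q th^n], or [X^e] is bounded by a negative power of [th], compensated by
    [th^n]. A large exponent [n] of the cutoff thus absorbs the singular
    weight. *)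
Lemma power_absorb (q e X th : R) (n : nat) (a : R) : 1 <= X -> 0 <= th <= 1 ->
  e < q -> 0 <= a -> 0 <= e -> a + a * e / (q - e) <= n%:R ->
  X `^ e * (th ^+ n * th `^ (- a)) <= X `^ q * th ^+ n + 1.
Proof.
move=> X1 /andP[t0 t1] eq_ a0 e0 nbig.
have X0 : 0 < X by lra.
have [->|tn0] := eqVneq th 0.
  case: n nbig => [|n] nbig; last first.
    by rewrite expr0n/= mul0r !mulr0 add0r ler01.
  have az : a = 0.
    have : 0 <= a * e / (q - e) by rewrite divr_ge0 ?mulr_ge0 ?subr_ge0// ltW.
    by move: nbig; lra.
  rewrite az oppr0 powRr0 expr0 !mulr1.
  by rewrite (@le_trans _ _ (X `^ q))// ?lerDl// ler_powR// ltW.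
have tp : 0 < th by rewrite lt0r tn0.
have qe : 0 < q - e by lra.
have [H|H] := leP (th `^ (- a)) (X `^ (q - e)).
  apply: (@le_trans _ _ (X `^ q * th ^+ n)); last by rewrite lerDl.
  have -> : X `^ q = X `^ e * X `^ (q - e) by rewrite -gt0_powRD// addrC subrK.
  rewrite -mulrA ler_wpM2l ?powR_ge0// mulrC ler_wpM2r// exprn_ge0//.
apply: (@le_trans _ _ 1); last by rewrite lerDr mulr_ge0 ?powR_ge0 ?exprn_ge0.
have Xe : X `^ e <= th `^ (- (a * e / (q - e))).
  pose c := e / (q - e); have c0 : 0 <= c by rewrite divr_ge0// ltW.
  have -> : - (a * e / (q - e)) = - a * c by rewrite /c; ring.
  have -> : X `^ e = X `^ ((q - e) * c).
    by rewrite /c mulrC divfK// gt_eqF.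
  rewrite (powRrM X) (powRrM th).
  by apply: ge0_ler_powR; rewrite ?nnegrE ?powR_ge0// ltW.
have E : th ^+ n * th `^ (- a) = th `^ (n%:R - a).
  by rewrite gt0_powRD// powR_mulrn.
rewrite E; apply: (@le_trans _ _ (th `^ (- (a * e / (q - e))) * th `^ (n%:R - a))).
  by rewrite ler_wpM2r ?powR_ge0.
rewrite -gt0_powRD// -[leRHS](powRr0 th) ger_powR ?tp//; lra.
Qed.

End power_profiles.

(** * Persistence of the local mass *)

Section gronwall.
Context {R : realType}.
Implicit Types (G : R -> R) (t r h e d a b c C : R).

(** Multiplication by the exponential reduces to [dini_nonincreasing]. *)
Lemma dini_gronwall G C : 0 <= C ->
  (forall t, 0 <= t -> forall e, 0 < e -> exists2 d : R, 0 < d &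
    forall r, 0 <= r -> `|r - t| < d -> `|G r - G t| <= e) ->
  (forall t, 0 < t -> forall e, 0 < e -> exists2 d : R, 0 < d &
    forall h, 0 < h < d -> G (t + h) <= G t + h * (- (C * G t) + e)) ->
  forall b, 0 <= b -> expR (C * b) * G b <= G 0.
Proof.
move=> C0 cG dG b b0.
pose Y t := expR (C * t) * G t.
have -> : G 0 = Y 0 by rewrite /Y mulr0 expR0 mul1r.
apply: (@dini_nonincreasing R Y) => //.
- move=> t t0 e e0.
  have Et : 0 < expR (C * t) := expR_gt0 _.
  have G1 : 0 < `|G t| + 1 by rewrite ltr_wpDl.
  pose e1 := Num.min 1 (e / 2 / expR (C * t)).
  have e10 : 0 < e1 by rewrite lt_min ltr01 divr_gt0//; lra.
  have [d d0 Hd] := cG t t0 e1 e10.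
  have e20 : 0 < e / 2 / (`|G t| + 1) by rewrite divr_gt0//; lra.
  have cE : (fun r => expR (C * r)) r @[r --> t] --> expR (C * t).
    apply: continuous_comp; last exact: continuous_expR.
    exact: mulrl_continuous.
  have /cvgrPdist_le /(_ _ e20) /nbhs_ballP[d' /= d'0 Hd'] := cE.
  exists (Num.min d d'); first by rewrite lt_min d0.
  move=> r r0; rewrite lt_min => /andP[rd rd'].
  have := Hd r r0 rd; rewrite le_min => /andP[GG1 GG2].
  have := Hd' r; rewrite /ball/= distrC => /(_ rd') EE.
  have Gr : `|G r| <= `|G t| + 1.
    by have := ler_normD (G r - G t) (G t); rewrite subrK; lra.
  have -> : Y r - Y t = (expR (C * r) - expR (C * t)) * G r + expR (C * t) * (G r - G t).
    by rewrite /Y; ring.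
  apply: (le_trans (ler_normD _ _)); rewrite !normrM [`|expR (C * t)|]gtr0_norm//.
  have H1 : `|expR (C * r) - expR (C * t)| * `|G r| <= e / 2.
    apply: (@le_trans _ _ (e / 2 / (`|G t| + 1) * (`|G t| + 1))); last first.
      by rewrite divfK// gt_eqF.
    by apply: ler_pM => //; rewrite distrC.
  have H2 : expR (C * t) * `|G r - G t| <= e / 2.
    by rewrite mulrC -ler_pdivlMr.
  lra.
- move=> t t0 e e0.
  have Et : 0 < expR (C * t) := expR_gt0 _.
  pose e1 := e / (2 * expR (C * t) * expR C).
  have EC : 0 < expR C := expR_gt0 _.
  have e10 : 0 < e1 by rewrite divr_gt0// !mulr_gt0.
  have [d d0 Hd] := dG t t0 e1 e10.
  pose M := expR (C * t) * C ^+ 2 * `|G t| * expR C + 1.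
  have M1 : 0 <= expR (C * t) * C ^+ 2 * `|G t| * expR C.
    by rewrite !mulr_ge0 ?sqr_ge0 ?(ltW Et) ?(ltW EC).
  have M0 : 0 < M by rewrite /M; lra.
  exists (Num.min (Num.min 1 d) (e / 2 / M)).
    by rewrite !lt_min ltr01 d0 divr_gt0//; lra.
  move=> h /andP[h0]; rewrite !lt_min => /andP[/andP[h1 hd] hM].
  have := Hd h; rewrite h0 hd => /(_ isT) H.
  have Eh : expR (C * (t + h)) = expR (C * t) * expR (C * h) by rewrite mulrDr expRD.
  have Eh1 : 1 + C * h <= expR (C * h) by exact: expR_ge1Dx.
  have Eh2 : 1 - C * h <= expR (- (C * h)) by have := expR_ge1Dx (- (C * h)).
  have EhC : expR (C * h) <= expR C by rewrite ler_expR ler_piMr// ltW.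
  have Eh0 : 0 < expR (C * h) := expR_gt0 _.
  have inv : expR (C * h) * expR (- (C * h)) = 1 by rewrite -expRD subrr expR0.
  set E := expR (C * h) in Eh Eh1 EhC Eh0 inv *.
  have X1 : E * (1 - C * h) <= 1 by rewrite -[leRHS]inv; apply: ler_wpM2l Eh2; exact: ltW.
  have X2 : 1 - C ^+ 2 * h ^+ 2 * expR C <= E * (1 - C * h).
    have [k|k] := leP (C * h) 1.
      have : (1 + C * h) * (1 - C * h) <= E * (1 - C * h) by apply: ler_wpM2r => //; rewrite subr_ge0.
      have : C ^+ 2 * h ^+ 2 <= C ^+ 2 * h ^+ 2 * expR C.
        apply: ler_peMr; first exact: mulr_ge0 (sqr_ge0 _) (sqr_ge0 _).
        by rewrite -[leLHS]expR0 ler_expR.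
      lra.
    have ch : 0 <= C * h - 1 by lra.
    have : E * (C * h - 1) <= expR C * (C * h - 1) by rewrite ler_wpM2r.
    have : 0 <= expR C * (C * h) * (C * h - 1) by rewrite !mulr_ge0 ?(ltW EC)//; lra.
    by have := mulr_ge0 (ltW EC) ch; lra.
  rewrite /Y Eh.
  apply: (@le_trans _ _ (expR (C * t) * E * (G t + h * (- (C * G t) + e1)))).
    by rewrite ler_wpM2l// mulr_ge0// ltW.
  have -> : expR (C * t) * E * (G t + h * (- (C * G t) + e1)) =
     expR (C * t) * G t + expR (C * t) * ((E * (1 - C * h) - 1) * G t) + h * (expR (C * t) * E * e1) by ring.
  have B1 : (E * (1 - C * h) - 1) * G t <= C ^+ 2 * h ^+ 2 * expR C * `|G t|.
    apply: (le_trans (ler_norm _)); rewrite normrM ler_wpM2r//.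
    by rewrite ler0_norm; lra.
  have B2 : expR (C * t) * E * e1 <= e / 2.
    rewrite /e1.
    have -> : expR (C * t) * E * (e / (2 * expR (C * t) * expR C)) = e / 2 * (E / expR C).
      by field; rewrite !gt_eqF.
    by rewrite ler_piMr// ?ler_pdivrMr ?mul1r//; lra.
  have B3 : h * M <= e / 2 by rewrite -ler_pdivlMr// ltW.
  have := ler_wpM2l (ltW Et) B1.
  have := ler_wpM2l (ltW h0) B2.
  have := ler_wpM2l (ltW h0) B3.
  rewrite /M.
  set q := expR (C * t) * ((E * _ - 1) * G t).
  have -> : expR (C * t) * (C ^+ 2 * h ^+ 2 * expR C * `|G t|) =
     h * (h * (expR (C * t) * C ^+ 2 * `|G t| * expR C)) by ring.
  set w := expR (C * t) * C ^+ 2 * `|G t| * expR C.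
  have := mulr_gt0 h0 h0; clear; lra.
Qed.

End gronwall.

Section mass.
Context {R : realType} {N : nat} (s p : R).
Hypotheses (hs : 0 < s < 1) (hp : 1 < p < 2).
Local Notation T := (Rn R N).
Local Notation mu := (@lebesgueRn R N).
Variables (x0 : T) (r : R) (hr : 0 < r <= 1).
Implicit Types (f g : T -> R) (t h e d a b c : R).

(** The primitive of [profile 1 q], comparable to [1 + a]. *)
Definition entropy q a : R := a + (1 + a) `^ (1 - q) / (1 - q).

Lemma entropy_concave q a b : 0 < q < 1 -> 0 <= a -> 0 <= b ->
  entropy q b <= entropy q a + profile 1 q a * (b - a).
Proof.
move=> q01 a0 b0; have [q0 q1] := andP q01.
have a1 : 0 < 1 + a by lra. have b1 : 0 <= 1 + b by lra.
have q1' : 0 < 1 - q < 1 by lra.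
have := powR_concave a1 b1 q1'.
have -> : 1 + b - (1 + a) = b - a by ring.
rewrite addrAC subrr add0r /entropy /profile.
have v0 : 0 <= (1 - q)^-1 by rewrite invr_ge0; lra.
move=> /(ler_wpM2r v0).
set A := _ `^ (1 - q); set B := _ `^ (1 - q); set E := _ `^ (- q).
have -> : (B + (1 - q) * E * (b - a)) / (1 - q) = B / (1 - q) + E * (b - a).
  by field; rewrite gt_eqF//; lra.
rewrite mulrDl mul1r; lra.
Qed.

Lemma entropy_taylor q a b : 0 < q < 1 -> 0 <= a -> 0 <= b ->
  entropy q a + profile 1 q a * (b - a) - 2 * (b - a) ^+ 2 <= entropy q b.
Proof.
move=> q01 a0 b0; have := entropy_concave q01 b0 a0.
have := profile_lip 1 q01 b0 a0; rewrite distrC [`|b - a|]distrC.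
have -> : (b - a) ^+ 2 = `|a - b| * `|a - b| by rewrite -expr2 real_normK ?num_real// -sqrrN opprB.
move=> /(ler_wpM2r (normr_ge0 (a - b))); rewrite -normrM.
have := ler_norm ((profile 1 q a - profile 1 q b) * (b - a)).
rewrite !normrM [`|b - a|]distrC; lra.
Qed.

Lemma entropy_lip q a b : 0 < q < 1 -> 0 <= a -> 0 <= b ->
  `|entropy q b - entropy q a| <= 2 * `|b - a|.
Proof.
move=> q01; have [q0 q1] := andP q01.
have H a' b' : 0 <= a' -> 0 <= b' -> entropy q b' - entropy q a' <= 2 * `|b' - a'|.
  move=> a0 b0; have := entropy_concave q01 a0 b0.
  have /andP[k0 k2] : 0 < profile 1 q a' <= 2 by apply: profile_bound => //; rewrite ler01 lexx.
  have : profile 1 q a' * (b' - a') <= 2 * `|b' - a'|.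
    apply: (le_trans (ler_norm _)); rewrite normrM ler_wpM2r// gtr0_norm//.
  lra.
by move=> a0 b0; rewrite ler_norml H// andbT lerNl opprB distrC H.
Qed.

Lemma entropy_ge q a : 0 < q < 1 -> 0 <= a -> 1 + a <= entropy q a.
Proof.
move=> /andP[q0 q1] a0; rewrite /entropy addrC lerD2l ler_pdivlMr ?subr_gt0// mul1r.
have : 1 <= (a + 1) `^ (1 - q).
  by rewrite -[leLHS](powRr0 (a + 1)) ler_powR//; lra.
lra.
Qed.

Lemma entropy_le q a : 0 < q <= 2^-1 -> 0 <= a -> entropy q a <= 3 * a + 2.
Proof.
move=> /andP[q0 q1] a0; rewrite /entropy.
have : (1 + a) `^ (1 - q) / (1 - q) <= (1 + a) * 2.
  apply: ler_pM; rewrite ?powR_ge0 ?invr_ge0 ?subr_ge0//; [lra| |].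
  - by rewrite -[leRHS](powRr1 (_ : 0 <= 1 + a)) ?ler_powR//; lra.
  - by rewrite -[leRHS]invrK lef_pV2 ?posrE//; lra.
lra.
Qed.

Lemma measurable_entropy q : measurable_fun setT (entropy q).
Proof. by apply: measurable_funD => //; apply: measurable_funM => //; exact: measurable_power. Qed.


Lemma mu_ball_le (F : T -> R) c : 0 <= c -> measurable_fun setT F ->
  (forall x, 0 <= F x) -> (forall x, F x <= c * (edist x0 x < r)%R%:R) ->
  (\int[mu]_x (F x)%:E <= c%:E * mu (eball x0 r))%E.
Proof.
move=> c0 mF F0 Fc; have mB := measurable_eball x0 r.
apply: (@le_trans _ _ (\int[mu]_x (c * \1_(eball x0 r) x)%:E)%E).
  apply: int_le => [//| |//|x].
    by apply: measurable_funM => //; exact: measurable_indic.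
  by rewrite (@indicE_bool R N _ (fun y => edist x0 y < r)).
rewrite intZ//.
by rewrite integral_indic// setIT.
Qed.

Variable m : nat.
Hypothesis hm : (2 <= m)%N.
Local Notation theta := (theta x0 r).
Local Notation chi := (chi x0 r m).

Lemma L1_chi : L1 chi.
Proof.
apply: ge0_integrable; [exact: measurable_chi|exact: chi_ge0|].
apply: (@le_lt_trans _ _ (1%:E * mu (eball x0 r))%E); last first.
  by rewrite mul1e; exact: eball_fin.
apply: mu_ball_le; [by []|exact: measurable_chi|exact: chi_ge0|move=> x].
by rewrite mul1r; case: ltP => xr; [rewrite (chi_le1 x0 m hr)|rewrite (chi_supp hm)].
Qed.

Lemma L1_linear (F f : T -> R) a b : measurable_fun setT F -> sqint f ->
  (forall x, `|F x| <= a * (f x * chi x) + b * chi x) -> L1 F.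
Proof.
move=> mF f2 H.
have i1 : L1 (fun x => a * (f x * chi x) + b * chi x).
  by apply: L1D; apply: L1Z; [exact: sqint_mul f2 (sqint_chi x0 hr hm)|exact: L1_chi].
have [mi _] := integrableP _ _ _ i1.
apply: (int_integrable mF _ H); first exact/measurable_EFinP.
rewrite -int_Rfine ?ltry//.
Qed.

Hypothesis hmm : s * p + s * p * ((2 - p / 2) * (p - 1)) /
  (1 - (2 - p / 2) * (p - 1)) <= m%:R.

(** The local integral of [entropy] stands for the local mass. By
    [subdifferential_entropy] and [power_absorb] its rate of decrease is at most
    a multiple of itself plus a constant, both independent of the size of the
    solution. *)
Lemma mass_lower_bound t : 0 < t -> exists2 c0 : R, 0 < c0 & exists M : R,
  forall u, flow s p u -> (forall h x, 0 <= h -> 0 <= u h x) ->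
  c0 * Int (fun x => u 0 x * chi x) - M <= Int (fun x => u t x * chi x).
Proof.
move=> t0; have [p1 p2] := andP hp; have [s0 s1] := andP hs.
pose q := 1 - p / 2.
have q01 : 0 < q < 1 by rewrite /q; lra.
have [q0 q1] := andP q01.
have qle : 0 < q <= 2^-1 by rewrite q0/= /q; lra.
pose e := (q + 1) * (p - 1).
have eE : e = (2 - p / 2) * (p - 1) by rewrite /e /q; ring.
have e0 : 0 <= e by rewrite /e mulr_ge0; lra.
(* [1 - e = (2 - p) (3 - p) / 2] *)
have e1 : e < 1.
  have : 0 < (2 - p) * (3 - p) by rewrite mulr_gt0; lra.
  by rewrite eE; lra.
have hme := hmm; rewrite -eE in hme.
pose Ce := 2 `^ p * q `^ (1 - p) + 2.
have Ce0 : 0 < Ce by rewrite ltr_wpDl// mulr_ge0 ?powR_ge0.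
have kpos a : 0 <= a -> 0 < profile 1 q a.
  by move=> a0; have /andP[] := @profile_bound R 1 q a (ltac:(by rewrite ler01 lexx)) q0 a0.
have kle a : 0 <= a -> 0 <= profile 1 q a <= 2.
  move=> a0; have /andP[k0 ->] := @profile_bound R 1 q a (ltac:(by rewrite ler01 lexx)) q0 a0.
  by rewrite ltW.
have near_er a : 0 <= a -> profile 1 q a `^ p * slope q a `^ (1 - p) <= Ce * power e a.
  move=> a0; apply: (le_trans (profile1_near hp q01 a0)).
  by rewrite ler_wpM2r ?power_ge0// /Ce lerDl.
have far_er a : 0 <= a -> a `^ (p - 1) * profile 1 q a <= Ce * power e a.
  move=> a0; apply: (le_trans (profile1_far hp q01 a0)).
  by rewrite ler_wpM2r ?power_ge0// /Ce lerDr mulr_ge0 ?powR_ge0.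
have [C C0 HC] := @subdifferential_entropy R N s p hs hp x0 r m hr hm (profile 1 q) (slope q)
  (power e) Ce kpos (fun a => @slope_gt0 R q a q0) (fun a _ => power_ge0 e a) Ce0
  (fun a b => @profile_slope R 1 q a b q01) near_er far_er (@measurable_profile R 1 q)
  (@measurable_power R e) 2 (ltac:(by [])) (fun a b => @profile_lip R 1 q a b q01) kle.
pose B := fine (mu (eball x0 r)).
have BE : mu (eball x0 r) = B%:E by rewrite fineK// ge0_fin_numE// eball_fin.
have B0 : 0 <= B by rewrite fine_ge0.
exists (expR (- (C * t)) / 3); first by rewrite divr_gt0// expR_gt0.
exists B => u fu u0.
have [u2 cu du] := fu.
pose g f x := entropy q (f x) * chi x.
pose Psi f := Int (g f).
have mchi : measurable_fun setT chi by exact: measurable_chi.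
have c0 x : 0 <= chi x by exact: chi_ge0.
have c1 x : chi x <= 1 by exact: (chi_le1 x0 m hr).
have gi f : sqint f -> (forall x, 0 <= f x) -> L1 (g f).
  move=> f2 f0; apply: (@L1_linear _ f 3 2) => // [|x].
    by apply: measurable_funM mchi; exact: measurableT_comp (measurable_entropy q) f2.1.
  have := entropy_ge q01 (f0 x); have := entropy_le qle (f0 x) => E1 E2.
  rewrite /g normrM (ger0_norm (c0 x)) ger0_norm; last by have := f0 x; lra.
  by rewrite mulrA -mulrDl ler_wpM2r.
have fchi f : sqint f -> L1 (fun x => f x * chi x).
  by move=> f2; exact: sqint_mul f2 (sqint_chi x0 hr hm).
have IB : Int chi <= B.
  rewrite -lee_fin -BE int_Rfine; last exact: L1_chi.
  rewrite -[leRHS]mul1e; apply: mu_ball_le; [by []|exact: mchi|exact: c0|move=> x].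
  by rewrite mul1r; case: ltP => xr; [rewrite c1|rewrite (chi_supp hm)].
(* [G] satisfies [G' <= - C G]; the constant [B], the volume of the ball,
   comes from the bound [1] in [power_absorb] *)
pose G t' := - (Psi (u t') + B).
have key : expR (C * t) * G t <= G 0.
  apply: (dini_gronwall (ltW C0)) (ltW t0).
  - have HP t1 r1 l : 0 <= t1 -> 0 <= r1 -> 0 < l <= 1 ->
       `|Psi (u r1) - Psi (u t1)| <= l * nsq chi + 1 / l * nsq (fun x => u r1 x - u t1 x).
      move=> t10 r10 /andP[l0 l1].
      have D2 := sqintB (u2 _ r10) (u2 _ t10).
      have C2 := sqint_chi x0 hr hm.
      have i2 := gi _ (u2 _ r10) (fun x => u0 _ x r10).
      have i1 := gi _ (u2 _ t10) (fun x => u0 _ x t10).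
      have i3 := L1Z l (sqint_sqr C2); have i4 := L1Z l^-1 (sqint_sqr D2).
      rewrite mul1r /nsq -(IntZ l (sqint_sqr C2)) -(IntZ l^-1 (sqint_sqr D2)) -(IntD i3 i4).
      apply: (Int_dist i2 i1 (L1D i3 i4)) => x.
      rewrite /g -mulrBl normrM (ger0_norm (c0 x)).
      apply: (@le_trans _ _ (2 * `|u r1 x - u t1 x| * chi x)).
        by rewrite ler_wpM2r//; apply: entropy_lip => //; apply: u0.
      rewrite -(real_normK (num_real (u r1 x - u t1 x))).
      set D := `|_|; have : 0 <= l * (chi x - l^-1 * D) ^+ 2 by rewrite mulr_ge0 ?sqr_ge0 ?ltW.
      have -> : l * (chi x - l^-1 * D) ^+ 2 = l * chi x ^+ 2 - 2 * D * chi x + l^-1 * D ^+ 2.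
        by field; rewrite gt_eqF.
      by lra.
    move=> t' t'0 d d0.
    have [d' d'0 Hd] := @L2_continuous_functional R N u Psi (fun=> nsq chi) 1
      (fun _ _ => nsq_ge0 chi) ler01 u2 cu HP t' t'0 d d0.
    exists d'; [exact: d'0|move=> r1 r10 rt]; have := Hd r1 r10 rt.
    rewrite /G; move: (Psi (u r1)) (Psi (u t')) => P1 P2 H.
    have -> : - (P1 + B) - - (P2 + B) = - (P1 - P2) by ring.
    by rewrite normrN.
  - move=> t' t'0 d d0; have [xi sub dxi] := du t' t'0.
    have [_ /Lfun2P xi2 _ _] := sub.
    have t'1 := ltW t'0.
    have f0 x : 0 <= u t' x by exact: u0.
    have f2 := u2 _ t'1.
    have mk : measurable_fun setT (fun x => profile 1 q (u t' x) * chi x).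
      by apply: measurable_funM mchi; exact: measurableT_comp (@measurable_profile R 1 q) f2.1.
    have k2 : sqint (fun x => profile 1 q (u t' x) * chi x).
      apply: (sqint_le mk (sqintZ 2 (sqint_chi x0 hr hm))) => x.
      have /andP[ka kb] := kle _ (f0 x).
      by rewrite !normrM ler_wpM2r ?normr_ge0// !ger0_norm.
    have k2' := sqintZ (-1) k2.
    have xi2' : sqint (fun x => - xi x).
      by have := sqintZ (-1) xi2; congr sqint; apply/funext => x; rewrite mulN1r.
    pose D := C * (Psi (u t') + B).
    have DE : - (C * G t') = D by rewrite /D /G; ring.
    have [||d' d'0 Hd] := @functional_dini R N u t' (fun x => - xi x)
      (fun x => -1 * (profile 1 q (u t' x) * chi x)) (fun f => - Psi f) 2 D t'0 u2 xi2' dxi k2' (ltac:(by [])) _ _ d d0.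
    + move=> r1 r10.
      have i1 := gi _ (u2 _ r10) (fun x => u0 _ x r10).
      have i2 := gi _ f2 f0.
      have D2 := sqintB (u2 _ r10) f2.
      have i3 := sqint_mul k2' D2.
      have i4 := L1Z 2 (sqint_sqr D2).
      rewrite lerNl !opprD opprK -(IntZ 2 (sqint_sqr D2)) -(IntB i2 i3).
      rewrite -(IntB (L1B i2 i3) i4).
      apply: (Int_le (L1B (L1B i2 i3) i4) i1) => x.
      have := entropy_taylor q01 (f0 x) (u0 _ x r10).
      rewrite /g; set A := entropy q (u t' x); set A' := entropy q (u r1 x).
      set k := profile _ _ _; set dd := u r1 x - u t' x.
      move=> H; have := ler_wpM2r (c0 x) H.
      have : dd ^+ 2 * chi x <= dd ^+ 2 by rewrite ler_piMr// sqr_ge0.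
      by lra.
    + rewrite (eq_Int (g := fun x => xi x * (profile 1 q (u t' x) * chi x))); last first.
        by move=> x; ring.
      rewrite -lee_fin; apply: (le_trans (HC _ _ f0 sub)); rewrite /D EFinM.
      apply: lee_wpmul2l; first by rewrite lee_fin ltW.
      pose F x := power e (u t' x) * (theta x ^+ m * theta x `^ (- (s * p))).
      have mth := measurable_theta x0 r.
      have mF : measurable_fun setT F.
        apply: measurable_funM; first exact: measurableT_comp (measurable_power e) f2.1.
        by apply: measurable_funM; [exact: measurable_funX|exact: measurable_powRn].
      pose S x : R := (edist x0 x < r)%R%:R.
      have mS : measurable_fun setT S.
        by apply: measurable_boolR; apply: measurable_fun_ltr => //; exact: measurable_edistl.
      have gi' := gi _ f2 f0.
      have mg : measurable_fun setT (g (u t')).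
        by have [/measurable_EFinP] := integrableP _ _ _ gi'.
      have g0 x : 0 <= g (u t') x.
        by rewrite mulr_ge0// (le_trans _ (entropy_ge q01 (f0 x)))// addr_ge0.
      have S0 x : 0 <= S x by exact: ler0n.
      have mgS : measurable_fun setT (fun x => g (u t') x + S x) by exact: measurable_funD.
      apply: (@le_trans _ _ (\int[mu]_x (g (u t') x + S x)%:E)%E).
        apply: int_le => [//|//|x|x].
          by rewrite !mulr_ge0 ?powR_ge0 ?exprn_ge0 ?theta_ge0.
        rewrite /F /S; case: ltP => xr; last first.
          rewrite (theta_supp xr) addr0.
          by rewrite expr0n; case: m hm => // n _; rewrite mul0r mulr0.
        have a1 : 1 <= 1 + u t' x by rewrite lerDl.
        have th01 : 0 <= theta x <= 1 by rewrite theta_ge0 (theta_le1 x0 hr).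
        have sp0 : 0 <= s * p by rewrite mulr_ge0 ?(ltW s0) ?(le_trans ler01 (ltW p1)).
        apply: (le_trans (power_absorb a1 th01 e1 sp0 e0 hme)).
        rewrite lerD2r /g /chi ler_wpM2r ?exprn_ge0 ?theta_ge0//.
        rewrite powRr1; last exact: le_trans ler01 a1.
        exact: entropy_ge.
      rewrite (intD _ mg mS g0 S0) EFinD -int_Rfine//; apply: leeD => //.
      rewrite -BE -[leRHS]mul1e; apply: mu_ball_le => // x.
      by rewrite mul1r.
    + exists d'; [exact: d'0|move=> h hd]; have := Hd h hd; rewrite DE /G.
      by move: (Psi (u (t' + h))) (Psi (u t')) => P1 P2; clear; lra.
have Gt0 : Psi (u t) <= 3 * Int (fun x => u t x * chi x) + 2 * B.
  have i1 := fchi _ (u2 _ (ltW t0)).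
  apply: (@le_trans _ _ (Int (fun x => 3 * (u t x * chi x) + 2 * chi x))).
    apply: Int_le; [exact: gi (u2 _ (ltW t0)) (fun x => u0 _ x (ltW t0))| |move=> x].
      by apply: L1D; apply: L1Z => //; exact: L1_chi.
    by rewrite /g mulrA -mulrDl ler_wpM2r// entropy_le// u0// ltW.
  rewrite (IntD (L1Z 3 i1) (L1Z 2 L1_chi)) (IntZ 3 i1) (IntZ 2 L1_chi) lerD2l.
  exact: ler_wpM2l.
have G0 : Int (fun x => u 0 x * chi x) <= Psi (u 0).
  apply: Int_le; [exact: fchi (u2 _ (lexx 0))|exact: gi (u2 _ (lexx 0)) (fun x => u0 _ x (lexx 0))|].
  move=> x; apply: ler_wpM2r; first exact: c0.
  by apply: le_trans (entropy_ge q01 (u0 0 x (lexx 0))); rewrite lerDr.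
have E0 : 0 < expR (- (C * t)) := expR_gt0 _.
have EE : expR (- (C * t)) * expR (C * t) = 1 by rewrite -expRD addNr expR0.
have := ler_wpM2l (ltW E0) key; rewrite mulrA EE mul1r /G mulrN => K1.
have K2 : expR (- (C * t)) * Int (fun x => u 0 x * chi x) <= expR (- (C * t)) * (Psi (u 0) + B).
  apply: ler_wpM2l; first exact: ltW.
  by apply: (le_trans G0); rewrite lerDl.
have -> : expR (- (C * t)) / 3 * Int (fun x => u 0 x * chi x) =
  (expR (- (C * t)) * Int (fun x => u 0 x * chi x)) / 3 by ring.
move: K1 K2 Gt0 B0; clear; set X := expR _ * Int _; set Y := expR _ * _; lra.
Qed.

End mass.

(** * Gain of integrability *)

Section gain_of_integrability.
Context {R : realType} {N : nat} (s p : R).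
Hypotheses (hN : (0 < N)%N) (hs : 0 < s < 1) (hp : 1 < p < 2).
Local Notation T := (Rn R N).
Local Notation mu := (@lebesgueRn R N).
Local Notation mu2 := (mu \x mu)%E.
Local Notation K := (@kernel R N (s * p)).
Local Notation ballc := (@ballc R N).
Implicit Types (f g : T -> R) (t h e d a b c : R).

Lemma edist_gt0 (x y : T) : x != y -> 0 < edist x y.
Proof.
move=> xy; rewrite lt0r edist_ge0 andbT; apply: contra xy => /eqP d0.
apply/eqP/eq_from_tnth => i; apply/eqP; rewrite -subr_eq0 -normr_le0 -d0.
exact: edist_coord.
Qed.

Lemma measurable_boolset (P : T -> bool) : measurable_fun setT P ->
  measurable [set x | P x].
Proof. by move=> mP; have := mP measurableT [set true] I; rewrite setTI. Qed.

Lemma measurable_sublevel f c : measurable_fun setT f -> measurable [set x | f x <= c].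
Proof. by move=> mf; apply: measurable_boolset; exact: measurable_fun_ler. Qed.

Lemma measurable_superlevel f c : measurable_fun setT f -> measurable [set x | c < f x].
Proof. by move=> mf; apply: measurable_boolset; exact: measurable_fun_ltr. Qed.

Lemma ball_remainder (x : T) a (A B : set T) : 0 < a -> measurable A -> measurable B ->
  eball x a `<=` A `|` B -> (mu B <= (ballc / 2 * a ^+ N)%:E)%E ->
  ((ballc / 2 * a ^+ N)%:E <= mu A)%E.
Proof.
move=> a0 mA mB sub hB.
have H : ((ballc * a ^+ N)%:E <= mu A + (ballc / 2 * a ^+ N)%:E)%E.
  apply: (le_trans (eball_ge x hN a0)).
  apply: (le_trans (le_measure _ _ _ sub)); rewrite ?inE; [exact: measurable_eball|exact: measurableU|].
  exact: (le_trans (measureU2 _ mA mB)) (leeD2l _ hB).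
have -> : ballc / 2 * a ^+ N = ballc * a ^+ N - ballc / 2 * a ^+ N by field.
by rewrite EFinB leeBlDr.
Qed.

Variables (x0 : T) (r : R) (m : nat) (q : R).
Hypotheses (hr : 0 < r <= 1) (hm : (2 <= m)%N) (hq : 0 < q < 1) (hpq : 0 <= p - 2 + q).
Local Notation theta := (theta x0 r).
Local Notation chi := (chi x0 r m).
Local Notation e := (p - 2 + q).
Local Notation diss := (dissipation s p x0 r m (profile 0 (1 - q))).

Lemma chi_half x y : edist x y < theta x / 2 -> (2 ^+ m)^-1 * chi x <= chi y.
Proof.
move=> xy; have th2 : theta x / 2 <= theta y by have := theta_lip x0 r x y; lra.
rewrite -exprVn -exprMn mulrC /chi lerXn2r ?nnegrE ?theta_ge0//.
by rewrite divr_ge0// theta_ge0.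
Qed.

Let q' : 0 < 1 - q < 1. Proof. by have [q0 q1] := andP hq; lra. Qed.
Let sp0 : 0 < s * p.
Proof. by have [s0 s1] := andP hs; have [p1 p2] := andP hp; rewrite mulr_gt0//; lra. Qed.

Definition gainc : R := 2^-1 * (2^-1 `^ (p - 1)) * ((1 - q) / 8) * (2 ^+ m)^-1.

Lemma gainc_gt0 : 0 < gainc.
Proof. by rewrite !mulr_gt0 ?powR_gt0 ?invr_gt0 ?exprn_gt0//; have [q0 q1] := andP hq; lra. Qed.

(** The factors of the dissipation at the pair, with [f y <= f x / 2]: [(f x /
    2)^(p-1)] for the difference, [f x^(q-1)] for the difference of the
    profiles, by [profile_slope]. *)
Lemma dissipation_pointwise f x y a : 1 <= f x -> 0 <= f y -> f y <= f x / 2 ->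
  0 < a <= theta x / 2 -> edist x y < a ->
  gainc * f x `^ e * chi x * (a `^ (N%:R + s * p))^-1 <= diss f (x, y).
Proof.
move=> fx fy fyx /andP[a0 ath] xya; have [p1 p2] := andP hp; have [q0 q1] := andP hq.
rewrite /dissipation/= fyx (lt_le_trans xya ath)/=.
have f0 : 0 < f x by lra.
have xy : x != y by apply: contraTneq fyx => <-; rewrite -ltNge; lra.
have Kxy : (a `^ (N%:R + s * p))^-1 <= K x y.
  by apply: kernel_ge sp0 _; rewrite edist_gt0//= ltW.
apply: ler_pM => //; rewrite ?invr_ge0 ?powR_ge0//.
  exact: mulr_ge0 (mulr_ge0 (ltW gainc_gt0) (powR_ge0 _ _)) (chi_ge0 _ _ _ _).
have chixy := chi_half (lt_le_trans xya ath).
have D1 : 2^-1 `^ (p - 1) * f x `^ (p - 1) <= (f x - f y) `^ (p - 1).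
  rewrite -powRM ?invr_ge0 ?(ltW f0)//.
  by apply: ge0_ler_powR; rewrite ?nnegrE//; lra.
have D2 : (1 - q) / 8 * f x `^ (q - 1) <= profile 0 (1 - q) (f y) - profile 0 (1 - q) (f x).
  have := @profile_slope R 0 (1 - q) (f x) (f y) q'.
  have -> : 0 <= f y <= f x by rewrite fy; lra.
  move=> /(_ isT); apply: le_trans.
  apply: (@le_trans _ _ (f x / 2 * slope (1 - q) (f x))); last first.
    by apply: ler_wpM2r; [apply: ltW; apply: slope_gt0; lra|lra].
  rewrite /slope.
  have -> : - (1 - q) - 1 = q - 2 by ring.
  have H : 2^-1 ^+ 2 * f x `^ (q - 2) <= (1 + f x) `^ (q - 2).
    apply: (@le_trans _ _ ((2 * f x) `^ (q - 2))); last first.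
      have -> : q - 2 = - (2 - q) by ring.
      rewrite !powRN lef_pV2 ?posrE ?powR_gt0//; try (by lra).
      by apply: ge0_ler_powR; rewrite ?nnegrE; lra.
    rewrite powRM// ?(ltW f0)//; apply: ler_wpM2r; first exact: powR_ge0.
    by rewrite exprVn -powR_mulrn// -powRN; apply: ler_powR; [rewrite ler1n|rewrite addrC lerDl ltW].
  have E : f x `^ (q - 1) = f x * f x `^ (q - 2).
    by rewrite -{2}(powRr1 (ltW f0)) -gt0_powRD//; congr (_ `^ _); ring.
  rewrite E.
  have -> : (1 - q) / 8 * (f x * f x `^ (q - 2)) =
     (f x / 2 * (1 - q)) * (2^-1 ^+ 2 * f x `^ (q - 2)) by field.
  have -> : f x / 2 * ((1 - q) * (1 + f x) `^ (q - 2)) = (f x / 2 * (1 - q)) * (1 + f x) `^ (q - 2).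
    by ring.
  by apply: ler_wpM2l H; rewrite mulr_ge0//; lra.
have -> : gainc * f x `^ e * chi x =
   2^-1 * (((2^-1 `^ (p - 1)) * f x `^ (p - 1)) * ((1 - q) / 8 * f x `^ (q - 1)) * ((2 ^+ m)^-1 * chi x)).
  have -> : f x `^ e = f x `^ (p - 1) * f x `^ (q - 1) by rewrite -gt0_powRD//; congr (_ `^ _); ring.
  by rewrite /gainc; ring.
have B1 : 0 <= 2^-1 `^ (p - 1) * f x `^ (p - 1) by rewrite mulr_ge0 ?powR_ge0.
have B2 : 0 <= (1 - q) / 8 * f x `^ (q - 1) by rewrite mulr_ge0 ?powR_ge0//; lra.
have B3 : 0 <= (2 ^+ m)^-1 * chi x by apply: mulr_ge0; [rewrite invr_ge0 exprn_ge0|exact: chi_ge0].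
apply: ler_wpM2l => //; apply: ler_pM => //; first exact: mulr_ge0.
exact: ler_pM.
Qed.

(** By [ball_remainder] half of the ball of radius [a] around [x] is filled with
    points where [f <= f x / 2]. If that ball is not within the near region then
    [a^(-sp)] is at most a multiple of [theta x^(-sp)], the weight of the
    error. *)
Lemma dissipation_section f (x : T) a : measurable_fun setT f -> (forall x, 0 <= f x) ->
  1 <= f x -> 0 < a -> 
  (mu [set y : T | (edist x0 y < r)%R /\ (f x / 2 < f y)%R] <= (ballc / 2 * a ^+ N)%:E)%E ->
  ((gainc * (ballc / 2) * (f x `^ e * (chi x * a `^ (- (s * p)))))%:E <=
   \int[mu]_y (diss f (x, y))%:E +
   (gainc * (ballc / 2) * 2 `^ (s * p) * (power e (f x) * (theta x ^+ m * theta x `^ (- (s * p)))))%:E)%E.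
Proof.
move=> mf f0 fx a0 Hbad; have [p1 p2] := andP hp; have [q0 q1] := andP hq.
have g0 := gainc_gt0; have b0 := @ballc_gt0 R N hN.
have c0 : 0 <= gainc * (ballc / 2) by apply: ltW; apply: mulr_gt0 g0 (divr_gt0 b0 _).
have kk z : 0 <= diss f z.
  apply: (@dissipation_ge0 R N s p x0 r m (profile 0 (1 - q)) (slope (1 - q))) => //.
    by move=> b b1; apply: slope_gt0 => //; lra.
  by move=> b b' bb; exact: profile_slope.
have [ath|ath] := leP a (theta x / 2); last first.
  apply: (@le_trans _ _ ((gainc * (ballc / 2) * 2 `^ (s * p) * (power e (f x) * (theta x ^+ m * theta x `^ (- (s * p)))))%:E)); last first.
    by rewrite leeDr// int_ge0.
  rewrite lee_fin -[leRHS]mulrA; apply: (ler_wpM2l c0).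
  have [th0|thn0] := eqVneq (theta x) 0.
    by rewrite /chi th0 expr0n; case: m hm => // n _; rewrite !(mul0r, mulr0).
  have th : 0 < theta x by rewrite lt0r thn0 theta_ge0.
  have H1 : f x `^ e <= power e (f x).
    by rewrite /power; apply: ge0_ler_powR; rewrite ?nnegrE//; lra.
  have H2 : a `^ (- (s * p)) <= 2 `^ (s * p) * theta x `^ (- (s * p)).
    have -> : 2 `^ (s * p) * theta x `^ (- (s * p)) = (theta x / 2) `^ (- (s * p)).
      rewrite powRM ?(ltW th) ?invr_ge0// mulrC; congr (_ * _).
      by rewrite -powR_inv1// -powRrM mulN1r opprK.
    rewrite !powRN lef_pV2 ?posrE ?powR_gt0 ?divr_gt0//.
    by apply: ge0_ler_powR; rewrite ?nnegrE ?divr_ge0 ?theta_ge0 ?(ltW a0) ?(ltW sp0) ?(ltW ath).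
  have -> : 2 `^ (s * p) * (power e (f x) * (theta x ^+ m * theta x `^ (- (s * p)))) =
    power e (f x) * (theta x ^+ m * (2 `^ (s * p) * theta x `^ (- (s * p)))) by ring.
  apply: ler_pM => //; rewrite ?powR_ge0//.
    by rewrite mulr_ge0 ?powR_ge0 ?chi_ge0.
  by rewrite ler_wpM2l// chi_ge0.
apply: (@le_trans _ _ (\int[mu]_y (diss f (x, y))%:E)%E); last first.
  rewrite leeDl// lee_fin; apply: mulr_ge0; first exact: mulr_ge0 c0 (powR_ge0 _ _).
  by rewrite !mulr_ge0 ?powR_ge0 ?exprn_ge0 ?theta_ge0.
pose v := gainc * f x `^ e * chi x * (a `^ (N%:R + s * p))^-1.
have v0 : 0 <= v.
  apply: mulr_ge0; last by rewrite invr_ge0 powR_ge0.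
  exact: mulr_ge0 (mulr_ge0 (ltW g0) (powR_ge0 _ _)) (chi_ge0 _ _ _ _).
pose A := [set y | edist x y < a /\ f y <= f x / 2].
have mA : measurable A.
  apply: measurableI; first exact: measurable_eball.
  exact: measurable_sublevel.
have mBad : measurable [set y | edist x0 y < r /\ f x / 2 < f y].
  apply: measurableI; first exact: measurable_eball.
  exact: measurable_superlevel.
have muA : ((ballc / 2 * a ^+ N)%:E <= mu A)%E.
  apply: (ball_remainder (x := x) a0 mA mBad _ Hbad) => y xy.
  have [H|H] := leP (f y) (f x / 2); [left; split => //|right; split => //].
  have [th|th] := leP r (edist x0 x).
    by move: ath; rewrite (theta_supp th) mul0r leNgt a0.
  have rth : 0 <= r - edist x0 x by rewrite subr_ge0 ltW.
  apply: (le_lt_trans (edist_triangle x x0 y)); rewrite -ltrBrDl.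
  apply: (lt_le_trans xy); apply: (le_trans ath); rewrite /theta max_l//.
  by rewrite ler_pdivrMr// ler_peMr// ler1n.
apply: (@le_trans _ _ (v%:E * mu A)%E).
  apply: (@le_trans _ _ (v%:E * (ballc / 2 * a ^+ N)%:E)%E); last exact: lee_wpmul2l.
  rewrite -EFinM lee_fin le_eqVlt; apply/orP; left; apply/eqP.
  have E : a `^ (- (s * p)) = (a `^ (N%:R + s * p))^-1 * a ^+ N.
    rewrite -powR_mulrn ?(ltW a0)// -powRN -gt0_powRD//; congr (_ `^ _); ring.
  by rewrite /v E; ring.
have <- : (\int[mu]_y (v * \1_A y)%:E = v%:E * mu A)%E.
  rewrite intZ//.
  by rewrite integral_indic// setIT.
have md := measurable_dissipation s p x0 r m (@measurable_profile R 0 (1 - q)) mf.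
apply: int_le => [||y|y].
- by apply: measurable_funM => //; exact: measurable_indic.
- exact: measurable_section md.
- by rewrite mulr_ge0.
- rewrite indicE; have [yA|yA] := boolP (y \in A); last by rewrite mulr0.
  rewrite mulr1; move: yA; rewrite inE => -[xya fyx].
  by apply: dissipation_pointwise => //; rewrite a0.
Qed.


Hypothesis hmq : s * p + s * p * e / (q - e) <= m%:R.

Lemma L1_power f : sqint f -> (forall x, 0 <= f x) -> L1 (fun x => power q (f x) * chi x).
Proof.
move=> f2 f0; have [q0 q1] := andP hq.
apply: (@L1_linear R N x0 r hr m hm _ f 1 1) => // [|x].
  apply: measurable_funM; last exact: measurable_chi.
  exact: measurableT_comp (@measurable_power R q) f2.1.
rewrite ger0_norm ?mulr_ge0 ?power_ge0 ?chi_ge0// !mul1r -[X in _ + X]mul1r -mulrDl.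
rewrite ler_wpM2r ?chi_ge0// addrC -[leRHS](powRr1 (_ : 0 <= 1 + f x)); last by have := f0 x; lra.
by apply: ler_powR; [have := f0 x; lra|exact: ltW].
Qed.

Lemma int_error_le f : sqint f -> (forall x, 0 <= f x) ->
  (\int[mu]_x (power e (f x) * (theta x ^+ m * theta x `^ (- (s * p))))%:E <=
   (Int (fun x => power q (f x) * chi x))%:E + mu (eball x0 r))%E.
Proof.
move=> f2 f0; have i1 := L1_power f2 f0; have mf := f2.1.
have [p1 p2] := andP hp.
have mth := measurable_theta x0 r.
pose S x : R := (edist x0 x < r)%R%:R.
have mS : measurable_fun setT S.
  by apply: measurable_boolR; apply: measurable_fun_ltr => //; exact: measurable_edistl.
have mg : measurable_fun setT (fun x => power q (f x) * chi x).
  by have [/measurable_EFinP] := integrableP _ _ _ i1.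
have g0 x : 0 <= power q (f x) * chi x by rewrite mulr_ge0 ?power_ge0 ?chi_ge0.
have S0 x : 0 <= S x by exact: ler0n.
apply: (@le_trans _ _ (\int[mu]_x (power q (f x) * chi x + S x)%:E)%E).
  apply: int_le => [||x|x].
  - apply: measurable_funM; first exact: measurableT_comp (measurable_power e) mf.
    by apply: measurable_funM; [exact: measurable_funX|exact: measurable_powRn].
  - exact: measurable_funD.
  - by rewrite !mulr_ge0 ?powR_ge0 ?exprn_ge0 ?theta_ge0.
  - rewrite /S; case: ltP => xr; last first.
      rewrite /chi (theta_supp xr) addr0.
      by rewrite expr0n; case: m hm => // n _; rewrite mul0r !mulr0.
    have a1 : 1 <= 1 + f x by rewrite lerDl.
    have th01 : 0 <= theta x <= 1 by rewrite theta_ge0 (theta_le1 x0 hr).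
    have eq_ : e < q by lra.
    exact: (power_absorb a1 th01 eq_ (ltW sp0) hpq hmq).
rewrite (intD _ mg mS g0 S0) -int_Rfine//; apply: leeD => //.
rewrite -[leRHS]mul1e; apply: mu_ball_le => // x.
by rewrite mul1r.
Qed.

(** The dissipation of the entropy [(1+f)^q] at the scale [rho a^(-tau)], at
    which the superlevel sets are small by assumption, controls a higher power
    of [f]: a point where [f = a] dissipates [a^(p-2+q)] times [(rho
    a^(-tau))^(-sp)], whereas the errors grow like [a^(p-2+q)] only. *)
Lemma static_entropy c : 0 <= c -> exists2 C : R, 0 < C & forall f, supersolution s p c f ->
  forall rho tau L, 0 < rho -> 1 <= L ->
  (forall a, L <= a -> (mu [set y : T | (edist x0 y < r)%R /\ (a / 2 < f y)%R] <=
     (ballc / 2 * (rho * a `^ (- tau)) ^+ N)%:E)%E) ->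
  (\int[mu]_x ((L < f x)%R%:R * (f x `^ (e + tau * (s * p)) * chi x))%:E <=
   (C * rho `^ (s * p) * (1 + Int (fun x => power q (f x) * chi x)))%:E)%E.
Proof.
move=> c0; have [p1 p2] := andP hp; have [q0 q1] := andP hq.
have sl : forall a, 0 <= a -> 0 < slope (1 - q) a.
  by move=> a a0; apply: slope_gt0 => //; have [] := andP q'.
have pos_k a : 0 <= a -> 0 < profile 0 (1 - q) a.
  move=> a0; have := @profile_bound R 0 (1 - q) a; rewrite lexx ler01 => /(_ isT).
  by case/andP: q' => q'0 _ /(_ q'0 a0) /andP[].
have kle a : 0 <= a -> 0 <= profile 0 (1 - q) a <= 2.
  move=> a0; have := @profile_bound R 0 (1 - q) a; rewrite lexx ler01 => /(_ isT).
  by case/andP: q' => q'0 _ /(_ q'0 a0) /andP[k0 ->]; rewrite ltW.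
have eE : p - 1 - (1 - q) = e by ring.
pose Ce := (1 - q) `^ (1 - p) + 1.
have Ce0 : 0 < Ce by rewrite ltr_wpDl ?powR_ge0.
have near_er a : 0 <= a -> profile 0 (1 - q) a `^ p * slope (1 - q) a `^ (1 - p) <= Ce * power e a.
  move=> a0; rewrite (profile0_near hp q' a0) eE.
  by rewrite ler_wpM2r ?power_ge0// /Ce lerDl.
have far_er a : 0 <= a -> a `^ (p - 1) * profile 0 (1 - q) a <= Ce * power e a.
  move=> a0; apply: (le_trans (profile0_far hp q' a0)); rewrite eE.
  by rewrite ler_peMl ?power_ge0// /Ce lerDr powR_ge0.
have [C C0 HC] := @supersolution_entropy R N s p hs hp x0 r m hr hm (profile 0 (1 - q)) (slope (1 - q))
  (power e) Ce pos_k sl (fun a _ => power_ge0 e a) Ce0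
  (fun a b => @profile_slope R 0 (1 - q) a b q') near_er far_er (@measurable_profile R 0 (1 - q))
  (@measurable_power R e) 2 (ltac:(by [])) (fun a b => @profile_lip R 0 (1 - q) a b q') kle.
pose B := fine (mu (eball x0 r)).
have BE : mu (eball x0 r) = B%:E by rewrite fineK// ge0_fin_numE// eball_fin.
have B0 : 0 <= B by rewrite fine_ge0.
pose g0 := gainc * (ballc / 2); pose g1 := g0 * 2 `^ (s * p).
have g00 : 0 < g0 by apply: mulr_gt0 gainc_gt0 (divr_gt0 (ballc_gt0 hN) _).
have g10 : 0 <= g1 by exact: mulr_ge0 (ltW g00) (powR_ge0 _ _).
pose C1 := (C + g1 + c) * (1 + B) / g0.
exists C1; first by rewrite divr_gt0// mulr_gt0//; lra.
move=> f sup rho tau L rho0 L1' Hsmall; have [f0 f2 fy _] := sup.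
have mf := f2.1.
have i1 := L1_power f2 f0.
pose Q := Int (fun x => power q (f x) * chi x).
have g_ge0 x : 0 <= power q (f x) * chi x by rewrite mulr_ge0 ?power_ge0 ?chi_ge0.
have Q0 : 0 <= Q by exact: Int_ge0.
have mth := measurable_theta x0 r; have mchi := measurable_chi x0 r m.
pose F x := (L < f x)%R%:R * (f x `^ (e + tau * (s * p)) * chi x).
pose E x := power e (f x) * (theta x ^+ m * theta x `^ (- (s * p))).
have F0 x : 0 <= F x by rewrite !mulr_ge0 ?powR_ge0 ?chi_ge0.
have E0 x : 0 <= E x by rewrite !mulr_ge0 ?powR_ge0 ?exprn_ge0 ?theta_ge0.
have mF : measurable_fun setT F.
  apply: measurable_funM; first by apply: measurable_boolR; exact: measurable_fun_ltr.
  by apply: measurable_funM mchi; exact: measurable_powRn.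
have mE : measurable_fun setT E.
  apply: measurable_funM; first exact: measurableT_comp (measurable_power e) mf.
  by apply: measurable_funM; [exact: measurable_funX|exact: measurable_powRn].
have md := measurable_dissipation s p x0 r m (@measurable_profile R 0 (1 - q)) mf.
have d0 z : 0 <= diss f z.
  apply: (@dissipation_ge0 R N s p x0 r m (profile 0 (1 - q)) (slope (1 - q))) => //.
  by move=> b b' bb; exact: profile_slope.
have key x : ((g0 * rho `^ (- (s * p)) * F x)%:E <= \int[mu]_y (diss f (x, y))%:E + (g1 * E x)%:E)%E.
  rewrite /F; case: (ltP L (f x)) => Lf; last first.
    by rewrite !mul0r mulr0 adde_ge0 ?int_ge0// lee_fin mulr_ge0.
  have fx1 : 1 <= f x by exact: le_trans L1' (ltW Lf).
  have fx0 : 0 < f x by exact: lt_le_trans ltr01 fx1.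
  have a0 : 0 < rho * f x `^ (- tau) by rewrite mulr_gt0// powR_gt0.
  have := dissipation_section mf f0 fx1 a0 (Hsmall _ (ltW Lf)).
  rewrite powRM ?(ltW rho0) ?powR_ge0// -powRrM mul1r.
  have -> : f x `^ (e + tau * (s * p)) = f x `^ e * f x `^ (- tau * - (s * p)).
    by rewrite -gt0_powRD//; congr (_ `^ _); ring.
  apply: le_trans; rewrite lee_fin le_eqVlt; apply/orP; left; apply/eqP.
  by rewrite /g0; ring.
have k0 : 0 <= g0 * rho `^ (- (s * p)) by exact: mulr_ge0 (ltW g00) (powR_ge0 _ _).
have I1 : ((g0 * rho `^ (- (s * p)))%:E * \int[mu]_x (F x)%:E <=
    \int[mu2]_z (diss f z)%:E + g1%:E * \int[mu]_x (E x)%:E)%E.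
  rewrite -intZ// -(intZ _ mE g10 E0) (int2E md d0).
  have mEl : measurable_fun setT (fun x => (g1 * E x)%:E).
    by apply/measurable_EFinP; exact: measurable_funM.
  have mdl := measurable_int_section md d0.
  have dl0 x : setT x -> (0 <= \int[mu]_y (diss f (x, y))%:E)%E by move=> _; exact: int_ge0.
  have El0 x : setT x -> (0 <= (g1 * E x)%:E)%E by rewrite lee_fin mulr_ge0.
  rewrite -(ge0_integralD _ measurableT dl0 mdl El0 mEl).
  apply: ge0_le_integral => //.
  - by move=> x _; rewrite lee_fin mulr_ge0.
  - by apply/measurable_EFinP; exact: measurable_funM.
  - exact: emeasurable_funD mdl mEl.
have I2 : (\int[mu]_x (E x)%:E <= (Q + B)%:E)%E.
  by rewrite EFinD -BE; exact: int_error_le f2 f0.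
have I3 : Int (fun x => f x * (profile 0 (1 - q) (f x) * chi x)) <= Q.
  have le1 x : f x * (profile 0 (1 - q) (f x) * chi x) <= power q (f x) * chi x.
    rewrite mulrA ler_wpM2r ?chi_ge0// /profile add0r /power.
    have fx1 : 0 < 1 + f x by rewrite ltr_pwDl.
    have -> : (1 + f x) `^ q = (1 + f x) * (1 + f x) `^ (- (1 - q)).
      by rewrite -{2}(powRr1 (ltW fx1)) -gt0_powRD//; congr (_ `^ _); ring.
    by rewrite ler_wpM2r ?powR_ge0// lerDr.
  have mk : measurable_fun setT (fun x => f x * (profile 0 (1 - q) (f x) * chi x)).
    apply: measurable_funM => //; apply: measurable_funM mchi.
    exact: measurableT_comp (@measurable_profile R 0 (1 - q)) mf.
  apply: (Int_le _ i1 le1).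
  have [mi _] := integrableP _ _ _ i1.
  apply: (int_integrable mk _ (g := fun x => power q (f x) * chi x)); first exact/measurable_EFinP.
    move=> x; have /andP[k1 _] := kle _ (f0 x).
    rewrite (ger0_norm (mulr_ge0 (f0 x) (mulr_ge0 k1 (chi_ge0 x0 r m x)))).
    exact: le1.
  by rewrite -int_Rfine ?ltry.
have I4 := HC c f sup.
have I5 : ((g0 * rho `^ (- (s * p)))%:E * \int[mu]_x (F x)%:E <= ((C + g1 + c) * (1 + B) * (1 + Q))%:E)%E.
  apply: (le_trans I1).
  apply: (@le_trans _ _ ((C * (Q + B))%:E + (c * Q)%:E + (g1 * (Q + B))%:E)%E).
    apply: leeD; last by rewrite (EFinM g1); apply: lee_wpmul2l; rewrite ?lee_fin.
    apply: (le_trans I4); apply: leeD; last by rewrite lee_fin ler_wpM2l.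
    by rewrite (EFinM C); apply: lee_wpmul2l; rewrite ?lee_fin// ltW.
  rewrite -!EFinD lee_fin.
  have H1 : (C + g1) * (Q + B) <= (C + g1) * ((1 + B) * (1 + Q)).
    apply: ler_wpM2l; first by rewrite addr_ge0// ltW.
    have -> : (1 + B) * (1 + Q) = Q + B + (1 + B * Q) by ring.
    by rewrite lerDl addr_ge0// mulr_ge0.
  have H2 : c * Q <= c * ((1 + B) * (1 + Q)).
    apply: ler_wpM2l => //.
    have -> : (1 + B) * (1 + Q) = Q + (1 + B + B * Q) by ring.
    by rewrite lerDl !addr_ge0// mulr_ge0.
  have -> : C * (Q + B) + c * Q + g1 * (Q + B) = (C + g1) * (Q + B) + c * Q by ring.
  have -> : (C + g1 + c) * (1 + B) * (1 + Q) = (C + g1) * ((1 + B) * (1 + Q)) + c * ((1 + B) * (1 + Q)) by ring.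
  exact: lerD.
have rs0 : 0 < rho `^ (s * p) by rewrite powR_gt0.
have k1 : 0 < g0 * rho `^ (- (s * p)) by rewrite mulr_gt0// powR_gt0.
have kinv : (g0 * rho `^ (- (s * p)))^-1 = rho `^ (s * p) / g0.
  by rewrite invfM powRN invrK mulrC.
have := lee_wpmul2l (_ : (0 <= (g0 * rho `^ (- (s * p)))^-1%:E)%E) I5.
rewrite lee_fin invr_ge0 => /(_ (ltW k1)).
rewrite muleA -EFinM mulVf ?gt_eqF// mul1e => /le_trans; apply.
rewrite -EFinM lee_fin kinv /C1 le_eqVlt; apply/orP; left; apply/eqP.
by rewrite -/Q; ring.
Qed.

End gain_of_integrability.

(** * Monotone sequences of supersolutions *)

Lemma absorb_half (R : realType) (X Y Z : R) : Y <= 4^-1 * (1 + Z) ->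
  Z <= X + 2 * Y -> Z <= 2 * X + 1.
Proof. lra. Qed.

Section bounded_mass.
Context {R : realType} {N : nat} (s p : R).
Hypotheses (hN : (0 < N)%N) (hs : 0 < s < 1) (hp : 1 < p < 2).
Local Notation T := (Rn R N).
Local Notation mu := (@lebesgueRn R N).
Local Notation ballc := (@ballc R N).
Implicit Types (f g : T -> R) (t h e d a b c l : R).
Variable x0 : T.

Definition inball r (x : T) : R := (edist x0 x < r)%R%:R.

Lemma inball_ge0 r x : 0 <= inball r x.
Proof. exact: ler0n. Qed.

Lemma measurable_inball r : measurable_fun setT (inball r).
Proof. by apply: measurable_boolR; apply: measurable_fun_ltr => //; exact: measurable_edistl. Qed.

Lemma L1_inball r : L1 (inball r).
Proof.
apply: ge0_integrable; [exact: measurable_inball|exact: inball_ge0|].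
apply: (@le_lt_trans _ _ (1%:E * mu (eball x0 r))%E); last by rewrite mul1e eball_fin.
by apply: mu_ball_le => [//||x|x]; [exact: measurable_inball|exact: inball_ge0|rewrite mul1r].
Qed.

Lemma L1_quadratic (F f : T -> R) r a b : measurable_fun setT F -> sqint f ->
  (forall x, `|F x| <= a * inball r x + b * f x ^+ 2) -> L1 F.
Proof.
move=> mF f2 H.
have i1 := L1D (L1Z a (L1_inball r)) (L1Z b (sqint_sqr f2)).
have [mi _] := integrableP _ _ _ i1.
apply: (int_integrable mF _ H); first exact/measurable_EFinP.
by rewrite -int_Rfine ?ltry.
Qed.

Lemma chebyshev_set (A : set T) (G : T -> R) k : measurable A -> L1 G -> 0 < k ->
  (forall x, 0 <= G x) -> (forall x, A x -> k <= G x) -> (mu A <= (k^-1 * Int G)%:E)%E.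
Proof.
move=> mA iG k0 G0 AG.
have [/measurable_EFinP mG _] := integrableP _ _ _ iG.
have H : (k%:E * mu A <= (Int G)%:E)%E.
  rewrite int_Rfine//.
  have <- : (\int[mu]_y (k * \1_A y)%:E = k%:E * mu A)%E.
    by rewrite intZ ?(ltW k0)// integral_indic// setIT.
  apply: int_le => [|//|x|x].
  - by apply: measurable_funM => //; exact: measurable_indic.
  - by rewrite mulr_ge0// ltW.
  - rewrite indicE; have [xA|xA] := boolP (x \in A); last by rewrite mulr0.
    by rewrite mulr1; apply: AG; rewrite inE in xA.
by rewrite EFinM lee_pdivlMl.
Qed.

Variables (f : nat -> T -> R) (Q : R).
Hypotheses (f0 : forall n x, 0 <= f n x) (f2 : forall n, sqint (f n))
  (fmono : forall n n', (n <= n')%N -> {ae mu, forall x, f n x <= f n' x})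
  (fQ : forall n, Int (fun x => inball 1 x * f n x `^ (p - 1)) <= Q).
Local Notation w n := (fun x => inball 1 x * f n x `^ (p - 1)).
Local Notation wtail n l := (fun x => inball 1 x * (l < f n x)%R%:R * f n x `^ (p - 1)).

Lemma powR_le_quadratic a : 0 <= a -> a `^ (p - 1) <= 1 + a ^+ 2.
Proof.
move=> a0; have [p1 p2] := andP hp; have [a1|a1] := leP a 1.
  apply: (@le_trans _ _ 1); last by rewrite lerDl sqr_ge0.
  suff : a `^ (p - 1) <= 1 `^ (p - 1) by rewrite powR1.
  by apply: ge0_ler_powR; rewrite ?nnegrE//; lra.
apply: (@le_trans _ _ (a ^+ 2)); last by rewrite lerDr.
by rewrite -powR_mulrn// ler_powR ?(ltW a1)//; lra.
Qed.

Let mf n := (f2 n).1.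

Lemma measurable_w n : measurable_fun setT (w n).
Proof. by apply: measurable_funM; [exact: measurable_inball|exact: measurable_powRn]. Qed.

Lemma measurable_wtail n l : measurable_fun setT (wtail n l).
Proof.
apply: measurable_funM; last exact: measurable_powRn.
apply: measurable_funM; first exact: measurable_inball.
by apply: measurable_boolR; exact: measurable_fun_ltr.
Qed.

Lemma L1_w n : L1 (w n).
Proof.
apply: (@L1_quadratic _ (f n) 1 1 1 (measurable_w n)) => // x.
rewrite ger0_norm ?mulr_ge0 ?powR_ge0 ?inball_ge0// !mul1r.
rewrite /inball; case: ltP => _; rewrite ?mul1r ?mul0r ?add0r ?sqr_ge0//.
exact: powR_le_quadratic.
Qed.

Lemma L1_wtail n l : L1 (wtail n l).
Proof.
apply: (int_integrable (measurable_wtail n l) (measurable_w n)) => [x|].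
  rewrite ger0_norm ?mulr_ge0 ?powR_ge0 ?inball_ge0//.
  by rewrite -mulrA ler_wpM2l ?inball_ge0//; case: ltP => _; rewrite ?mul1r ?mul0r ?powR_ge0.
by rewrite -int_Rfine ?ltry//; exact: L1_w.
Qed.

(** Equi-integrability of a bounded monotone sequence: from the index [n0] on
    the integrals increase by less than [d / 3], and the function of index [n0]
    is square integrable. *)
Lemma uniform_tails d : 0 < d -> exists n0 : nat, exists2 l0 : R, 1 <= l0 &
  forall n l, (n0 <= n)%N -> l0 <= l -> Int (wtail n l) <= d.
Proof.
move=> d0; have [p1 p2] := andP hp.
have Fmono n n' : (n <= n')%N -> Int (w n) <= Int (w n').
  move=> nn; apply: Int_ae_le; [exact: L1_w|exact: L1_w|].
  apply: filterS (fmono nn) => x fx; rewrite ler_wpM2l ?inball_ge0//.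
  by apply: ge0_ler_powR; rewrite ?nnegrE//; lra.
pose S := [set Int (w n) | n in [set: nat]].
have Ssup : has_sup S.
  by split; [exists (Int (w 0%N)); exists 0%N|exists Q => _ [n _ <-]; exact: fQ].
have d3 : 0 < d / 3 by lra.
have [_ [n0 _ <-] Hn0] := sup_adherent d3 Ssup.
have gap n : Int (w n) - Int (w n0) <= d / 3.
  have : Int (w n) <= sup S by apply: ub_le_sup; [exact: Ssup.2|exists n].
  rewrite lerBlDl => /le_trans; apply; rewrite -lerBlDr; exact: ltW.
(* [La^(p-3) <= La^(-1)] makes the part of [f n0] above [La] small *)
pose La := Num.max 1 (3 * nsq (f n0) / d).
have La1 : 1 <= La by rewrite le_max lexx.
have La0 : 0 < La by lra.
have HLa : La `^ (p - 3) * nsq (f n0) <= d / 3.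
  apply: (@le_trans _ _ (La^-1 * nsq (f n0))).
    rewrite ler_wpM2r ?nsq_ge0// -powR_inv1 ?(ltW La0)//; apply: ler_powR => //; lra.
  rewrite mulrC ler_pdivrMr//.
  have : 3 * nsq (f n0) / d <= La by rewrite le_max lexx orbT.
  rewrite ler_pdivrMr//; lra.
have Q0 : 0 <= Q.
  by apply: le_trans (fQ 0); apply: Int_ge0 => x; rewrite mulr_ge0 ?powR_ge0 ?inball_ge0.
pose E := 3 * La `^ (p - 1) * Q / d.
have E0 : 0 <= E by rewrite divr_ge0 ?mulr_ge0 ?powR_ge0 ?(ltW d0).
pose l0 := Num.max 1 (E `^ (p - 1)^-1).
exists n0; exists l0; first by rewrite le_max lexx.
move=> n l nn ll.
have l1 : 1 <= l by apply: le_trans ll; rewrite le_max lexx.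
have l0' : 0 < l by lra.
have Hl : E <= l `^ (p - 1).
  have -> : E = (E `^ (p - 1)^-1) `^ (p - 1).
    by rewrite -powRrM mulVf ?powRr1//; rewrite gt_eqF//; lra.
  apply: ge0_ler_powR; rewrite ?nnegrE ?powR_ge0 ?(ltW l0')//; first lra.
  by apply: le_trans ll; rewrite le_max lexx orbT.
pose G x := inball 1 x * (l < f n x)%R%:R.
have mG : measurable_fun setT G.
  apply: measurable_funM; first exact: measurable_inball.
  by apply: measurable_boolR; exact: measurable_fun_ltr.
have iG : L1 G.
  apply: (int_integrable mG (measurable_inball 1)) => [x|].
    rewrite ger0_norm ?mulr_ge0 ?inball_ge0// ler_piMr ?inball_ge0//.
    by case: ltP.
  by rewrite -int_Rfine ?ltry//; exact: L1_inball.
have cheb : l `^ (p - 1) * Int G <= Q.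
  rewrite -IntZ//; apply: le_trans (fQ n).
  apply: Int_le; [exact: L1Z|exact: L1_w|move=> x].
  rewrite /G mulrCA ler_wpM2l ?inball_ge0//.
  case: ltP => lf; rewrite ?mulr1 ?mulr0 ?powR_ge0//.
  by apply: ge0_ler_powR; rewrite ?nnegrE ?(ltW l0') ?(ltW lf)//; lra.
have IG : La `^ (p - 1) * Int G <= d / 3.
  have G0 : 0 <= Int G by apply: Int_ge0 => x; rewrite mulr_ge0 ?inball_ge0.
  have : E * Int G <= Q by apply: le_trans cheb; rewrite ler_wpM2r.
  have [Qz|Qn] := eqVneq Q 0.
    have : 1 * Int G <= l `^ (p - 1) * Int G.
      rewrite ler_wpM2r// -[leLHS](powRr0 l); apply: ler_powR => //; lra.
    move=> h1 _; have -> : Int G = 0 by lra.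
    by rewrite mulr0 ltW.
  have Qp : 0 < Q by rewrite lt0r Qn.
  have -> : E * Int G = (La `^ (p - 1) * Int G) * (3 / d) * Q by rewrite /E; ring.
  rewrite -[leRHS]mul1r ler_pM2r// -ler_pdivlMr ?divr_gt0// mul1r invf_div.
  by [].
have i1 := L1B (L1_w n) (L1_w n0).
have i2 := L1Z (La `^ (p - 1)) iG.
have i3 := L1Z (La `^ (p - 3)) (sqint_sqr (f2 n0)).
have main : Int (wtail n l) <= Int (fun x => w n x - w n0 x) +
    La `^ (p - 1) * Int G + La `^ (p - 3) * nsq (f n0).
  rewrite /nsq -(IntZ _ iG) -(IntZ _ (sqint_sqr (f2 n0))) -(IntD i1 i2) -(IntD (L1D i1 i2) i3).
  apply: Int_ae_le; [exact: L1_wtail|exact: (L1D (L1D i1 i2) i3)|].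
  apply: filterS (fmono nn) => x fx.
  rewrite /G /inball; case: ltP => xB; last first.
    by rewrite !mul0r subrr mulr0 !add0r mulr_ge0 ?powR_ge0 ?sqr_ge0.
  rewrite !mul1r.
  have wle : f n0 x `^ (p - 1) <= f n x `^ (p - 1).
    by apply: ge0_ler_powR; rewrite ?nnegrE//; lra.
  have q0 : 0 <= La `^ (p - 3) * f n0 x ^+ 2 by rewrite mulr_ge0 ?powR_ge0 ?sqr_ge0.
  case: ltP => lf; last first.
    by rewrite mul0r mulr0 addr0 addr_ge0// subr_ge0.
  rewrite mul1r mulr1.
  suff : f n0 x `^ (p - 1) <= La `^ (p - 1) + La `^ (p - 3) * f n0 x ^+ 2 by lra.
  have [fL|fL] := leP (f n0 x) La.
    rewrite ler_wpDr//; apply: ge0_ler_powR; rewrite ?nnegrE ?(ltW La0)//; lra.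
  have fp : 0 < f n0 x by apply: lt_trans fL.
  have -> : f n0 x `^ (p - 1) = f n0 x `^ (p - 3) * f n0 x ^+ 2.
    by rewrite -powR_mulrn// -gt0_powRD//; congr (_ `^ _); ring.
  rewrite ler_wpDl ?powR_ge0// ler_wpM2r ?sqr_ge0//.
  have -> : p - 3 = - (3 - p) by ring.
  rewrite !powRN lef_pV2 ?posrE ?powR_gt0//.
  by apply: ge0_ler_powR; rewrite ?nnegrE ?(ltW La0) ?(ltW fL)//; lra.
rewrite IntB in main; [|exact: L1_w|exact: L1_w].
have := gap n; move: main IG HLa; clear.
set A := Int _; set B := Int _; set C := Int _; set D := _ * Int _; set F := _ * nsq _; lra.
Qed.


Variables (q c : R) (m : nat).
Hypotheses (hm : (2 <= m)%N) (hq : 0 < q < 1) (hpq : 0 <= p - 2 + q) (c0 : 0 <= c)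
  (hmq : s * p + s * p * (p - 2 + q) / (q - (p - 2 + q)) <= m%:R)
  (hf : forall n, supersolution s p c (f n)).
Hypotheses (step1 : N%:R * (2 - p) <= s * p * (p - 1))
  (step2 : 3 - p <= q * (1 + s * p / N%:R)).

Let sp0 : 0 < s * p.
Proof. by have [s0 s1] := andP hs; have [p1 p2] := andP hp; rewrite mulr_gt0//; lra. Qed.

Let N0 : 0 < N%:R :> R. Proof. by rewrite ltr0n. Qed.

Lemma ball_powE rho tau a : 0 < rho -> 0 < a ->
  ballc / 2 * (rho * a `^ (- (tau / N%:R))) ^+ N = ballc / 2 * rho ^+ N * a `^ (- tau).
Proof.
move=> r0 a0; rewrite exprMn -(powR_mulrn N (powR_ge0 a _)) -powRrM mulrA.
by congr (_ * _ `^ _); field; rewrite gt_eqF.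
Qed.

Lemma power_le_powR a L : 1 <= L -> L < a -> power q a <= 2 * a `^ q.
Proof.
move=> L1' La; have [q0 q1] := andP hq; have a1 : 1 <= a by lra.
have a0 : 0 <= a by lra.
apply: (@le_trans _ _ ((2 * a) `^ q)).
  by rewrite /power; apply: ge0_ler_powR; rewrite ?nnegrE//; lra.
rewrite powRM// ler_wpM2r ?powR_ge0// -[leRHS]powRr1//; apply: ler_powR => //; lra.
Qed.

(** The tails of [(f n)^(p-1)] are uniformly small, so [static_entropy] applies
    with [tau = (p-1)/N] and a small [rho]. By [step1] the power that it
    controls is at least [q], and the factor [rho^(sp)] absorbs the right-hand
    side. *)
Lemma bounded_power : exists n0 : nat, exists M : R, forall n, (n0 <= n)%N ->
  Int (fun x => power q (f n x) * chi x0 1 m x) <= M.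
Proof.
have [p1 p2] := andP hp; have [q0 q1] := andP hq.
have hr1 : 0 < (1:R) <= 1 by rewrite ltr01 lexx.
have [C C0 HC] := static_entropy hN hs hp x0 hr1 hm hq hpq hmq c0.
(* the factor [C rho^(sp)] of the right-hand side becomes [1/4] *)
pose rho := (4 * C)^-1 `^ (s * p)^-1.
have C40 : 0 < (4 * C)^-1 by rewrite invr_gt0 mulr_gt0.
have rho0 : 0 < rho by rewrite powR_gt0.
have rhoE : rho `^ (s * p) = (4 * C)^-1.
  by rewrite -powRrM mulVf ?gt_eqF// powRr1// ltW.
pose k := ballc / 2 * rho ^+ N.
have k0 : 0 < k by rewrite mulr_gt0 ?divr_gt0 ?ballc_gt0 ?exprn_gt0.
have kd : 0 < k * 2^-1 `^ (p - 1) by rewrite mulr_gt0 ?powR_gt0.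
have [n0 [l0 l01 tails]] := uniform_tails kd.
pose L := 2 * l0; have L1' : 1 <= L by rewrite /L; lra.
pose B := Int (inball 1).
exists n0; exists (2 * ((1 + L) `^ q * B) + 1) => n nn.
pose chi1 := chi x0 1 m.
have c1 x : 0 <= chi1 x by exact: chi_ge0.
have chiB x : chi1 x <= inball 1 x.
  rewrite /inball /chi1; case: ltP => xr; first exact: (chi_le1 x0 m hr1).
  by rewrite (chi_supp hm).
have small a : L <= a -> (mu [set y : T | (edist x0 y < 1)%R /\ (a / 2 < f n y)%R] <=
     (ballc / 2 * (rho * a `^ (- ((p - 1) / N%:R))) ^+ N)%:E)%E.
  move=> La; have a0 : 0 < a by lra.
  have a20 : 0 < a / 2 by lra.
  have al : l0 <= a / 2 by move: La; rewrite /L; lra.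
  have mA : measurable [set y : T | edist x0 y < 1 /\ a / 2 < f n y].
    by apply: measurableI; [exact: measurable_eball|exact: measurable_superlevel].
  apply: (le_trans (@chebyshev_set _ _ ((a / 2) `^ (p - 1)) mA (L1_wtail n (a / 2)) _ _ _)).
  - by rewrite powR_gt0.
  - by move=> x; rewrite !mulr_ge0 ?powR_ge0 ?inball_ge0.
  - move=> x /= [xB fx]; rewrite /inball xB fx !mul1r.
    by apply: ge0_ler_powR; rewrite ?nnegrE ?(ltW a20)// ?(ltW fx)//; lra.
  rewrite lee_fin ball_powE// -/k.
  apply: (@le_trans _ _ (((a / 2) `^ (p - 1))^-1 * (k * 2^-1 `^ (p - 1)))).
    by rewrite ler_wpM2l ?invr_ge0 ?powR_ge0//; apply: tails.
  rewrite powRM ?(ltW a0) ?invr_ge0// invfM powRN le_eqVlt; apply/orP; left; apply/eqP.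
  by field; rewrite !gt_eqF ?powR_gt0.
have := HC (f n) (hf n) rho ((p - 1) / N%:R) L rho0 L1' small.
rewrite rhoE -/chi1.
set e1 := p - 2 + q + _; set Qn := Int _ => I1.
have eq1 : q <= e1.
  rewrite /e1 -lerBlDl.
  have -> : (p - 1) / N%:R * (s * p) = s * p * (p - 1) / N%:R by ring.
  have -> : q - (p - 2 + q) = 2 - p by ring.
  by rewrite ler_pdivlMr// mulrC.
have iQ : L1 (fun x => power q (f n x) * chi1 x) := L1_power x0 hr1 hm hq (f2 n) (f0 n).
pose F x := (L < f n x)%R%:R * (f n x `^ e1 * chi1 x).
have F0 x : 0 <= F x by rewrite !mulr_ge0 ?powR_ge0.
have mF : measurable_fun setT F.
  apply: measurable_funM; first by apply: measurable_boolR; exact: measurable_fun_ltr.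
  by apply: measurable_funM; [exact: measurable_powRn|exact: measurable_chi].
have Fy : (\int[mu]_x (F x)%:E < +oo)%E by apply: (le_lt_trans I1); exact: ltry.
have iF : L1 F by exact: ge0_integrable.
have IF : Int F <= C * (4 * C)^-1 * (1 + Qn) by rewrite -lee_fin int_Rfine.
have cE : C * (4 * C)^-1 = 4^-1 by field; rewrite gt_eqF.
rewrite cE in IF.
have le1 x : power q (f n x) * chi1 x <= (1 + L) `^ q * inball 1 x + 2 * F x.
  rewrite /F; case: ltP => Lf.
    rewrite mul1r ler_wpDl ?mulr_ge0 ?powR_ge0 ?inball_ge0// mulrA ler_wpM2r//.
    apply: (le_trans (power_le_powR L1' Lf)); rewrite ler_wpM2l//.
    by apply: ler_powR => //; apply: (le_trans L1'); exact: ltW.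
  rewrite mul0r mulr0 addr0; apply: ler_pM => //; first exact: power_ge0.
  by rewrite /power; apply: ge0_ler_powR; rewrite ?nnegrE ?addr_ge0 ?lerD2l ?(ltW q0) ?(le_trans ler01 L1').
have i1 := L1Z ((1 + L) `^ q) (L1_inball 1); have i2 := L1Z 2 iF.
have := Int_le iQ (L1D i1 i2) le1.
rewrite (IntD i1 i2) (IntZ _ (L1_inball 1)) (IntZ _ iF) -/Qn -/B.
exact: absorb_half.
Qed.

(** Now [\int (1+f)^q] is bounded and [static_entropy] applies with [tau = q/N]
    and a fixed [rho]; by [step2] the power that it controls is at least [1].
    The ball is halved, as the bound just obtained carries a weight vanishing on
    the boundary. *)
Lemma bounded_mass : exists n0 : nat, exists M : R, forall n, (n0 <= n)%N ->
  Int (fun x => f n x * chi x0 2^-1 m x) <= M.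
Proof.
have [p1 p2] := andP hp; have [q0 q1] := andP hq.
have hr1 : 0 < (1:R) <= 1 by rewrite ltr01 lexx.
have hr2 : 0 < (2^-1:R) <= 1 by rewrite invr_gt0 ltr0n/= invf_le1// ler1n.
have [n0 [M' HM']] := bounded_power.
pose M := Num.max M' 1.
have M0 : 0 < M by rewrite lt_max ltr01 orbT.
have HM n : (n0 <= n)%N -> Int (fun x => power q (f n x) * chi x0 1 m x) <= M.
  by move=> nn; rewrite le_max HM'.
have [C C0 HC] := static_entropy hN hs hp x0 hr2 hm hq hpq hmq c0.
pose k := ballc / 2; have k0 : 0 < k by rewrite divr_gt0 ?ballc_gt0.
(* the volume [rho^N] for which Chebyshev's inequality gives half of the ball;
   the factor [2^m] bounds [1 / chi] on the smaller ball *)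
pose kk := 2 ^+ m * M * 2 `^ q / k.
have kk0 : 0 < kk by rewrite divr_gt0// !mulr_gt0 ?powR_gt0 ?exprn_gt0.
pose rho := kk `^ N%:R^-1.
have rho0 : 0 < rho by rewrite powR_gt0.
have rhoE : rho ^+ N = kk.
  by rewrite -powR_mulrn ?(ltW rho0)// -powRrM mulVf ?gt_eqF// powRr1// ltW.
pose chi2 := chi x0 2^-1 m; pose chi1 := chi x0 1 m.
have chi12 x : inball 2^-1 x <= 2 ^+ m * chi1 x.
  rewrite /inball; case: ltP => xr; last by rewrite mulr_ge0 ?chi_ge0 ?exprn_ge0.
  rewrite /chi1 /chi -exprMn -[leLHS](expr1n _ m) lerXn2r ?nnegrE ?mulr_ge0 ?theta_ge0//.
  have : 1 - edist x0 x <= theta x0 1 x by rewrite le_max lexx.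
  by move: xr; lra.
have c2 x : 0 <= chi2 x by exact: chi_ge0.
have chiB x : chi2 x <= inball 2^-1 x.
  rewrite /inball /chi2; case: ltP => xr; first exact: (chi_le1 x0 m hr2).
  by rewrite (chi_supp hm).
have chi21 x : chi2 x <= 2 ^+ m * chi1 x by exact: le_trans (chiB x) (chi12 x).
exists n0.
exists (Int chi2 + C * rho `^ (s * p) * (1 + 2 ^+ m * M)) => n nn.
have iQ1 : L1 (fun x => power q (f n x) * chi1 x) := L1_power x0 hr1 hm hq (f2 n) (f0 n).
have iQ : L1 (fun x => power q (f n x) * chi2 x) := L1_power x0 hr2 hm hq (f2 n) (f0 n).
have small a : 1 <= a -> (mu [set y : T | (edist x0 y < 2^-1)%R /\ (a / 2 < f n y)%R] <=
     (ballc / 2 * (rho * a `^ (- (q / N%:R))) ^+ N)%:E)%E.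
  move=> a1; have a0 : 0 < a by lra.
  have a20 : 0 < a / 2 by lra.
  have mA : measurable [set y : T | edist x0 y < 2^-1 /\ a / 2 < f n y].
    by apply: measurableI; [exact: measurable_eball|exact: measurable_superlevel].
  have i1 := L1Z (2 ^+ m) iQ1.
  apply: (le_trans (@chebyshev_set _ _ ((a / 2) `^ q) mA i1 _ _ _)).
  - by rewrite powR_gt0.
  - move=> x; apply: mulr_ge0 (mulr_ge0 (power_ge0 _ _) (chi_ge0 _ _ _ _)).
    by rewrite exprn_ge0.
  - move=> x /= [xB fx]; rewrite mulrCA.
    have H1 : (a / 2) `^ q <= power q (f n x).
      rewrite /power; apply: ge0_ler_powR; rewrite ?nnegrE ?(ltW a20) ?addr_ge0 ?(ltW q0)//.
      by rewrite ler_wpDl// ltW.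
    have H2 : 1 <= 2 ^+ m * chi1 x by have := chi12 x; rewrite /inball xB.
    by rewrite -[leLHS]mulr1 ler_pM ?powR_ge0.
  rewrite lee_fin ball_powE// rhoE (IntZ _ iQ1).
  apply: (@le_trans _ _ (((a / 2) `^ q)^-1 * (2 ^+ m * M))).
    by rewrite ler_wpM2l ?invr_ge0 ?powR_ge0// ler_wpM2l ?exprn_ge0//; apply: HM.
  have k2 : 2^-1 `^ q = (2 `^ q)^-1 :> R by rewrite -powR_inv1// -powRrM mulN1r powRN.
  rewrite powRM ?(ltW a0) ?invr_ge0// invfM powRN k2 invrK le_eqVlt; apply/orP; left; apply/eqP.
  by rewrite /kk -/k; field; rewrite !gt_eqF ?powR_gt0.
have := HC (f n) (hf n) rho (q / N%:R) 1 rho0 (lexx 1) small.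
rewrite -/chi2; set e1 := p - 2 + q + _; set Qn := Int _ => I1.
have eq1 : 1 <= e1.
  have -> : e1 = p - 2 + q * (1 + s * p / N%:R) by rewrite /e1; ring.
  by rewrite -lerBlDl (_ : 1 - (p - 2) = 3 - p)//; ring.
have QM : Qn <= 2 ^+ m * M.
  apply: (@le_trans _ _ (2 ^+ m * Int (fun x => power q (f n x) * chi1 x))); last first.
    by rewrite ler_wpM2l ?exprn_ge0//; apply: HM.
  rewrite -(IntZ _ iQ1); apply: (Int_le iQ (L1Z _ iQ1)) => x.
  by rewrite mulrCA ler_wpM2l ?power_ge0.
pose F x := (1 < f n x)%R%:R * (f n x `^ e1 * chi2 x).
have F0 x : 0 <= F x by rewrite !mulr_ge0 ?powR_ge0.
have mF : measurable_fun setT F.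
  apply: measurable_funM; first by apply: measurable_boolR; exact: measurable_fun_ltr.
  by apply: measurable_funM; [exact: measurable_powRn|exact: measurable_chi].
have Fy : (\int[mu]_x (F x)%:E < +oo)%E by apply: (le_lt_trans I1); exact: ltry.
have iF : L1 F by exact: ge0_integrable.
have IF : Int F <= C * rho `^ (s * p) * (1 + Qn) by rewrite -lee_fin int_Rfine.
have ic : L1 chi2 := L1_chi x0 hr2 hm.
apply: (@le_trans _ _ (Int chi2 + Int F)).
  rewrite -(IntD ic iF); apply: (Int_le _ (L1D ic iF)).
    exact: sqint_mul (f2 n) (sqint_chi x0 hr2 hm).
  move=> x; rewrite /F; case: ltP => f1.
    rewrite mul1r ler_wpDl// ler_wpM2r// -[leLHS]powRr1//.
    by apply: ler_powR => //; exact: ltW.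
  by rewrite mul0r addr0 ler_piMl.
rewrite lerD2l; apply: (le_trans IF).
by rewrite ler_wpM2l ?mulr_ge0 ?powR_ge0 ?(ltW C0)// lerD2l.
Qed.

End bounded_mass.

(** * Spreading of positivity *)

Lemma ler_pM_ge0r (R : realType) (a a' b b' : R) : 0 <= a -> 0 <= b' -> a <= a' -> b <= b' ->
  a * b <= a' * b'.
Proof.
by move=> a0 b0 aa bb; apply: le_trans (ler_wpM2l a0 bb) (ler_wpM2r b0 aa).
Qed.

Lemma powR_expr (R : realType) (x a : R) i : 0 <= x -> (x ^+ i) `^ a = (x `^ a) ^+ i.
Proof.
move=> x0; rewrite -(powR_mulrn i x0) -(powR_mulrn i (powR_ge0 x a)) -!powRrM.
by rewrite [a * _]mulrC.
Qed.

Section positivity.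
Context {R : realType} {N : nat} (s p : R).
Hypotheses (hN : (0 < N)%N) (hs : 0 < s < 1) (hp : 1 < p < 2).
Local Notation T := (Rn R N).
Local Notation mu := (@lebesgueRn R N).
Local Notation mu2 := (mu \x mu)%E.
Local Notation K := (@kernel R N (s * p)).
Local Notation ballc := (@ballc R N).
Implicit Types (u f g : T -> R) (t h e d a b c sg : R).
Variables (x0 : T) (k : R).
Hypothesis k0 : 0 < k.

Let sp0 : 0 < s * p.
Proof. by have [s0 s1] := andP hs; have [p1 p2] := andP hp; rewrite mulr_gt0//; lra. Qed.

(** The levels of [f] are compared with a cone instead of constants: this
    localizes the sublevel sets around [x0]. *)
Definition tilt f x : R := f x + k * edist x0 x.
Definition gap f sg x : R := Num.max (sg - tilt f x) 0.

Lemma gap_ge0 f sg x : 0 <= gap f sg x.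
Proof. by rewrite le_max lexx orbT. Qed.

Lemma gap_ge f sg x : sg - tilt f x <= gap f sg x.
Proof. by rewrite le_max lexx. Qed.

Lemma gap_in f sg x : tilt f x < sg -> gap f sg x = sg - tilt f x.
Proof. by move=> h; rewrite /gap max_l// subr_ge0 ltW. Qed.

Lemma gap_out f sg x : sg <= tilt f x -> gap f sg x = 0.
Proof. by move=> h; rewrite /gap max_r// subr_le0. Qed.

Lemma measurable_tilt f : measurable_fun setT f -> measurable_fun setT (tilt f).
Proof.
by move=> mf; apply: measurable_funD => //; apply: measurable_funM => //; exact: measurable_edistl.
Qed.

Lemma measurable_gap f sg : measurable_fun setT f -> measurable_fun setT (gap f sg).
Proof.
move=> mf; apply: measurable_max => //; apply: measurable_funB => //; exact: measurable_tilt.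
Qed.

Lemma penergy_sum u f g : measurable_fun setT u -> measurable_fun setT f -> measurable_fun setT g ->
  (forall x y, `|u x - u y| <= `|f x - f y| + `|g x - g y|) ->
  (penergy s p f < +oo)%E -> (penergy s p g < +oo)%E -> (penergy s p u < +oo)%E.
Proof.
move=> mu_ mf mg ufg fy gy; have [p1 p2] := andP hp.
pose F f (z : T * T) := `|f z.1 - f z.2| `^ p * K z.1 z.2.
have mF u' : measurable_fun setT u' -> measurable_fun setT (F u') by exact: measurable_penergy.
have F0 u' z : 0 <= F u' z by exact: penergy_int_ge0.
have FD0 z : 0 <= F f z + F g z by rewrite addr_ge0.
have mFD : measurable_fun setT (fun z => F f z + F g z) by apply: measurable_funD; exact: mF.
apply: (@le_lt_trans _ _ (\int[mu2]_z (4 * (F f z + F g z))%:E)%E).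
  rewrite penergyE; apply: int_le.
  - exact: mF.
  - exact: measurable_funM.
  - exact: F0.
  - move=> z; rewrite /F -mulrDl mulrA ler_wpM2r ?kernel_ge0//.
    apply: (@le_trans _ _ (`| (`|f z.1 - f z.2| + `|g z.1 - g z.2|) | `^ p)).
      rewrite ge0_ler_powR ?nnegrE ?(le_trans ler01 (ltW p1))//.
      by rewrite [leRHS]ger0_norm// addr_ge0.
    by apply: (le_trans (powR_norm_add _ _ hp)); rewrite !normr_id.
rewrite (intZ _ mFD _ FD0)// (intD _ (mF f mf) (mF g mg) (F0 f) (F0 g)).
apply: lte_mul_pinfty => //; exact: lte_add_pinfty fy gy.
Qed.

Lemma max0_lip a b : `|Num.max a 0 - Num.max b 0| <= `|a - b|.
Proof.
rewrite ler_norml; apply/andP; split.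
  by case: (leP a 0) => a0; case: (leP b 0) => b0; have := ler_norm (b - a); have := ler_norm (a - b); rewrite distrC; lra.
by case: (leP a 0) => a0; case: (leP b 0) => b0; have := ler_norm (b - a); have := ler_norm (a - b); rewrite distrC; lra.
Qed.

Variables (c : R) (f : T -> R) (c0 : 0 <= c).
Hypothesis hf : supersolution s p c f.

Let f0 x : 0 <= f x. Proof. by case: hf. Qed.
Let f2 : sqint f. Proof. by case: hf. Qed.
Let mf : measurable_fun setT f. Proof. exact: f2.1. Qed.
Let fy : (penergy s p f < +oo)%E. Proof. by case: hf. Qed.

Lemma tilt_ball sg x : sg <= k -> tilt f x < sg -> edist x0 x < 1.
Proof.
move=> sk; rewrite /tilt => H; have fx := f0 x.
have : k * edist x0 x < k * 1.
  by rewrite mulr1; apply: lt_le_trans sk; apply: le_lt_trans H; rewrite lerDr.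
by rewrite ltr_pM2l.
Qed.

Lemma gap_le sg x : 0 <= sg -> gap f sg x <= sg.
Proof.
move=> sg0; rewrite /gap ge_max sg0 andbT lerBlDr lerDl.
by rewrite addr_ge0// mulr_ge0 ?edist_ge0 ?ltW.
Qed.

(** As [f >= 0], the gap is the positive part of [l - f] where [l] is the
    positive part of [sg - k |x - x0|], a Lipschitz function of compact
    support. *)
Lemma admissible_gap sg : 0 <= sg <= k -> admissible s p (gap f sg).
Proof.
move=> /andP[sg0 sk]; have mg := measurable_gap sg mf.
pose l x := Num.max (sg - k * edist x0 x) 0.
have ml : measurable_fun setT l.
  apply: measurable_max => //; apply: measurable_funB => //.
  by apply: measurable_funM => //; exact: measurable_edistl.
split.
  have i1 := L1Z (k ^+ 2) (L1_inball x0 1).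
  split => //; apply: (@le_lt_trans _ _ (\int[mu]_x (k ^+ 2 * inball x0 1 x)%:E)%E); last first.
    by rewrite -int_Rfine ?ltry.
  have [/measurable_EFinP mi _] := integrableP _ _ _ i1.
  apply: int_le => // [|x|x]; [exact: measurable_funX|exact: sqr_ge0|].
  rewrite /inball; case: ltP => xr.
    by rewrite mulr1 lerXn2r ?nnegrE ?gap_ge0 ?(ltW k0)// (le_trans (gap_le x sg0)).
  rewrite mulr0 gap_out ?expr0n// leNgt; apply/negP => /(tilt_ball sk).
  by rewrite ltNge xr.
apply: (penergy_sum mg ml mf _ _ fy).
- move=> x y.
  have E z : gap f sg z = Num.max (l z - f z) 0.
    rewrite /gap /l /tilt; have := f0 z; have := edist_ge0 x0 z.
    case: (leP (sg - k * edist x0 z) 0) => h e0 fz.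
      by rewrite !max_r//; lra.
    by congr (Num.max _ 0); ring.
  rewrite !E; apply: (le_trans (max0_lip _ _)).
  have -> : l x - f x - (l y - f y) = (l x - l y) - (f x - f y) by ring.
  exact: ler_normB.
- apply: (@penergy_lipschitz R N s p hs hp l x0 1 k ltr01 (ltW k0) ml) => [x y|x|x xr].
  + apply: (le_trans (max0_lip _ _)).
    have -> : sg - k * edist x0 x - (sg - k * edist x0 y) = k * (edist x0 y - edist x0 x) by ring.
    rewrite normrM (gtr0_norm k0) ler_wpM2l ?(ltW k0)// ler_norml; apply/andP; split.
      by have := edist_triangle y x0 x; rewrite [edist y x]edistC; lra.
    by have := edist_triangle x x0 y; lra.
  + rewrite le_max lexx orbT/= ge_max (ltW k0) andbT.
    by rewrite lerBlDr (le_trans sk)// lerDl mulr_ge0 ?edist_ge0 ?ltW.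
  + rewrite /l max_r// subr_le0 (le_trans sk)// -[leLHS]mulr1.
    by rewrite ler_wpM2l// ltW.
Qed.

(** What the points above the level contribute to raising the points below. *)
Definition level_gain sg (z : T * T) : R :=
  if [&& tilt f z.1 < sg, sg <= tilt f z.2 & f z.1 < f z.2]
  then (f z.2 - f z.1) `^ (p - 1) * gap f sg z.1 * K z.1 z.2 else 0.

Definition level_error sg (z : T * T) : R :=
  k `^ p * (tilt f z.1 < sg)%R%:R * tamed s p z.

Lemma level_gain_ge0 sg z : 0 <= level_gain sg z.
Proof.
by rewrite /level_gain; case: ifP => // _; rewrite !mulr_ge0 ?powR_ge0 ?gap_ge0 ?kernel_ge0.
Qed.

Lemma level_error_ge0 sg z : 0 <= level_error sg z.
Proof. by rewrite !mulr_ge0 ?powR_ge0 ?tamed_ge0. Qed.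

Lemma measurable_level_gain sg : measurable_fun setT (level_gain sg).
Proof.
have mt := measurable_tilt mf; have mg := measurable_gap sg mf.
have mf1 := measurable_fst_fun mf; have mf2 := measurable_snd_fun mf.
apply: measurable_fun_ifT => //.
  apply: measurable_and; first by apply: measurable_fun_ltr => //; exact: measurable_fst_fun mt.
  apply: measurable_and; first by apply: measurable_fun_ler => //; exact: measurable_snd_fun mt.
  exact: measurable_fun_ltr.
apply: measurable_funM; last exact: measurable_kernel.
apply: measurable_funM; last exact: measurable_fst_fun mg.
by apply: measurable_powRn; exact: measurable_funB.
Qed.

Lemma measurable_level_error sg : measurable_fun setT (level_error sg).
Proof.
apply: measurable_funM; last exact: measurable_tamed.
apply: measurable_funM => //; apply: measurable_boolR; apply: measurable_fun_ltr => //.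
exact: measurable_fst_fun (measurable_tilt mf).
Qed.

(** With [f x <= f y]: if [y] is above the level the pairing is exactly minus
    the gain. If it is below, the gap at [y] is less than the gap at [x] by the
    difference [D] of the values up to [k |x - y|], so the pairing is positive
    only if [D < k |x - y|] and is then of the order of [tamed]. *)
Lemma level_pair sg : 0 <= sg <= k -> forall z,
  pairing s p f (gap f sg) z + level_gain sg z + level_gain sg (swap z) <=
  level_error sg z + level_error sg (swap z).
Proof.
move=> /andP[sg0 sk]; have [p1 p2] := andP hp.
have main z : f z.1 <= f z.2 ->
    pairing s p f (gap f sg) z + level_gain sg z + level_gain sg (swap z) <=
    level_error sg z + level_error sg (swap z).
  case: z => x y /= fxy.
  have -> : level_gain sg (swap (x, y)) = 0.
    by rewrite /level_gain /swap/= [f y < f x]ltNge fxy/= !andbF.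
  rewrite addr0; set E := level_error sg (x, y).
  have E0 : 0 <= E by exact: level_error_ge0.
  have E0' : 0 <= level_error sg (swap (x, y)) by exact: level_error_ge0.
  rewrite /pairing/= -[f x - f y]opprB PhiN Phi_pos// ?subr_ge0//.
  set D := f y - f x; have D0 : 0 <= D by rewrite subr_ge0.
  have K0 := kernel_ge0 (s * p) x y.
  have [gy|gy] := leP sg (tilt f y).
    apply: (@le_trans _ _ 0); last by rewrite addr_ge0.
    rewrite /level_gain/= gy/=; case: ifP => [_|_].
      by rewrite (gap_out gy) -/D le_eqVlt; apply/orP; left; apply/eqP; ring.
    rewrite addr0 (gap_out gy) subr0 !mulNr oppr_le0.
    by rewrite !mulr_ge0 ?powR_ge0 ?gap_ge0.
  have -> : level_gain sg (x, y) = 0.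
    by rewrite /level_gain/= [sg <= _]leNgt gy/= !andbF.
  rewrite addr0; apply: (@le_trans _ _ (level_error sg (swap (x, y)))); last by rewrite lerDr.
  rewrite /level_error /swap/= gy mulr1.
  have gapy := gap_in gy.
  have gxy : gap f sg y - gap f sg x <= k * edist x y - D.
    have := gap_ge f sg x; rewrite gapy /tilt /D.
    have := edist_triangle y x0 x; rewrite [edist y x]edistC => /(ler_wpM2l (ltW k0)).
    rewrite mulrDr; lra.
  have -> : - D `^ (p - 1) * (gap f sg x - gap f sg y) * K x y =
    D `^ (p - 1) * (gap f sg y - gap f sg x) * K x y by ring.
  have [kD|kD] := leP (k * edist x y) D.
    apply: (@le_trans _ _ 0); last by rewrite mulr_ge0 ?powR_ge0 ?tamed_ge0.
    rewrite mulr_le0_ge0// mulr_ge0_le0 ?powR_ge0// (le_trans gxy)//.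
    by rewrite subr_le0.
  rewrite /tamed/= [edist y x]edistC [kernel _ y x]kernelC.
  have pp : p = (p - 1) + 1 by ring.
  case: (ltP (edist x y) 1) => dxy; rewrite /= ?mulr1 ?mulr0 ?addr0 ?add0r.
    rewrite mulrA ler_wpM2r// -powRM ?edist_ge0 ?(ltW k0)//.
    have kd0 : 0 < k * edist x y by exact: le_lt_trans kD.
    have -> : (k * edist x y) `^ p = (k * edist x y) `^ (p - 1) * (k * edist x y).
      by rewrite {1}pp gt0_powRD// powRr1// ltW.
    apply: ler_pM_ge0r; rewrite ?powR_ge0 ?(ltW kd0) ?(ltW k0)//.
      by apply: ge0_ler_powR; rewrite ?nnegrE ?(ltW kd0) ?(ltW kD)//; lra.
    by apply: (le_trans gxy); rewrite lerBlDr lerDl.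
  rewrite ler_wpM2r//.
  have gyk : gap f sg y <= k by apply: le_trans (gap_le _ sg0) sk.
  have Dk : D <= k.
    have : f y <= tilt f y by rewrite lerDl mulr_ge0 ?edist_ge0 ?ltW.
    by have := f0 x; rewrite /D; lra.
  have -> : k `^ p = k `^ (p - 1) * k by rewrite {1}pp gt0_powRD// powRr1// ltW.
  apply: ler_pM_ge0r; rewrite ?powR_ge0 ?(ltW k0)//.
    by apply: ge0_ler_powR; rewrite ?nnegrE ?(ltW k0)//; lra.
  by apply: le_trans gyk; rewrite lerBlDr lerDl gap_ge0.
move=> z; have [fz|/ltW fz] := leP (f z.1) (f z.2); first exact: main.
have := main (swap z) fz.
have -> : pairing s p f (gap f sg) (swap z) = pairing s p f (gap f sg) z.
  by rewrite /pairing /swap/= (kernelC _ z.2 z.1) -[f z.2 - f z.1]opprB PhiN; ring.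
have -> : swap (swap z) = z by case: z {fz}.
move: (pairing _ _ _ _ _) (level_gain sg z) (level_gain sg (swap z)).
move: (level_error sg z) (level_error sg (swap z)); move=> A B C D E.
by rewrite -!addrA [E + D]addrC [B + A]addrC.
Qed.


Variable CT : R.
Hypotheses (CT0 : 0 < CT) (hCT : forall x : T, (\int[mu]_y (tamed s p (x, y))%:E <= CT%:E)%E).

Definition levelC : R := k `^ p * CT + c * k ^+ 2.

Lemma levelC_gt0 : 0 < levelC.
Proof.
by apply: ltr_wpDr; [rewrite mulr_ge0 ?sqr_ge0|rewrite mulr_gt0// powR_gt0].
Qed.

Definition sub sg := [set x | tilt f x < sg].

Lemma measurable_sub sg : measurable (sub sg).
Proof. by apply: measurable_boolset; apply: measurable_fun_ltr => //; exact: measurable_tilt. Qed.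

(** The level inequality: all the errors come from points below the level. *)
Lemma level_step sg (A : set T) v b : 0 <= sg <= k -> measurable A -> 0 < v ->
  (forall x, A x -> (v%:E <= \int[mu]_y (level_gain sg (x, y))%:E)%E) ->
  (mu (sub sg) <= b%:E)%E -> (mu A <= (levelC * b / v)%:E)%E.
Proof.
move=> hsg mA v0 Av Sb; have [sg0 sk] := andP hsg.
have mG := measurable_level_gain sg; have mE := measurable_level_error sg.
have [f0' f2' fy' sup] := hf.
have S1 := sup _ _ _ (admissible_gap hsg) (gap_ge0 f sg) mG mE
  (level_gain_ge0 sg) (level_error_ge0 sg) (level_pair hsg).
have mS : measurable_fun setT (fun x => tilt f x < sg).
  by apply: measurable_fun_ltr => //; exact: measurable_tilt.
have kp : 0 <= k `^ p by exact: powR_ge0.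
have I1 : (\int[mu2]_z (level_error sg z)%:E <= (k `^ p * CT)%:E * mu (sub sg))%E.
  exact: (int2_tamed hCT kp mS mE (level_error_ge0 sg) (fun z => lexx _)).
have I2 : ((Int (fun x => f x * gap f sg x))%:E <= (k ^+ 2)%:E * mu (sub sg))%E.
  have iL : L1 (fun x => f x * gap f sg x).
    by exact: sqint_mul f2 (admissible_gap hsg).1.
  have [/measurable_EFinP mi _] := integrableP _ _ _ iL.
  rewrite int_Rfine//.
  have <- : (\int[mu]_y (k ^+ 2 * \1_(sub sg) y)%:E = (k ^+ 2)%:E * mu (sub sg))%E.
    rewrite intZ ?sqr_ge0//; last by apply: measurable_indic; exact: measurable_sub.
    by rewrite integral_indic ?setIT//; exact: measurable_sub.
  apply: int_le => [//| |x|x].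
  - by apply: measurable_funM => //; apply: measurable_indic; exact: measurable_sub.
  - by rewrite mulr_ge0 ?gap_ge0.
  - rewrite (@indicE_bool R N _ (fun x => tilt f x < sg))//; case: ltP => tx; last first.
      by rewrite gap_out// !mulr0.
    rewrite mulr1 expr2 ler_pM ?gap_ge0//.
      apply: le_trans (le_trans (ltW tx) sk).
      by rewrite lerDl mulr_ge0 ?edist_ge0 ?ltW.
    exact: le_trans (gap_le x sg0) sk.
have I3 : (\int[mu2]_z (level_gain sg z)%:E <= levelC%:E * mu (sub sg))%E.
  apply: (le_trans S1); rewrite /levelC EFinD ge0_muleDl; last 2 first.
  - by rewrite lee_fin mulr_ge0// ltW.
  - by rewrite lee_fin mulr_ge0 ?sqr_ge0.
  apply: leeD => //; rewrite !EFinM -muleA; apply: lee_wpmul2l => //.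
have I4 : (v%:E * mu A <= \int[mu2]_z (level_gain sg z)%:E)%E.
  have <- : (\int[mu]_y (v * \1_A y)%:E = v%:E * mu A)%E.
    by rewrite intZ ?(ltW v0)// integral_indic// setIT.
  rewrite (int2E mG (level_gain_ge0 sg)); apply: ge0_le_integral => //.
  - by move=> x _; rewrite lee_fin mulr_ge0// ltW.
  - by apply/measurable_EFinP; apply: measurable_funM => //; exact: measurable_indic.
  - exact: measurable_int_section mG (level_gain_ge0 sg).
  - move=> x _; rewrite indicE; have [xA|xA] := boolP (x \in A).
      by rewrite mulr1; apply: Av; rewrite inE in xA.
    by rewrite mulr0; apply: int_ge0 => y; exact: level_gain_ge0.
have I5 : (v%:E * mu A <= (levelC * b)%:E)%E.
  apply: (le_trans I4); apply: (le_trans I3); rewrite EFinM.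
  by apply: lee_wpmul2l => //; rewrite lee_fin ltW// levelC_gt0.
by rewrite mulrC EFinM lee_pdivlMl.
Qed.

(** Local gain: the points below the higher level fill less than half of the
    ball of radius [rho], so a point below the lower level sees the other half
    at a height at least [(sg - sg') / 2] above it. *)
Lemma level_local sg sg' rho : 0 <= sg' < sg -> sg <= k -> 0 < rho ->
  k * rho <= (sg - sg') / 2 -> (mu (sub sg) <= (ballc / 2 * rho ^+ N)%:E)%E ->
  (mu (sub sg') <= (levelC * rho ^+ N *
     (((sg - sg') / 2) `^ p)^-1 * rho `^ (s * p))%:E)%E.
Proof.
move=> /andP[sg'0 sgs] sk rho0 krho Sb; have [p1 p2] := andP hp.
have hsg : 0 <= sg <= k by rewrite sk andbT; lra.
have d0 : 0 < (sg - sg') / 2 by lra.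
have dE : sg - sg' = (sg - sg') / 2 + (sg - sg') / 2 by lra.
move: krho d0 dE; set d := (sg - sg') / 2; clearbody d => krho d0 dE.
pose w := d `^ (p - 1) * d * (rho `^ (N%:R + s * p))^-1.
have w0 : 0 < w.
  by apply: mulr_gt0 (mulr_gt0 (powR_gt0 _ d0) d0) _; rewrite invr_gt0 powR_gt0.
have b0 : 0 < ballc / 2 by rewrite divr_gt0 ?ballc_gt0.
have rN : 0 < rho ^+ N by rewrite exprn_gt0.
pose v := w * (ballc / 2 * rho ^+ N).
have v0 : 0 < v by exact: mulr_gt0 w0 (mulr_gt0 b0 rN).
have := @level_step sg (sub sg') v _ hsg (measurable_sub sg') v0 _ Sb.
move=> H; apply: le_trans (H _) _ => [x Sx|].
  pose A := eball x rho `&` ~` sub sg.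
  have mA : measurable A.
    by apply: measurableI; [exact: measurable_eball|apply: measurableC; exact: measurable_sub].
  have muA : ((ballc / 2 * rho ^+ N)%:E <= mu A)%E.
    apply: (ball_remainder hN rho0 mA (measurable_sub sg) (x := x) _ Sb) => y xy.
    by have [ty|ty] := pselect (sub sg y); [right|left].
  apply: (@le_trans _ _ (w%:E * mu A)%E).
    by rewrite /v EFinM; apply: lee_wpmul2l => //; rewrite lee_fin ltW.
  have <- : (\int[mu]_y (w * \1_A y)%:E = w%:E * mu A)%E.
    by rewrite intZ ?(ltW w0)// integral_indic// setIT.
  apply: int_le => [||y|y].
  - by apply: measurable_funM => //; exact: measurable_indic.
  - exact: measurable_section (measurable_level_gain sg).
  - by rewrite mulr_ge0// ltW.
  - rewrite indicE; have [yA|yA] := boolP (y \in A); last by rewrite mulr0; exact: level_gain_ge0.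
    rewrite mulr1; move: yA; rewrite inE => -[xy /negP]; rewrite -leNgt => ty.
    have xy' : edist x y < rho by [].
    have tx : tilt f x < sg' by [].
    have Dd : d <= f y - f x.
      have := ler_wpM2l (ltW k0) (edist_triangle x x0 y).
      have := ler_wpM2l (ltW k0) (ltW xy').
      by move: tx ty krho; rewrite /tilt mulrDr; lra.
    have fxy : f x < f y by rewrite -subr_gt0; exact: lt_le_trans Dd.
    rewrite /level_gain/= ty fxy (lt_trans tx sgs)/=.
    have exy : 0 < edist x y.
      by apply: edist_gt0; apply: contraTneq fxy => ->; rewrite ltxx.
    rewrite /w; apply: ler_pM; rewrite ?mulr_ge0 ?invr_ge0 ?powR_ge0 ?(ltW d0)//; last first.
      by apply: kernel_ge sp0 _; rewrite exy ltW.
    apply: ler_pM; rewrite ?powR_ge0 ?(ltW d0)//.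
      by apply: ge0_ler_powR; rewrite ?nnegrE ?(ltW d0) ?subr_ge0 ?(ltW fxy)//; lra.
    by rewrite gap_in ?(lt_trans tx sgs)//; move: tx; lra.
rewrite lee_fin le_eqVlt; apply/orP; left; apply/eqP.
rewrite /v /w.
have -> : rho `^ (s * p) = rho `^ (N%:R + s * p) * (rho ^+ N)^-1.
  by rewrite -powR_mulrn ?(ltW rho0)// -powRN -gt0_powRD//; congr (_ `^ _); ring.
have -> : d `^ p = d `^ (p - 1) * d.
  by rewrite -{3}(powRr1 (ltW d0)) -gt0_powRD// subrK.
have D0 : 0 < d `^ (p - 1) by rewrite powR_gt0.
have P0 : 0 < rho `^ (N%:R + s * p) by rewrite powR_gt0.
by field; rewrite !gt_eqF// ballc_gt0.
Qed.


Lemma Int_le_integral (F G : T -> R) : L1 F -> measurable_fun setT G ->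
  (forall x, 0 <= G x) -> (forall x, F x <= G x) -> ((Int F)%:E <= \int[mu]_x (G x)%:E)%E.
Proof.
move=> iF mG G0 FG; have [Gy|] := ltP (\int[mu]_x (G x)%:E)%E +oo%E; last first.
  by apply: le_trans; exact: leey.
have iG : L1 G by exact: ge0_integrable.
by rewrite -int_Rfine// lee_fin; exact: Int_le.
Qed.

Definition farc r : R := 2^-1 `^ (p - 1) * (k / 4) * ((r + 1) `^ (N%:R + s * p))^-1.

(** Global gain: the integral of [f^(p-1)] over a ball, possibly far away, pulls
    up all the points below the level [3k/4]. Points of the ball where [f <= 2k]
    are discarded. *)
Lemma level_global r v : 0 < r -> 0 < v ->
  v <= farc r * (Int (fun x => inball x0 r x * f x `^ (p - 1)) -
                (2 * k) `^ (p - 1) * Int (inball x0 r)) ->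
  (mu (sub (3 / 4 * k)) <= (levelC * 2 ^+ N / v)%:E)%E.
Proof.
move=> r0 v0 Hv; have [p1 p2] := andP hp.
have r1 : 0 < r + 1 by lra.
have hk : 0 <= k <= k by rewrite lexx (ltW k0).
have B1 : (mu (sub k) <= (2 ^+ N)%:E)%E.
  apply: le_trans (_ : mu (eball x0 1) <= _)%E; last by have := @eball_le R N x0 1 ltr01; rewrite mulr1.
  apply: le_measure; rewrite ?inE; [exact: measurable_sub|exact: measurable_eball|].
  by move=> x; exact: tilt_ball (lexx k).
apply: (level_step hk (measurable_sub _) v0 _ B1) => x tx.
have tx' : tilt f x < 3 / 4 * k by [].
have iB := L1_inball x0 r.
have mF : measurable_fun setT (fun x => inball x0 r x * f x `^ (p - 1)).
  by apply: measurable_funM; [exact: measurable_inball|exact: measurable_powRn].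
have iF : L1 (fun x => inball x0 r x * f x `^ (p - 1)).
  apply: (@L1_quadratic R N x0 _ f r 1 1 mF f2) => y.
  rewrite ger0_norm ?mulr_ge0 ?powR_ge0 ?inball_ge0// !mul1r.
  rewrite /inball; case: ltP => _; rewrite ?mul1r ?mul0r ?add0r ?sqr_ge0//.
  exact: powR_le_quadratic.
have iB2 := L1Z ((2 * k) `^ (p - 1)) iB.
have iD := L1B iF iB2.
have iG := L1Z (farc r) iD.
apply: (@le_trans _ _ (Int (fun y => farc r * (inball x0 r y * f y `^ (p - 1) -
    (2 * k) `^ (p - 1) * inball x0 r y)))%:E).
  by rewrite lee_fin (IntZ _ iD) (IntB iF iB2) (IntZ _ iB).
apply: (Int_le_integral iG) => [|y|y].
- exact: measurable_section (measurable_level_gain k).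
- exact: level_gain_ge0.
have f1 : 0 < farc r.
  rewrite /farc; apply: mulr_gt0; last by rewrite invr_gt0 powR_gt0.
  by apply: mulr_gt0; [rewrite powR_gt0|exact: divr_gt0].
rewrite /inball; case: ltP => yr; last first.
  by rewrite mul0r mulr0 subr0 mulr0 level_gain_ge0.
rewrite mul1r mulr1.
have [fyk|fyk] := leP (f y) (2 * k).
  apply: (@le_trans _ _ 0); last exact: level_gain_ge0.
  rewrite mulr_ge0_le0 ?(ltW f1)// subr_le0.
  by apply: ge0_ler_powR; rewrite ?nnegrE//; lra.
have txk : tilt f x < k by lra.
have fxk : f x < k.
  by apply: le_lt_trans txk; rewrite lerDl mulr_ge0 ?edist_ge0 ?ltW.
have tyk : k <= tilt f y.
  apply: (@le_trans _ _ (f y)); first by lra.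
  by rewrite lerDl mulr_ge0 ?edist_ge0 ?ltW.
have fxy : f x < f y by lra.
apply: (@le_trans _ _ (farc r * f y `^ (p - 1))).
  by rewrite ler_wpM2l ?(ltW f1)// lerBlDr lerDl powR_ge0.
rewrite /level_gain/= txk tyk fxy /=.
have exy : 0 < edist x y.
  by apply: edist_gt0; apply: contraTneq fxy => ->; rewrite ltxx.
have exr : edist x y <= r + 1.
  have := edist_triangle x0 x y; rewrite [edist x x0]edistC.
  by have := tilt_ball (lexx k) txk; lra.
have gx : k / 4 <= gap f k x by rewrite gap_in//; lra.
have Kxy : ((r + 1) `^ (N%:R + s * p))^-1 <= K x y.
  by apply: kernel_ge sp0 _; rewrite exy.
have Dp : 2^-1 `^ (p - 1) * f y `^ (p - 1) <= (f y - f x) `^ (p - 1).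
  rewrite -powRM ?invr_ge0//; apply: ge0_ler_powR; rewrite ?nnegrE ?subr_ge0 ?(ltW fxy)//.
  - by lra.
  - by rewrite mulr_ge0 ?invr_ge0.
  - by lra.
have -> : farc r * f y `^ (p - 1) =
  (2^-1 `^ (p - 1) * f y `^ (p - 1)) * (k / 4) * ((r + 1) `^ (N%:R + s * p))^-1.
  by rewrite /farc; ring.
have k40 : 0 <= k / 4 by lra.
apply: ler_pM Kxy; last 1 first.
- by apply: ler_pM Dp gx; rewrite // mulr_ge0 ?powR_ge0.
- by rewrite mulr_ge0// mulr_ge0 ?powR_ge0.
- by rewrite invr_ge0 powR_ge0.
Qed.

Variables (rho0 lam : R).
Hypotheses (rho00 : 0 < rho0) (rho16 : rho0 <= 16^-1) (lam0 : 0 < lam) (lam12 : lam <= 2^-1)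
  (lam_sp : 2 `^ p * lam `^ (s * p) <= 1)
  (small_rho : levelC * rho0 `^ (s * p) <= ballc / 2 * lam ^+ N * (k / 16) `^ p).
Hypothesis start : (mu (sub (3 / 4 * k)) <= (ballc / 2 * rho0 ^+ N)%:E)%E.

Let lam_pow i : rho0 * lam ^+ i <= 16^-1 * 2^-1 ^+ i.
Proof. by rewrite ler_pM ?exprn_ge0 ?(ltW lam0) ?(ltW rho00)// lerXn2r ?nnegrE ?invr_ge0// ltW. Qed.

(** De Giorgi iteration. The levels decrease from [3k/4] to [k/2] by halving
    steps, which costs [2^(ip)] in [level_local]; the radii decrease
    geometrically and gain [rho^(sp)], which compensates this by [lam_sp]. *)
Lemma level_iteration i :
  (mu (sub (k / 2 + k / 4 * 2^-1 ^+ i)) <= (ballc / 2 * (rho0 * lam ^+ i) ^+ N)%:E)%E.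
Proof.
have [p1 p2] := andP hp; have b0 := @ballc_gt0 R N hN.
elim: i => [|i IH].
  rewrite !expr0 !mulr1 (_ : k / 2 + k / 4 = 3 / 4 * k); last by field.
  exact: start.
set sg := k / 2 + k / 4 * 2^-1 ^+ i in IH; set sg' := k / 2 + k / 4 * 2^-1 ^+ i.+1.
set rho := rho0 * lam ^+ i in IH.
have hi : 0 < 2^-1 ^+ i :> R by rewrite exprn_gt0.
have hi1 : 2^-1 ^+ i <= 1 :> R by rewrite exprn_ile1// invf_le1// ler1n.
have li : 0 < lam ^+ i by rewrite exprn_gt0.
have rho_gt0 : 0 < rho by rewrite mulr_gt0.
have E : (sg - sg') / 2 = k / 16 * 2^-1 ^+ i by rewrite /sg /sg' exprS; field.
have kh : 0 < k * 2^-1 ^+ i by rewrite mulr_gt0.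
have kh1 : k * 2^-1 ^+ i <= k by rewrite ler_piMr// ltW.
have ss : 0 <= sg' < sg.
  have -> : sg' = k / 2 + k / 8 * 2^-1 ^+ i by rewrite /sg' exprS; field.
  by rewrite /sg; lra.
have sk : sg <= k by rewrite /sg; lra.
have krho : k * rho <= (sg - sg') / 2.
  by rewrite E -mulrA ler_pM2l//; exact: lam_pow.
have step := level_local ss sk rho_gt0 krho IH.
apply: (le_trans step).
rewrite lee_fin E.
have -> : rho0 * lam ^+ i.+1 = rho * lam by rewrite /rho exprSr mulrA.
have -> : (rho * lam) ^+ N = rho ^+ N * lam ^+ N by rewrite exprMn.
have -> : (k / 16 * 2^-1 ^+ i) `^ p = (k / 16) `^ p * (2 `^ p ^+ i)^-1.
  rewrite powRM ?(ltW hi)//; last by lra.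
  rewrite powR_expr ?invr_ge0// -exprVn; congr (_ * _ ^+ _).
  by rewrite -powR_inv1// -powRrM mulN1r powRN.
have -> : rho `^ (s * p) = rho0 `^ (s * p) * lam `^ (s * p) ^+ i.
  by rewrite (powRM _ (ltW rho00) (ltW li)) (powR_expr _ _ (ltW lam0)).
have q2 : (2 `^ p * lam `^ (s * p)) ^+ i <= 1 by rewrite exprn_ile1// mulr_ge0 ?powR_ge0.
have k16 : 0 < (k / 16) `^ p by rewrite powR_gt0// divr_gt0.
have P2 : 0 < (2 `^ p) ^+ i :> R by rewrite exprn_gt0// powR_gt0.
have rN : 0 <= rho ^+ N by rewrite exprn_ge0// ltW.
have -> : levelC * rho ^+ N / ((k / 16) `^ p / 2 `^ p ^+ i) * (rho0 `^ (s * p) * lam `^ (s * p) ^+ i)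
  = rho ^+ N * (levelC * rho0 `^ (s * p) / (k / 16) `^ p) * (2 `^ p * lam `^ (s * p)) ^+ i.
  have -> : (2 `^ p * lam `^ (s * p)) ^+ i = (2 `^ p) ^+ i * (lam `^ (s * p)) ^+ i by rewrite exprMn.
  move: P2 k16; move: (2 `^ p ^+ i) (lam `^ (s * p) ^+ i) ((k / 16) `^ p).
  move: (rho ^+ N) (rho0 `^ (s * p)) => E' F A B D A0 D0.
  by field; rewrite !gt_eqF.
have -> : ballc / 2 * (rho ^+ N * lam ^+ N) = rho ^+ N * (ballc / 2 * lam ^+ N) * 1 by ring.
have H : levelC * rho0 `^ (s * p) / (k / 16) `^ p <= ballc / 2 * lam ^+ N.
  by rewrite ler_pdivrMr.
have H0 : 0 <= levelC * rho0 `^ (s * p) / (k / 16) `^ p.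
  by rewrite divr_ge0 ?(ltW k16)// mulr_ge0 ?powR_ge0// ltW// levelC_gt0.
apply: ler_pM => //; first exact: mulr_ge0.
  by rewrite exprn_ge0// mulr_ge0 ?powR_ge0.
exact: ler_wpM2l.
Qed.

Lemma sub_null : mu (sub (k / 2)) = 0%E.
Proof.
have b0 := @ballc_gt0 R N hN.
apply/eqP; rewrite eq_le measure_ge0 andbT; apply/lee_addgt0Pr => d d0; rewrite add0e.
pose i := (Num.bound (ballc / 2 / d)).
have hi : ballc / 2 / d < i%:R.
  by rewrite /i; apply: archi_boundP; rewrite !divr_ge0 ?(ltW b0) ?(ltW d0).
apply: (@le_trans _ _ (mu (sub (k / 2 + k / 4 * 2^-1 ^+ i)))).
  apply: le_measure; rewrite ?inE; [exact: measurable_sub|exact: measurable_sub|].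
  move=> x; rewrite /sub/= => /lt_le_trans; apply; rewrite lerDl.
  by rewrite mulr_ge0 ?exprn_ge0 ?divr_ge0 ?invr_ge0// ltW.
apply: (le_trans (level_iteration i)); rewrite lee_fin.
have li : 0 < lam ^+ i by rewrite exprn_gt0.
have hi2 : 2^-1 ^+ i <= 1 :> R by rewrite exprn_ile1// invf_le1// ler1n.
have rl : rho0 * lam ^+ i <= 2^-1 ^+ i.
  by apply: le_trans (lam_pow i) _; rewrite ler_piMl ?exprn_ge0// invf_le1// ler1n.
have r0 : 0 <= rho0 * lam ^+ i by rewrite mulr_ge0 ?(ltW rho00) ?(ltW li).
have r1 : (rho0 * lam ^+ i) ^+ N <= 2^-1 ^+ i.
  apply: le_trans rl; case: N hN => [//|N' _]; rewrite exprS ler_piMr// exprn_ile1//.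
  by apply: le_trans hi2; apply: le_trans (lam_pow i) _; rewrite ler_piMl ?exprn_ge0// invf_le1// ler1n.
apply: (@le_trans _ _ (ballc / 2 * 2^-1 ^+ i)).
  by rewrite ler_wpM2l// divr_ge0// ltW.
rewrite exprVn ler_pdivrMr ?exprn_gt0//.
apply: (@le_trans _ _ (d * i%:R)).
  by rewrite [d * _]mulrC -ler_pdivrMr// ltW.
rewrite ler_wpM2l ?(ltW d0)// -natrX ler_nat ltnW// ltn_expl//.
Qed.

End positivity.

Section local_positivity.
Context {R : realType} {N : nat} (s p : R).
Hypotheses (hN : (0 < N)%N) (hs : 0 < s < 1) (hp : 1 < p < 2).
Local Notation T := (Rn R N).
Local Notation mu := (@lebesgueRn R N).
Local Notation ballc := (@ballc R N).

(** A supersolution with much local mass is large near the center of the ball,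
    at a level that is as high as desired: [level_global] starts the
    iteration. *)
Lemma local_positivity (x0 : T) (k r c : R) : 0 < k -> 0 < r -> 0 <= c ->
  exists Q : R, forall f, supersolution s p c f ->
  Q <= Int (fun x => inball x0 r x * f x `^ (p - 1)) ->
  {ae mu, forall x, edist x0 x < 4^-1 -> k / 4 <= f x}.
Proof.
move=> k0 r0 c0; have [p1 p2] := andP hp; have [s0 s1] := andP hs.
have sp0 : 0 < s * p by rewrite mulr_gt0//; lra.
have b0 := @ballc_gt0 R N hN.
have [CT CT0 HCT] := @tamed_bound R N s p hs hp.
(* then [lam^(sp) = 2^(-p)] *)
pose lam : R := 2^-1 `^ s^-1; have lam0 : 0 < lam by rewrite powR_gt0.
have lam12 : lam <= 2^-1.
  rewrite -[leRHS]powRr1 ?invr_ge0// /lam ger_powR//; last by rewrite invf_ge1 ?ltW.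
  by rewrite invr_gt0 ltr0n/= invf_le1// ler1n.
have lam_sp : 2 `^ p * lam `^ (s * p) <= 1.
  rewrite /lam -powRrM mulrA mulVf ?gt_eqF// mul1r -powRM ?invr_ge0//.
  by rewrite divff ?powR1.
pose C1 := levelC p k c CT; have C10 : 0 < C1 by exact: levelC_gt0.
pose y := ballc / 2 * lam ^+ N * (k / 16) `^ p / C1.
have k16 : 0 < k / 16 by rewrite divr_gt0.
have y0 : 0 < y by rewrite divr_gt0// mulr_gt0 ?powR_gt0// mulr_gt0 ?exprn_gt0// divr_gt0.
pose rho0 := Num.min 16^-1 (y `^ (s * p)^-1).
have rho00 : 0 < rho0 by rewrite lt_min powR_gt0// andbT invr_gt0.
have rho16 : rho0 <= 16^-1 by rewrite ge_min lexx.
have small_rho : C1 * rho0 `^ (s * p) <= ballc / 2 * lam ^+ N * (k / 16) `^ p.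
  rewrite mulrC -ler_pdivlMr// -/y.
  apply: (@le_trans _ _ ((y `^ (s * p)^-1) `^ (s * p))).
    apply: ge0_ler_powR; rewrite ?nnegrE ?powR_ge0 ?(ltW sp0) ?(ltW rho00)//.
    by rewrite ge_min lexx orbT.
  by rewrite -powRrM mulVf ?gt_eqF// powRr1// ltW.
pose B := ballc / 2 * rho0 ^+ N.
have B0 : 0 < B by rewrite mulr_gt0 ?exprn_gt0// divr_gt0.
pose v := C1 * 2 ^+ N / B; have v0 : 0 < v by rewrite divr_gt0// mulr_gt0// exprn_gt0.
have f1 : 0 < @farc R N s p k r.
  rewrite /farc; apply: mulr_gt0; last by rewrite invr_gt0 powR_gt0//; lra.
  by apply: mulr_gt0; [rewrite powR_gt0|exact: divr_gt0].
exists (v / @farc R N s p k r + (2 * k) `^ (p - 1) * Int (inball x0 r)) => f hf HQ.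
have Hv : v <= @farc R N s p k r * (Int (fun x => inball x0 r x * f x `^ (p - 1)) -
                (2 * k) `^ (p - 1) * Int (inball x0 r)).
  by rewrite -ler_pdivrMl// mulrC lerBrDr.
have start := level_global hs hp k0 c0 hf CT0 HCT r0 v0 Hv.
have vB : levelC p k c CT * 2 ^+ N / v = B.
  by rewrite /v -/C1; field; rewrite !gt_eqF ?exprn_gt0.
rewrite vB in start.
have null := sub_null hN hs hp k0 c0 hf CT0 HCT rho00 rho16 lam0 lam12 lam_sp small_rho start.
exists (sub x0 k f (k / 2)); split => //.
  rewrite /sub; apply: measurable_boolset; apply: measurable_fun_ltr => //.
  by apply: measurable_tilt; case: hf => _ [].
move=> x /= nx; apply: contrapT => tx; apply: nx => dx; rewrite leNgt; apply/negP => fx; apply: tx.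
rewrite /sub/= /tilt.
have : k * edist x0 x < k * 4^-1 by rewrite ltr_pM2l.
lra.
Qed.

End local_positivity.

(** * Singular data and pointwise values *)

Section singular_data.
Context {R : realType} {N : nat}.
Hypothesis hN : (0 < N)%N.
Local Notation T := (Rn R N).
Local Notation mu := (@lebesgueRn R N).
Local Notation ballc := (@ballc R N).
Implicit Types (f g w : T -> R) (a b c r k : R).

(** Since [gamma <= -N], each annulus of a geometric sequence shrinking to [x0]
    contributes at least the same amount [d]. *)
Lemma integral_homogeneous_infty (x0 : T) (B gamma : R) (m : nat) (M : R) :
  0 < B -> gamma <= - N%:R ->
  (\int[mu]_x (B * edist x0 x `^ gamma * chi x0 2^-1 m x)%:E <= M%:E)%E -> False.
Proof.
move=> B0 hg HM; have b0 := @ballc_gt0 R N hN.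
have b1 : ballc <= 1.
  by rewrite /ballc invf_le1 ?exprn_gt0 ?ltr0n// exprn_ege1// ler1n.
pose g x := B * edist x0 x `^ gamma * chi x0 2^-1 m x.
have g0 x : 0 <= g x by rewrite !mulr_ge0 ?powR_ge0 ?chi_ge0// ltW.
have mg : measurable_fun setT g.
  apply: measurable_funM; last exact: measurable_chi.
  by apply: measurable_funM => //; apply: measurable_powRn; exact: measurable_edistl.
pose I r x : R := (edist x0 x < r)%R%:R.
have mI r : measurable_fun setT (I r).
  by apply: measurable_boolR; apply: measurable_fun_ltr => //; exact: measurable_edistl.
have I0 r x : 0 <= I r x by exact: ler0n.
pose d := B * (4^-1) ^+ m * (ballc / 2).
have d0 : 0 < d by rewrite /d !mulr_gt0 ?exprn_gt0 ?divr_gt0.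
(* the ratio is such that the inner ball has at most half the volume of the
   outer one, with the crude bounds on volumes *)
pose lam := ballc / 4; have lam0 : 0 < lam by rewrite divr_gt0.
have lam1 : lam <= 1 by rewrite /lam; lra.
have step r : 0 < r <= 4^-1 -> (d%:E + \int[mu]_x (g x * I (lam * r) x)%:E <=
    \int[mu]_x (g x * I r x)%:E)%E.
  move=> /andP[r0 r4].
  pose A := eball x0 r `&` ~` eball x0 (lam * r).
  have mA : measurable A.
    by apply: measurableI; [exact: measurable_eball|apply: measurableC; exact: measurable_eball].
  have muA : ((ballc / 2 * r ^+ N)%:E <= mu A)%E.
    apply: (ball_remainder hN r0 mA (measurable_eball x0 (lam * r)) (x := x0)).
      by move=> y xy; have [ty|ty] := pselect (eball x0 (lam * r) y); [right|left].
    apply: (le_trans (eball_le x0 (mulr_gt0 lam0 r0))).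
    rewrite lee_fin mulrA exprMn ler_wpM2r ?exprn_ge0 ?(ltW r0)//.
    have -> : 2 * lam = ballc / 2 by rewrite /lam; field.
    by apply: ler_iXnr => //; rewrite ?divr_ge0 ?(ltW b0)//; lra.
  pose c := B * r `^ gamma * (4^-1) ^+ m.
  have c0 : 0 <= c by rewrite !mulr_ge0 ?powR_ge0 ?exprn_ge0// ltW.
  have dc : (d%:E <= c%:E * mu A)%E.
    apply: (@le_trans _ _ (c%:E * (ballc / 2 * r ^+ N)%:E)%E); last exact: lee_wpmul2l.
    rewrite -EFinM lee_fin.
    have -> : c * (ballc / 2 * r ^+ N) = d * (r `^ gamma * r ^+ N) by rewrite /c /d; ring.
    rewrite ler_peMr ?(ltW d0)// -powR_mulrn ?(ltW r0)// -gt0_powRD// -[leLHS](powRr0 r).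
    rewrite ger_powR ?r0//; first by lra.
    by rewrite -lerBrDr sub0r.
  apply: (le_trans (leeD dc (lexx _))).
  have <- : (\int[mu]_y (c * \1_A y)%:E = c%:E * mu A)%E.
    by rewrite intZ// integral_indic// setIT.
  have mc : measurable_fun setT (fun x => c * \1_A x : R).
    by apply: measurable_funM => //; exact: measurable_indic.
  have c1 x : 0 <= c * \1_A x :> R by rewrite mulr_ge0.
  have mgI r' : measurable_fun setT (fun x => g x * I r' x) by exact: measurable_funM.
  have gI0 r' x : 0 <= g x * I r' x by rewrite mulr_ge0.
  rewrite -(intD _ mc (mgI _) c1 (gI0 _)).
  apply: int_le => [||x|x]; [exact: measurable_funD|exact: mgI|by rewrite addr_ge0|].
  have lr : lam * r <= r by rewrite ler_piMl// ltW.
  rewrite /I indicE; case: (ltP (edist x0 x) (lam * r)) => xl.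
    rewrite (lt_le_trans xl lr) memNset ?mulr0 ?add0r//.
    by move=> -[_]; apply.
  rewrite mulr0 addr0; have [xA|xA] := boolP (x \in A); last by rewrite mulr0 mulr_ge0.
  move: xA; rewrite inE => -[xr _]; have xr' : edist x0 x < r by [].
  rewrite xr' !mulr1 /c /g.
  have x0' : 0 < edist x0 x by apply: lt_le_trans xl; exact: mulr_gt0.
  apply: ler_pM; rewrite ?mulr_ge0 ?powR_ge0 ?exprn_ge0 ?(ltW B0)//.
    apply: ler_wpM2l; first exact: ltW.
    have -> : gamma = - (- gamma) by rewrite opprK.
    rewrite (powRN r) (powRN (edist x0 x)) lef_pV2 ?posrE ?powR_gt0//.
    apply: ge0_ler_powR; rewrite ?nnegrE ?(ltW x0') ?(ltW r0) ?(ltW xr')//.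
    by rewrite oppr_ge0 (le_trans hg)// oppr_le0.
  rewrite /chi lerXn2r ?nnegrE ?theta_ge0 ?invr_ge0//.
  apply: (@le_trans _ _ (2^-1 - edist x0 x)); last by rewrite le_max lexx.
  by move: xr' r4; clear; set e := edist _ _; lra.
have iter (J : nat) r : 0 < r <= 4^-1 -> ((J%:R * d)%:E <= \int[mu]_x (g x * I r x)%:E)%E.
  elim: J r => [|J IH] r hr.
    by rewrite mul0r; apply: int_ge0 => x; rewrite mulr_ge0.
  apply: le_trans (step r hr); rewrite -natr1 mulrDl mul1r addrC EFinD.
  apply: leeD => //; apply: IH; have [r0 r4] := andP hr.
  by rewrite mulr_gt0//= (le_trans _ r4)// ler_piMl// ltW.
pose J := Num.bound (M / d).
have h4 : 0 < (4^-1 : R) <= 4^-1 by apply/andP; split; rewrite // invr_gt0.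
have H : ((J%:R * d)%:E <= M%:E)%E.
  apply: le_trans HM; apply: (le_trans (iter J _ h4)).
  apply: int_le => [||x|x]; [exact: measurable_funM|exact: mg|by rewrite mulr_ge0|].
  by rewrite -/(g x) /I; case: ltP => _; rewrite ?mulr1 ?mulr0.
have M0 : 0 <= M.
  by rewrite -lee_fin; apply: le_trans HM; apply: int_ge0.
have MJ : M / d < J%:R by apply: archi_boundP; rewrite divr_ge0// ltW.
by move: H; rewrite lee_fin leNgt -ltr_pdivrMr// MJ.
Qed.

Lemma fatou_ae (u : nat -> T -> R) g (M : R) : (forall n, measurable_fun setT (u n)) ->
  (forall n x, 0 <= u n x) -> (forall x, 0 <= g x) -> measurable_fun setT g ->
  {ae mu, forall x, u n x @[n --> \oo] --> g x} ->
  (forall n, (\int[mu]_x (u n x)%:E <= M%:E)%E) -> (\int[mu]_x (g x)%:E <= M%:E)%E.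
Proof.
move=> mu_ u0 g0 mg [A [mA A0 Acvg]] uM.
pose v n x := if x \in A then g x else u n x.
have v0 n x : 0 <= v n x by rewrite /v; case: ifP.
have mv n : measurable_fun setT (v n).
  apply: measurable_fun_ifT => //.
  apply: (measurable_fun_bool true); rewrite setTI (_ : _ @^-1` _ = A)//.
  by apply/seteqP; split => x /= h; [exact: set_mem|exact: mem_set].
have vcvg x : (v n x)%:E @[n --> \oo] --> (g x)%:E.
  have [xA|xA] := boolP (x \in A).
    rewrite (_ : (fun n => (v n x)%:E) = cst (g x)%:E); first exact: cvg_cst.
    by apply/funext => n; rewrite /v xA.
  rewrite (_ : (fun n => (v n x)%:E) = (fun n => (u n x)%:E)); last first.
    by apply/funext => n; rewrite /v (negbTE xA).
  apply: cvg_EFin; first exact: nearW.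
  have [//|ncvg] := pselect (u n x @[n --> \oo] --> g x).
  by exfalso; move: xA; rewrite notin_setE; apply; apply: Acvg.
have vM n : (\int[mu]_x (v n x)%:E <= M%:E)%E.
  rewrite (_ : integral _ _ _ = \int[mu]_x (u n x)%:E)%E//.
  apply: int_ae_eq => //; exists A; split => // x /= nx.
  by apply: contrapT => xA; apply: nx; rewrite /v memNset.
have F : (\int[mu]_x limn_einf (fun n => (v n x)%:E) <=
    limn_einf (fun n => \int[mu]_x (v n x)%:E))%E.
  apply: (@fatou _ _ _ mu setT measurableT (fun n x => (v n x)%:E)) => [n|n x _].
    by apply/measurable_EFinP; exact: mv.
  by rewrite lee_fin.
have -> : (\int[mu]_x (g x)%:E = \int[mu]_x limn_einf (fun n => (v n x)%:E))%E.
  by apply: eq_integral => x _; have [-> _] := cvg_limn_einf_sup (vcvg x).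
apply: (le_trans F); rewrite limn_einf_lim; apply: lime_le; first exact: is_cvg_einfs.
apply: nearW => n; apply: le_trans (vM n).
by apply: ereal_inf_lbound; exists n => /=.
Qed.

Lemma precise_value_ge w (x : T) r0 k : measurable_fun setT w -> 0 < r0 -> 0 <= k ->
  {ae mu, forall y, edist x y < r0 -> k <= w y} -> (k%:E <= precise_value w x)%E.
Proof.
move=> mw r00 k0 kw; rewrite /precise_value limf_einfE.
set av := (fun r : R => _).
pose V : set R := [set r | 0 < r < r0].
apply: (@le_trans _ _ (ereal_inf (av @` V))); last first.
  apply: ereal_sup_ubound; exists V => //.
  exists r0 => //= r; rewrite /ball/= sub0r normrN => rr r1.
  by rewrite /V/= r1/=; move: rr; rewrite gtr0_norm.
apply: le_ereal_inf_tmp => _ [r /andP[r1 rr0] <-]; rewrite /av.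
have mB := measurable_eball x r.
have BE : mu (eball x r) = (fine (mu (eball x r)))%:E.
  by rewrite fineK// ge0_fin_numE// eball_fin.
have Bpos : 0 < fine (mu (eball x r)).
  rewrite -lte_fin -BE; apply: lt_le_trans (eball_ge x hN r1).
  by rewrite lte_fin mulr_gt0 ?ballc_gt0// exprn_gt0.
rewrite BE inver gt_eqF// lee_pdivlMl// -BE muleC.
pose w' y := Num.max (w y) k.
have mw' : measurable_fun setT w' by apply: measurable_maxr.
have -> : (\int[mu]_(y in eball x r) (w y)%:E = \int[mu]_(y in eball x r) (w' y)%:E)%E.
  apply: ae_eq_integral => //.
  - by apply: measurable_funTS; exact/measurable_EFinP.
  - by apply: measurable_funTS; exact/measurable_EFinP.
  - apply: filterS kw => y ky yB; rewrite /w' max_l// ky//.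
    exact: lt_trans yB rr0.
rewrite -integral_cst//; apply: ge0_le_integral => //.
- by apply: measurable_funTS; exact/measurable_EFinP.
- by move=> y _; rewrite lee_fin le_max lexx orbT.
Qed.

End singular_data.

(** * Blow-up of the minimal solution *)

Section blow_up.
Context {R : realType} {N : nat} (s p p1 A gamma : R).
Hypotheses (hN : (1 <= N)%N) (hs : 0 < s < 1) (hp1 : 1 < p1 < 2)
  (hp1_root : s * p1 * (p1 - 1) = N%:R * (2 - p1)) (hp : p1 <= p < 2) (hA : 0 < A)
  (hgamma : gamma <= - N%:R).
Local Notation T := (Rn R N).
Local Notation mu := (@lebesgueRn R N).

Lemma p_range : 1 < p < 2.
Proof. by have [? ?] := andP hp1; have [? ?] := andP hp; apply/andP; split => //; lra. Qed.

(** The function [s p (p - 1) - N (2 - p)] increases with [p] and vanishes at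
    [p1]. *)
Lemma critical_exponent : N%:R * (2 - p) <= s * p * (p - 1).
Proof.
have [a1 a2] := andP hp1; have [b1 b2] := andP hp; have [s0 s1] := andP hs.
apply: (@le_trans _ _ (N%:R * (2 - p1))); first by rewrite ler_wpM2l//; lra.
rewrite -hp1_root -!mulrA ler_wpM2l ?(ltW s0)// ler_pM//; lra.
Qed.

(** Both conditions hold for [q = 1] with strict inequality, the second one
    because [N (2 - p) < s p] by [critical_exponent]. *)
Lemma exponent_choice : exists2 q : R, 0 < q < 1 &
  0 <= p - 2 + q /\ 3 - p <= q * (1 + s * p / N%:R).
Proof.
have [q1 q2] := andP p_range; have [s0 s1] := andP hs.
have N0 : 0 < N%:R :> R by rewrite ltr0n.
have sp0 : 0 < s * p by rewrite mulr_gt0//; lra.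
have H : 2 - p < s * p / N%:R.
  rewrite ltr_pdivlMr// mulrC; apply: (le_lt_trans critical_exponent).
  by rewrite gtr_pMr//; lra.
have d0 : 0 < 1 + s * p / N%:R by lra.
exists (Num.max (2 - p) ((3 - p) / (1 + s * p / N%:R))).
  apply/andP; split; first by rewrite lt_max; apply/orP; left; lra.
  by rewrite gt_max; apply/andP; split; [lra|rewrite ltr_pdivrMr// mul1r; lra].
split.
  have : 2 - p <= Num.max (2 - p) ((3 - p) / (1 + s * p / N%:R)) by rewrite le_max lexx.
  lra.
by rewrite -ler_pdivrMr// le_max lexx orbT.
Qed.

Variables (u0n : nat -> T -> R) (un : nat -> R -> T -> R).
Hypotheses (hu0n_ge0 : forall n, {ae mu, forall x, 0 <= u0n n x})
  (hu0n_nd : forall n, {ae mu, forall x, u0n n x <= u0n n.+1 x})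
  (hu0n_cvg : {ae mu, forall x, u0n n x @[n --> \oo] --> A * (enorm x) `^ gamma})
  (hun : forall n, semigroup_solution s p (u0n n) (un n)).

Let v n t : T -> R := pos (un n t).

Let v_ge0 n t x : 0 <= v n t x. Proof. exact: pos_ge0. Qed.

Let un_flow n : flow s p (un n). Proof. exact: gradient_flow_flow (hun n). Qed.

Let un0 n : {ae mu, forall x, un n 0 x = u0n n x}. Proof. by case: (hun n). Qed.

Let un_ge0 n t : 0 <= t -> {ae mu, forall x, 0 <= un n t x}.
Proof.
move=> t0; apply: (flow_ge0 p_range (un_flow n)) => //.
by apply: filterS2 (un0 n) (hu0n_ge0 n) => x ->.
Qed.

Let v_ae n t : 0 <= t -> {ae mu, forall x, un n t x = v n t x}.
Proof. by move=> t0; apply: filterS (un_ge0 n t0) => x u0; rewrite /v /pos max_l. Qed.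

Let un2 n t : 0 <= t -> sqint (un n t).
Proof. by case: (un_flow n) => H _ _; exact: H. Qed.

Let v2 n t : 0 <= t -> sqint (v n t).
Proof. by move=> t0; apply: sqint_pos; exact: un2. Qed.

Let v_flow n : flow s p (v n).
Proof.
apply: (flow_ae (un_flow n)) => t t0; first by have [] := v2 n t0.
exact: v_ae.
Qed.

Let u0_mono n n' : (n <= n')%N -> {ae mu, forall x, u0n n x <= u0n n' x}.
Proof.
elim: n' => [|n' IH]; first by rewrite leqn0 => /eqP ->; apply: aeW => x; rewrite lexx.
rewrite leq_eqVlt => /orP[/eqP ->|]; first by apply: aeW => x; rewrite lexx.
rewrite ltnS => /IH H; apply: filterS2 H (hu0n_nd n') => x; exact: le_trans.
Qed.

Let v_mono n n' t : 0 <= t -> (n <= n')%N -> {ae mu, forall x, v n t x <= v n' t x}.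
Proof.
move=> t0 nn; apply: (flow_comparison p_range (v_flow n) (v_flow n')) => //.
have v0 k := @v_ae k 0 (lexx 0).
apply: filterS2 (u0_mono nn) (filterI (filterI (un0 n) (un0 n')) (filterI (v0 n) (v0 n'))) => x H.
by case=> -[E1 E2] [E3 E4]; rewrite -E3 -E4 E1 E2.
Qed.

Lemma initial_mass_unbounded m M : (2 <= m)%N ->
  exists n, M < Int (fun x => v n 0 x * chi (@zeroRn R N) 2^-1 m x).
Proof.
move=> hm; have hr : 0 < (2^-1 : R) <= 1 by rewrite invr_gt0 ltr0n/= invf_le1// ler1n.
apply: contrapT => nM; apply: (@integral_homogeneous_infty R N hN (@zeroRn R N) A gamma m M hA hgamma).
have v0 n := v2 n (lexx 0).
have mchi := @measurable_chi R N (@zeroRn R N) 2^-1 m.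
have c0 x : 0 <= chi (@zeroRn R N) 2^-1 m x by exact: chi_ge0.
apply: (@fatou_ae R N (fun n x => v n 0 x * chi (@zeroRn R N) 2^-1 m x)) => [n|n x|x|||n].
- by apply: measurable_funM mchi; exact: (v0 n).1.
- by rewrite mulr_ge0.
- by rewrite !mulr_ge0 ?powR_ge0// ltW.
- apply: measurable_funM mchi; apply: measurable_funM => //.
  by apply: measurable_powRn; exact: measurable_edistl.
- have H : {ae mu, forall x, forall n, v n 0 x = u0n n x}.
    apply: ae_foralln => n; apply: filterS2 (un0 n) (v_ae n (lexx 0)) => x.
    by move=> <- ->.
  apply: filterS2 H hu0n_cvg => x E cv; rewrite -enormE.
  apply: cvgMl.
  by rewrite (_ : (fun n => v n 0 x) = (fun n => u0n n x)); [exact: cv|apply/funext => n; rewrite E].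
- have i1 : L1 (fun x => v n 0 x * chi (@zeroRn R N) 2^-1 m x).
    exact: sqint_mul (v0 n) (sqint_chi _ hr hm).
  rewrite -int_Rfine// lee_fin leNgt; apply/negP => H; apply: nM; exists n.
  exact: H.
Qed.

(** Otherwise [bounded_mass] bounds the local masses at time [t], and by
    [mass_lower_bound] the initial ones. *)
Lemma local_mass_unbounded t Q : 0 < t ->
  exists n, Q < Int (fun x => inball (@zeroRn R N) 1 x * v n t x `^ (p - 1)).
Proof.
move=> t0; have hp' := p_range; have [q1 q2] := andP hp'; have [s0 s1] := andP hs.
have sp0 : 0 < s * p by rewrite mulr_gt0//; lra.
have [q hq [hpq step2]] := exponent_choice.
have [c c0 Hsup] := @flow_supersolution R N s p hp' t t0.
(* the exponent [m] of the cutoff has to suit both applications of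
   [power_absorb] *)
pose a1 := s * p + s * p * (p - 2 + q) / (q - (p - 2 + q)).
pose a2 := s * p + s * p * ((2 - p / 2) * (p - 1)) / (1 - (2 - p / 2) * (p - 1)).
pose m := (maxn 2 (maxn (Num.truncn a1).+1 (Num.truncn a2).+1)).
have hm : (2 <= m)%N by rewrite leq_maxl.
have trunc (a : R) : a <= (Num.truncn a).+1%:R by apply: ltW; exact: truncnS_gt.
have hm1 : a1 <= m%:R.
  by apply: le_trans (trunc a1) _; rewrite ler_nat /m !leq_max leqnn !orbT.
have hm2 : a2 <= m%:R.
  by apply: le_trans (trunc a2) _; rewrite ler_nat /m !leq_max leqnn !orbT.
have hr : 0 < (2^-1 : R) <= 1 by rewrite invr_gt0 ltr0n/= invf_le1// ler1n.
have [c1 c10 [M1 HM1]] := mass_lower_bound hs hp' (@zeroRn R N) hr hm hm2 t0.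
have t1 := ltW t0.
apply: contrapT => nQ.
have fQ n : Int (fun x => inball (@zeroRn R N) 1 x * v n t x `^ (p - 1)) <= Q.
  by rewrite leNgt; apply/negP => H; apply: nQ; exists n.
have hf n : supersolution s p c (v n t).
  by apply: (Hsup _ (v_flow n)) => r x _; exact: v_ge0.
have [n0 [M2 HM2]] := @bounded_mass R N s p hN hs hp' (@zeroRn R N) (fun n => v n t) Q
  (fun n x => v_ge0 n t x) (fun n => v2 n t1) (fun n n' => v_mono t1) fQ q c m hm hq hpq c0 hm1 hf
  critical_exponent step2.
have [n1 Hn1] := initial_mass_unbounded ((M2 + M1) / c1) hm.
pose n := maxn n0 n1.
have H1 := HM2 n (leq_maxl _ _).
have H2 := HM1 _ (v_flow n) (fun h x _ => v_ge0 n h x).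
have H3 : Int (fun x => v n1 0 x * chi (@zeroRn R N) 2^-1 m x) <=
    Int (fun x => v n 0 x * chi (@zeroRn R N) 2^-1 m x).
  apply: Int_ae_le.
  - exact: sqint_mul (v2 n1 (lexx 0)) (sqint_chi _ hr hm).
  - exact: sqint_mul (v2 n (lexx 0)) (sqint_chi _ hr hm).
  - by apply: filterS (v_mono (lexx 0) (leq_maxr n0 n1)) => x H; rewrite ler_wpM2r ?chi_ge0.
have H4 := lt_le_trans Hn1 H3.
rewrite ltr_pdivrMr// in H4.
have := le_trans H2 H1; rewrite lerBlDr mulrC => H5.
by have := lt_le_trans H4 H5; rewrite ltxx.
Qed.

Lemma minimal_solution_blow_up (x : T) t : 0 < t ->
  precise_value (un n t) x @[n --> \oo] --> +oo%E.
Proof.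
move=> t0; have hp' := p_range; have [q1 q2] := andP hp'; have t1 := ltW t0.
apply/cvgeyPge => M.
pose k := 4 * Num.max M 1.
have k1 : 1 <= Num.max M 1 by rewrite le_max lexx orbT.
have k0 : 0 < k by rewrite mulr_gt0//; lra.
pose r := edist x (@zeroRn R N) + 1.
have r0 : 0 < r by rewrite ltr_wpDl// edist_ge0.
have [c c0 Hsup] := @flow_supersolution R N s p hp' t t0.
have [Q HQ] := local_positivity hN hs hp' x k0 r0 c0.
have [n0 Hn0] := local_mass_unbounded Q t0.
exists n0 => // n /= nn.
have f0 n' y : 0 <= v n' t y := v_ge0 n' t y.
have hf : supersolution s p c (v n t).
  by apply: (Hsup _ (v_flow n)) => h y _; exact: v_ge0.
have mF n' r' z : measurable_fun setT (fun y => inball z r' y * v n' t y `^ (p - 1)).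
  apply: measurable_funM; first exact: measurable_inball.
  by apply: measurable_powRn; exact: (v2 n' t1).1.
have iF n' r' z : L1 (fun y => inball z r' y * v n' t y `^ (p - 1)).
  apply: (@L1_quadratic R N z _ (v n' t) r' 1 1 (mF n' r' z) (v2 n' t1)) => y.
  rewrite ger0_norm ?mulr_ge0 ?powR_ge0 ?inball_ge0// !mul1r.
  rewrite /inball; case: ltP => _; rewrite ?mul1r ?mul0r ?add0r ?sqr_ge0//.
  exact: powR_le_quadratic.
have H1 : Q <= Int (fun y => inball x r y * v n t y `^ (p - 1)).
  apply: (le_trans (ltW Hn0)); apply: Int_ae_le; [exact: iF|exact: iF|].
  apply: filterS (v_mono t1 nn) => y vy.
  apply: ler_pM; rewrite ?inball_ge0 ?powR_ge0//; last first.
    by apply: ge0_ler_powR; rewrite ?nnegrE//; lra.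
  rewrite /inball; case: (ltP (edist zeroRn y) 1) => y1; last exact: ler0n.
  rewrite (_ : (edist x y < r) = true)// /r.
  by apply: (le_lt_trans (edist_triangle (@zeroRn R N) x y)); rewrite ltrD2l.
have pos := HQ _ hf H1.
have k4 : k / 4 = Num.max M 1 by rewrite /k; field.
apply: (@le_trans _ _ (k / 4)%:E); first by rewrite lee_fin k4 le_max lexx.
apply: (@precise_value_ge R N hN (un n t) x 4^-1 (k / 4)).
- exact: (un2 n t1).1.
- by rewrite invr_gt0.
- by rewrite divr_ge0// ltW.
- by apply: filterS2 pos (v_ae n t1) => y H E yd; rewrite E; exact: H.
Qed.

End blow_up.

Unset Implicit Arguments.

Theorem theorem7p4 (R : realType) (N : nat) (s p p1 A gamma : R)
    (hN : (1 <= N)%N) (hs : 0 < s < 1)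
    (hp1 : 1 < p1 < 2) (hp1_root : s * p1 * (p1 - 1) = N%:R * (2 - p1))
    (hp : p1 <= p < 2) (hA : 0 < A)
    (hgamma : - (s * p / (2 - p)) <= gamma <= - N%:R)
    (u0n : nat -> Rn R N -> R) (un : nat -> R -> Rn R N -> R)
    (hu0n_L1 : forall n, u0n n \in Lfun (lebesgueRn R N) 1%E)
    (hu0n_Loo : forall n, u0n n \in Lfun (lebesgueRn R N) +oo%E)
    (hu0n_ge0 : forall n, {ae lebesgueRn R N, forall x, 0 <= u0n n x})
    (hu0n_nd : forall n, {ae lebesgueRn R N, forall x, u0n n x <= u0n n.+1 x})
    (hu0n_cvg : {ae lebesgueRn R N, forall x,
       u0n n x @[n --> \oo] --> A * (enorm x) `^ gamma})
    (hun : forall n, semigroup_solution s p (u0n n) (un n)) :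
  forall (x : Rn R N) (t : R), 0 < t ->
    precise_value (un n t) x @[n --> \oo] --> +oo%E.
Proof.
move=> x t t0; have [_ hg] := andP hgamma.
exact: (minimal_solution_blow_up hN hs hp1 hp1_root hp hA hg hu0n_ge0 hu0n_nd hu0n_cvg hun x t0).
Qed.
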